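(* Let $r$ and $n$ be integers with either ($r\ge 5$, $r\ne 6$, $r\ne 10$, $n\ge 3$) or ($r=10$, $n\ge 5$). Let $$\rho_n^{(2,r)}=\bigoplus_{\lambda\in\Lambda_n^{(2,r)}}\rho_\lambda^{(2,r)}:\ B_n\to\prod_{\lambda\in\Lambda_n^{(2,r)}}U(V_\lambda^{(2,r)})$$ be the (unitary) Jones representation of the $n$-strand braid group. Then the closure $\overline{\rho_n^{(2,r)}(B_n)}$ contains $\prod_{\lambda\in\Lambda_n^{(2,r)}}SU(V_\lambda^{(2,r)})$.
   Context: Fix an integer $r\ge 3$ and let $q=e^{2\pi i/r}$ or $q=e^{-2\pi i/r}$, with $q^{1/2}=e^{\pm\pi i/r}$ (same sign) and $q^{m/2}=(q^{1/2})^m$. Quantum integers: $[m]=\frac{q^{m/2}-q^{-m/2}}{q^{1/2}-q^{-1/2}}$, so $[2]=2\cos(\pi/r)$. $B_n$ denotes the braid group with standard generators $\sigma_1,\dots,\sigma_{n-1}$. A Young diagram $\lambda=[\lambda_1,\dots,\lambda_k]$, $\lambda_1\ge\dots\ge\lambda_k\ge 0$ (empty rows allowed), has $n=\sum\lambda_i$ boxes; a standard tableau of shape $\lambda$ is a filling of the boxes by $1,\dots,n$ increasing along rows and columns. For integers $k,r$ with $r\ge k+1$, a diagram $\lambda$ with at most $k$ rows is $(k,r)$-admissible if $\lambda_1-\lambda_k\le r-k$. For a standard tableau $t$ with $n$ boxes, $t^{(i)}$ ($0\le i\le n$) is obtained by deleting the boxes containing $n,n-1,\dots,n-i+1$; $t$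 is $(k,r)$-admissible if the shape of every $t^{(i)}$ is $(k,r)$-admissible. If entries $m,m'$ of $t$ lie in rows $r_1,r_2$ and columns $c_1,c_2$, put $d_{t,m,m'}=(c_1-c_2)-(r_1-r_2)$. For $1\le i\le n-1$ and $d=d_{t,i,i+1}$ put $\alpha_{t,i}=\frac{[d+1]}{[2][d]}$ and $\beta_{t,i}=\sqrt{\alpha_{t,i}(1-\alpha_{t,i})}$. Let $V_\lambda^{(k,r)}$ be the Hilbert space with orthonormal basis $\{v_t\}$, $t$ ranging over $(k,r)$-admissible standard tableaux of shape $\lambda$, and let $s_i(t)$ be $t$ with entries $i,i+1$ swapped. Define $E_i v_t=\alpha_{t,i}v_t+\beta_{t,i}v_{s_i(t)}$ if $s_i(t)$ is a $(k,r)$-admissible standard tableau, and $E_iv_t=\alpha_{t,i}v_t$ otherwise (then $\alpha_{t,i}\in\{0,1\}$). The Jones–Wenzl sector is the unitary representation $\rho_\lambda^{(k,r)}:B_n\to U(V_\lambda^{(k,r)})$, $\sigma_i\mapsto q\,\mathrm{Id}-(1+q)E_i$. $\Lambda_n^{(k,r)}$ is the set of $(k,r)$-admissible Young diagrams with $n$ boxes. $SU(V)$ denotes the special unitary group of a Hilbert space $V$ (trivial if $\dim V=1$). *)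

(* Defs.v *)
From HB Require Import structures.
From mathcomp Require Import all_boot all_order all_algebra.
From mathcomp Require Import all_classical all_reals.
From mathcomp Require Import trigo.
From mathcomp Require Import complex.
Unset Printing Implicit Defensive.
Import Order.TTheory GRing.Theory Num.Theory.
Local Open Scope ring_scope.

Section Jones.
Variable R : realType.
Local Notation C := R[i].

Definition qhalf (b : bool) (r : nat) : C :=
  Complex (cos (pi / r%:R)) ((if b then 1 else -1) * sin (pi / r%:R)).

Definition qq (b : bool) (r : nat) : C := qhalf b r ^+ 2.

Definition qint (b : bool) (r : nat) (m : int) : C :=
  (qhalf b r ^ m - qhalf b r ^ (- m)) / (qhalf b r - (qhalf b r)^-1).

(* A Young diagram with at most k rows is a sequence lam of length k,
   lam_1 >= ... >= lam_k >= 0 (empty rows allowed); rows are indexed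
   0..k-1 here. *)
Definition young_diag (k : nat) (lam : seq nat) : bool :=
  (size lam == k) && sorted geq lam.

Definition adm_diag (k r : nat) (lam : seq nat) : bool :=
  young_diag k lam && (nth 0 lam 0 - nth 0 lam k.-1 <= r - k)%N.

Definition in_Lambda (k r n : nat) (lam : seq nat) : bool :=
  adm_diag k r lam && (sumn lam == n).

(* A filling of n boxes by 1..n is encoded as an n-tuple t of positions
   (row, column): the entry m (1 <= m <= n) sits in box t_(m-1).
   (In a diagram with n boxes, every row index is < k and every column
   index is < n.) *)
Definition tabl (k n : nat) := n.-tuple ('I_k * 'I_n)%type.

Definition pos (k n : nat) (t : tabl k n) (m : nat) : nat * nat :=
  nth (0, 0)%N [seq (nat_of_ord p.1, nat_of_ord p.2) | p <- t] m.-1.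

Definition in_shape (k n : nat) (lam : seq nat) (p : 'I_k * 'I_n) : bool :=
  (nat_of_ord p.2 < nth 0 lam p.1)%N.

Definition standard (k n : nat) (lam : seq nat) (t : tabl k n) : bool :=
  [&& uniq t,
      all (@in_shape k n lam) t,
      [forall p : 'I_k * 'I_n, @in_shape k n lam p ==> (p \in t)],
      [forall a : 'I_n, forall b : 'I_n,
         ((tnth t a).1 == (tnth t b).1) && ((tnth t a).2 < (tnth t b).2)%N
           ==> (a < b)%N] &
      [forall a : 'I_n, forall b : 'I_n,
         ((tnth t a).2 == (tnth t b).2) && ((tnth t a).1 < (tnth t b).1)%N
           ==> (a < b)%N]].

(* shape of t^{(i)}: t with the boxes containing n, n-1, ..., n-i+1
   deleted, i.e. the boxes of the entries 1..n-i. *)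
Definition shape_sub (k n : nat) (t : tabl k n) (i : nat) : seq nat :=
  [seq count (fun p : 'I_k * 'I_n => nat_of_ord p.1 == j) (take (n - i) t)
  | j <- iota 0 k].

Definition adm_tabl (k r n : nat) (t : tabl k n) : bool :=
  [forall i : 'I_n.+1, adm_diag k r (shape_sub k n t i)].

Definition basis (k r n : nat) (lam : seq nat) : {set tabl k n} :=
  [set t | standard k n lam t && adm_tabl k r n t].

Definition dimV (k r n : nat) (lam : seq nat) : nat := #|basis k r n lam|.

Definition dcont (k n : nat) (t : tabl k n) (m m' : nat) : int :=
  (((pos k n t m).2)%:Z - ((pos k n t m').2)%:Z)
  - (((pos k n t m).1)%:Z - ((pos k n t m').1)%:Z).

Definition alpha (b : bool) (r k n : nat) (t : tabl k n) (i : nat) : C :=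
  let d := dcont k n t i i.+1 in qint b r (d + 1) / (qint b r 2 * qint b r d).

(* beta = sqrt(alpha (1 - alpha)); alpha is real, so we take the real
   square root of the real part. *)
Definition beta (b : bool) (r k n : nat) (t : tabl k n) (i : nat) : C :=
  let a := alpha b r k n t i in (Num.sqrt (complex.Re (a * (1 - a))))%:C%C.

Definition swap_tabl (k n : nat) (t : tabl k n) (i : nat) : tabl k n :=
  [tuple tnth t (if nat_of_ord j == i.-1 then insubd j i
                 else if nat_of_ord j == i then insubd j i.-1 else j)
  | j < n].

(* matrix of E_i in the orthonormal basis (v_t), indexed via enum_val;
   column t is the coordinate vector of E_i v_t. *)
Definition Emx (b : bool) (k r n : nat) (lam : seq nat) (i : nat)
  : 'M[C]_(dimV k r n lam) :=
  \matrix_(x, y)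
    let s := enum_val x in let t := enum_val y in
    (if s == t then alpha b r k n t i else 0)
    + (if s == swap_tabl k n t i then beta b r k n t i else 0).

Definition rho_gen (b : bool) (k r n : nat) (lam : seq nat) (i : nat)
  : 'M[C]_(dimV k r n lam) :=
  qq b r *: 1%:M - (1 + qq b r) *: Emx b k r n lam i.

(* A braid word: sequence of (i, e) standing for sigma_i (e = true) or
   sigma_i^{-1} (e = false), 1 <= i <= n-1.  Every element of B_n is the
   value of such a word, so rho(B_n) = { rho_word w }. *)
Definition braid_word (n : nat) (w : seq (nat * bool)) : bool :=
  all (fun x => (0 < x.1 < n)%N) w.

Definition rho_word (b : bool) (k r n : nat) (lam : seq nat)
  (w : seq (nat * bool)) : 'M[C]_(dimV k r n lam) :=
  \prod_(x <- w)
     (if x.2 then rho_gen b k r n lam x.1 else invmx (rho_gen b k r n lam x.1)).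

Definition adjmx (d : nat) (M : 'M[C]_d) : 'M[C]_d :=
  (map_mx (@conjc R) M)^T.

Definition special_unitary (d : nat) (M : 'M[C]_d) : Prop :=
  adjmx d M *m M = 1%:M /\ \det M = 1.

End Jones.

(* Main.v *)
(* For n boxes, the bases of all the sectors together are the lattice paths of
   length n in {0, ..., r-2} starting at 0: an entry in the first row is a step up,
   an entry in the second row a step down, and the sectors are told apart by the
   final height. So the Jones representation acts on the span of these paths, and
   sigma_i only moves the steps i and i+1.

   Let G be the group of images of braids, and call X tangent to G if it is a limit
   of c (g - 1) with g in G and c real, |c| -> oo. Tangent matrices form a real Lie
   algebra, stable under conjugation by G, whose one-parameter groups lie in the
   closure of G. By the spectral theorem every special unitary matrix of a sector
   lies on such a group, with a traceless velocity. It remains to show that the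
   complexification L of the tangent algebra contains the matrix units e_{s,t} for
   distinct paths s, t with the same final height. This goes by induction on m, for
   the units that act on the first m steps only. Such a unit is a sum of two units
   for m + 1 steps, with different final heights; conjugating it with sigma_m and
   comparing separates the two parts, as the eigenvalues -1 and q of sigma_m satisfy
   q^2 <> 1.

   For r <> 6, 10 the induction starts at m = 3. There sigma_1 acts on the height 1
   block as q - (1 + q) P, with P a projection of rank 1, and some odd k makes
   |1 + q^k| < 1, so that iterating Y |-> Y sigma_1^k Y^-1 from Y = sigma_2 produces
   elements that come as close to commuting with P as desired without ever doing
   so. Their commutators with sigma_1^k give a tangent vector.

   For r = 10 the image of B_3 is finite, and the induction starts at m = 5. For
   m = 4, the commutator of sigma_1 with its conjugate by sigma_2 sigma_3^2 sigma_2
   is a rotation with trace 3 - 2 y, where y = 2 cos (pi / 5). The Galois conjugate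
   of 3 - 2 y is larger than 2, so the rotation has infinite order, and its powers
   close to 1 give a tangent vector. *)
Require Import Defs.
From HB Require Import structures.
From mathcomp Require Import all_boot all_order all_algebra.
From mathcomp Require Import all_classical all_reals.
From mathcomp Require Import topology normedtype sequences derive realfun trigo.
From mathcomp Require Import perm complex spectral ring lra zify.
Import Order.TTheory GRing.Theory Num.Theory numFieldNormedType.Exports.
Local Open Scope ring_scope.
Set Implicit Arguments.
Unset Strict Implicit.

(** * Norms and adjoints *)

(** Density in the product is more than density in each factor, as two sectors might be linked by an
    isomorphism or a duality of their projective images. The price is that a unit for m steps only
    yields, at m + 1 steps, a sum over two heights that differ by 2. The separation proceeds from
    low heights to high ones, where the lower summand is already known; heights 1 and 2 start this
    process and need arguments of their own.

    Complex scalars enter because the separation takes eigencomponents under conjugation by unitary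
    matrices, and these are not skew-Hermitian. Nothing is lost, since a skew-Hermitian element of L
    is itself tangent. Tangency is defined by explicit limits, so no manifold structure on a closed
    group is used.

    For r = 10 the induction cannot start at m = 4: at height 0 the generators sigma_1 and sigma_3
    coincide, so this block sees only the finite group of three strands. *)

Notation "A ^H" := (@adjmx _ _ A) (at level 8, format "A ^H") : ring_scope.

Section Norm.
Variable R : realType.
Local Notation C := R[i].

Definition cabs (z : C) : R := complex.Re `|z|.

Lemma cabsE (z : C) : (cabs z)%:C%C = `|z|.
Proof. by rewrite /cabs RRe_real ?normr_real. Qed.

Lemma cabs_ge0 z : 0 <= cabs z.
Proof. by rewrite -lecR cabsE normr_ge0. Qed.

Lemma cabsM x y : cabs (x * y) = cabs x * cabs y.
Proof. by apply: complexI; rewrite rmorphM /= !cabsE normrM. Qed.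

Lemma cabsD x y : cabs (x + y) <= cabs x + cabs y.
Proof. by rewrite -lecR rmorphD /= !cabsE ler_normD. Qed.

Lemma cabsN x : cabs (- x) = cabs x.
Proof. by rewrite /cabs normrN. Qed.

Lemma cabs0 : cabs 0 = 0.
Proof. by rewrite /cabs normr0. Qed.

Lemma cabs1 : cabs 1 = 1.
Proof. by rewrite /cabs normr1. Qed.

Lemma cabs_eq0 z : (cabs z == 0) = (z == 0).
Proof.
rewrite -[RHS]normr_eq0 -cabsE; apply/eqP/eqP => [->//|]; exact: complexI.
Qed.

Lemma cabsJ z : cabs (z^*)%C = cabs z.
Proof. by rewrite /cabs normcJ. Qed.

Lemma cabsR (x : R) : cabs x%:C%C = `|x|.
Proof. by rewrite /cabs normc_def /= expr0n /= addr0 sqrtr_sqr. Qed.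

Lemma cabs_sqr z : ((cabs z) ^+ 2)%:C%C = z * (z^*)%C.
Proof. by rewrite rmorphXn /= cabsE sqr_normc. Qed.

Lemma cabs_sum (I : finType) (F : I -> C) : cabs (\sum_i F i) <= \sum_i cabs (F i).
Proof.
elim/big_ind2: _ => [|x a y b xa yb|//]; first by rewrite cabs0.
by apply: (le_trans (cabsD _ _)); apply: lerD.
Qed.

(* The l1 norm of the entries, which is submultiplicative. *)
Definition nm m n (A : 'M[C]_(m, n)) : R := \sum_i \sum_j cabs (A i j).

Lemma nm_ge0 m n (A : 'M[C]_(m, n)) : 0 <= nm A.
Proof. by apply: sumr_ge0 => i _; apply: sumr_ge0 => j _; apply: cabs_ge0. Qed.

Lemma nmD m n (A B : 'M[C]_(m, n)) : nm (A + B) <= nm A + nm B.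
Proof.
rewrite /nm -big_split; apply: ler_sum => i _; rewrite -big_split /=.
by apply: ler_sum => j _; rewrite mxE cabsD.
Qed.

Lemma nmZ m n (z : C) (A : 'M[C]_(m, n)) : nm (z *: A) = cabs z * nm A.
Proof.
rewrite /nm mulr_sumr; apply: eq_bigr => i _; rewrite mulr_sumr.
by apply: eq_bigr => j _; rewrite mxE cabsM.
Qed.

Lemma nmN m n (A : 'M[C]_(m, n)) : nm (- A) = nm A.
Proof. by rewrite -scaleN1r nmZ cabsN cabs1 mul1r. Qed.

Lemma nm0 m n : nm (0 : 'M[C]_(m, n)) = 0.
Proof. by rewrite -(scale0r 0) nmZ cabs0 mul0r. Qed.

Lemma nmB m n (A B : 'M[C]_(m, n)) : nm (A - B) <= nm A + nm B.
Proof. by rewrite -(nmN B) nmD. Qed.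

Lemma nm_entry m n (A : 'M[C]_(m, n)) i j : cabs (A i j) <= nm A.
Proof.
rewrite /nm (bigD1 i) //= (bigD1 j) //= -addrA lerDl addr_ge0 //.
  by apply: sumr_ge0 => k _; apply: cabs_ge0.
by apply: sumr_ge0 => k _; apply: sumr_ge0 => l _; apply: cabs_ge0.
Qed.

Lemma nmM m n p (A : 'M[C]_(m, n)) (B : 'M[C]_(n, p)) : nm (A *m B) <= nm A * nm B.
Proof.
rewrite /nm mulr_suml; apply: ler_sum => i _.
apply: (@le_trans _ _ (\sum_j \sum_k cabs (A i k) * cabs (B k j))).
  apply: ler_sum => j _; rewrite mxE; apply: (le_trans (cabs_sum _)).
  by apply: ler_sum => k _; rewrite cabsM.
rewrite exchange_big /= mulr_suml; apply: ler_sum => k _.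
rewrite -mulr_sumr ler_wpM2l ?cabs_ge0 //.
rewrite (bigD1 k) //= lerDl; apply: sumr_ge0 => l _.
by apply: sumr_ge0 => j _; apply: cabs_ge0.
Qed.

Lemma nm_eq0 m n (A : 'M[C]_(m, n)) : nm A <= 0 -> A = 0.
Proof.
move=> h; apply/matrixP => i j; rewrite mxE; apply/eqP; rewrite -cabs_eq0.
by rewrite eq_le cabs_ge0 andbT (le_trans (nm_entry _ _ _) h).
Qed.

Lemma adjE n (A : 'M[C]_n) i j : A^H i j = ((A j i)^*)%C.
Proof. by rewrite !mxE. Qed.

Lemma adjK n (A : 'M[C]_n) : (A^H)^H = A.
Proof. by apply/matrixP => i j; rewrite !adjE conjcK. Qed.

Lemma adjD n (A B : 'M[C]_n) : (A + B)^H = A^H + B^H.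
Proof. by apply/matrixP => i j; rewrite !(adjE, mxE) rmorphD. Qed.

Lemma adjN n (A : 'M[C]_n) : (- A)^H = - A^H.
Proof. by apply/matrixP => i j; rewrite !(adjE, mxE) rmorphN. Qed.

Lemma adjB n (A B : 'M[C]_n) : (A - B)^H = A^H - B^H.
Proof. by rewrite adjD adjN. Qed.

Lemma adjZ n z (A : 'M[C]_n) : (z *: A)^H = (z^*)%C *: A^H.
Proof. by apply/matrixP => i j; rewrite !(adjE, mxE) rmorphM. Qed.

Lemma adjM n (A B : 'M[C]_n) : (A *m B)^H = B^H *m A^H.
Proof.
apply/matrixP => i j; rewrite !(adjE, mxE) rmorph_sum; apply: eq_bigr => k _.
by rewrite rmorphM !adjE mulrC.
Qed.

Lemma adj0 n : (0 : 'M[C]_n)^H = 0.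
Proof. by apply/matrixP => i j; rewrite !(adjE, mxE) rmorph0. Qed.

Lemma adj1 n : (1%:M : 'M[C]_n)^H = 1%:M.
Proof. by apply/matrixP => i j; rewrite !(adjE, mxE) rmorph_nat eq_sym. Qed.

Lemma nmH n (A : 'M[C]_n) : nm (A^H) = nm A.
Proof.
rewrite /nm exchange_big; apply: eq_bigr => i _; apply: eq_bigr => j _.
by rewrite adjE cabsJ.
Qed.

Lemma unitary_entry n (A : 'M[C]_n) i j : A *m A^H = 1%:M -> cabs (A i j) <= 1.
Proof.
move=> /matrixP/(_ i i); rewrite !mxE eqxx => h.
have : (cabs (A i j))^+2 <= 1.
  rewrite -lecR -[X in _ <= X]h cabs_sqr (bigD1 j) //= adjE lerDl.
  by apply: sumr_ge0 => k _; rewrite adjE mul_conjC_ge0.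
by rewrite expr_le1 ?cabs_ge0.
Qed.

Lemma unitary_nm n (A : 'M[C]_n) : A *m A^H = 1%:M -> nm A <= (n * n)%:R.
Proof.
move=> h; apply: (@le_trans _ _ (\sum_(i < n) \sum_(j < n) 1)).
  by apply: ler_sum => i _; apply: ler_sum => j _; apply: unitary_entry.
rewrite (eq_bigr (fun=> n%:R)) => [|i _]; last first.
  by rewrite sumr_const cardT size_enum_ord.
by rewrite sumr_const cardT size_enum_ord natrM mulr_natr.
Qed.

End Norm.

(** * Tangent vectors of a unitary group *)

Section Tangent.
Variables (R : realType) (N : nat).
Local Notation C := R[i].
Local Notation M := 'M[C]_N.

Record unitary_group (G : M -> Prop) : Prop := UnitaryGroup {
  ug1 : G 1%:M;
  ugM : forall A B, G A -> G B -> G (A *m B);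
  ugV : forall A, G A -> G (A^H);
  ugU : forall A, G A -> A *m A^H = 1%:M }.

Variable G : M -> Prop.
Hypothesis GG : unitary_group G.

(* The bound on [c] from below makes [g] tend to [1]. *)
Definition tang (X : M) : Prop := forall eps : R, 0 < eps ->
  exists (g : M) (c : R),
    [/\ G g, eps^-1 < `|c| & nm (c%:C%C *: (g - 1%:M) - X) < eps].

Let K : R := (N * N)%:R + 1.

Let K_ge1 : 1 <= K. Proof. by rewrite /K lerDr. Qed.
Let K_ge0 : 0 <= K. Proof. exact: le_trans K_ge1. Qed.

Lemma ug_nm g : G g -> nm g <= K.
Proof. by move=> /(ugU GG)/unitary_nm h; apply: (le_trans h); rewrite lerDl. Qed.

Lemma ug_VM g : G g -> g^H *m g = 1%:M.
Proof. by move=> /(ugU GG)/mulmx1C. Qed.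

(** Applying the hypothesis at eps / (B + 1) absorbs the constant, so later estimates only have to
    be of order eps. *)
Lemma tang_bound (X : M) (B : R) : 0 <= B ->
  (forall eps : R, 0 < eps -> eps < 1 -> exists (g : M) (c : R),
    [/\ G g, eps^-1 < `|c| & nm (c%:C%C *: (g - 1%:M) - X) <= B * eps]) ->
  tang X.
Proof.
move=> B0 h e e0.
pose d := Num.min (2^-1) (e / (B + 1)).
have B1 : 0 < B + 1 by lra.
have d0 : 0 < d by rewrite /d lt_min divr_gt0 // andbT; lra.
have d1 : d < 1 by rewrite /d gt_min; apply/orP; left; lra.
have dB : d * (B + 1) <= e.
  by rewrite -ler_pdivlMr // /d ge_min lexx orbT.
have de : d <= e by apply: le_trans dB; rewrite ler_peMr //; lra.
have [g [c [Gg hc hn]]] := h d d0 d1.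
exists g, c; split => //.
  by apply: le_lt_trans hc; rewrite lef_pV2 ?posrE.
by apply: (le_lt_trans hn); apply: lt_le_trans dB; rewrite mulrC mulrDr mulr1 ltrDl.
Qed.

(* The scale can be prescribed: passing to the power [floor (c' / c)] turns the
   scale [c'] into any much smaller [c]. *)
Lemma tang_scale (X : M) : tang X -> exists2 B : R, 0 <= B &
  forall eps : R, 0 < eps -> eps < 1 -> exists2 g : M, G g &
    nm (eps^-1%:C%C *: (g - 1%:M) - X) <= B * eps.
Proof.
move=> tX; set nX := nm X; have nX0 : 0 <= nX := nm_ge0 _.
pose B1 := K + (nX + 1) * nX.
have B10 : 0 <= B1 by rewrite /B1 addr_ge0 // mulr_ge0 // addr_ge0.
(* The scale may be taken positive: if c < 0, then g^H serves with scale - c, because g^H - 1 = -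
   g^H (g - 1). *)
have step1 (d : R) : 0 < d -> d < 1 -> exists (g : M) (c : R),
   [/\ G g, d^-1 < c & nm (c%:C%C *: (g - 1%:M) - X) <= B1 * d].
  move=> d0 d1; have [g [c [Gg hc hn]]] := tX d d0.
  have [c0|c0] := leP 0 c.
    exists g, c; split=> //; first by rewrite -(ger0_norm c0).
    apply: (le_trans (ltW hn)); rewrite ler_peMl ?(ltW d0) // /B1.
    by apply: (le_trans K_ge1); rewrite lerDl mulr_ge0 // addr_ge0.
  have cn : 0 < `|c| by rewrite normr_gt0 lt_eqF.
  have hc' : `|c|^-1 <= d.
    by rewrite -(invrK d) lef_pV2 ?posrE ?invr_gt0 // ltW.
  have small : nm (g - 1%:M) <= (nX + 1) * d.
    have : nm (c%:C%C *: (g - 1%:M)) <= nX + 1.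
      rewrite -[_ *: _](subrK X); apply: (le_trans (nmD _ _)).
      by rewrite addrC lerD2l ltW // (lt_trans hn).
    rewrite nmZ cabsR -ler_pdivlMl // => h; apply: (le_trans h).
    by rewrite mulrC ler_wpM2l // addr_ge0.
  exists (g^H), (- c); split; [exact: ugV | by rewrite -(ltr0_norm c0) |].
  have -> : (- c)%:C%C *: (g^H - 1%:M) - X =
     g^H *m (c%:C%C *: (g - 1%:M) - X) + (g - 1%:M)^H *m X.
    rewrite adjB adj1 mulmxBr -scalemxAr mulmxBr (ug_VM Gg) mulmx1 mulmxBl mul1mx.
    by rewrite rmorphN /= scaleNr -scalerN opprB addrA subrK.
  apply: (le_trans (nmD _ _)); rewrite /B1 mulrDl; apply: lerD.
    apply: (le_trans (nmM _ _)); apply: ler_pM; rewrite ?nm_ge0 ?ug_nm ?ltW //.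
    exact: ugV.
  apply: (le_trans (nmM _ _)); rewrite nmH mulrAC ler_wpM2r //.
have step2 g k : G g -> nm (g ^+ k - 1%:M) <= k%:R * K * nm (g - 1%:M).
  move=> Gg; elim: k => [|k IH]; first by rewrite expr0 subrr nm0 !mul0r.
  have Gk : G (g ^+ k).
    by elim: (k) => [|j Gj]; rewrite ?expr0 ?exprS; [exact: ug1|exact: ugM].
  have -> : g ^+ k.+1 - 1%:M = g ^+ k *m (g - 1%:M) + (g ^+ k - 1%:M).
    by rewrite mulmxBr mulmx1 addrA subrK exprSr.
  apply: (le_trans (nmD _ _)); rewrite -natr1 mulrDl mul1r mulrDl addrC lerD //.
  by apply: (le_trans (nmM _ _)); rewrite ler_wpM2r ?nm_ge0 ?ug_nm.
(* The remainder of the first order expansion of a power is quadratic in k |g - 1|, a quantity that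
   will be of order e. *)
have step3 g k : G g ->
    nm (g ^+ k - 1%:M - k%:R *: (g - 1%:M)) <= (k%:R * nm (g - 1%:M)) ^+ 2 * K.
  move=> Gg; elim: k => [|k IH].
    by rewrite expr0 subrr scale0r subr0 nm0 mul0r expr0n mul0r.
  have -> : g ^+ k.+1 - 1%:M - k.+1%:R *: (g - 1%:M) =
     (g ^+ k - 1%:M - k%:R *: (g - 1%:M)) + (g ^+ k - 1%:M) *m (g - 1%:M).
    rewrite mulmxBr mulmx1 mulmxBl mul1mx exprSr -[_ * g]/(_ *m g) -natr1.
    set a := _ *m g; set b := 1%:M; set h := g ^+ k.
    move: a b h => a b h.
    by apply/matrixP => i j; rewrite !mxE; ring.
  apply: (le_trans (nmD _ _)).
  have h2 := le_trans (nmM (g ^+ k - 1%:M) (g - 1%:M)) (ler_wpM2r (nm_ge0 _) (step2 g k Gg)).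
  apply: (le_trans (lerD IH h2)).
  rewrite -natr1; have k0 : 0 <= k%:R :> R by [].
  move: (k%:R) k0 (nm _) (nm_ge0 (g - 1%:M)) => x x0 y y0.
  rewrite -subr_ge0.
  have -> : ((x + 1) * y) ^+ 2 * K - ((x * y) ^+ 2 * K + x * K * y * y)
     = (x + 1) * K * y ^+ 2 by ring.
  by rewrite !mulr_ge0 // addr_ge0.
exists ((nX + B1) ^+ 2 * K + B1 + nX + B1).
  have hh : 0 <= (nX + B1) ^+ 2 * K by apply: mulr_ge0 => //; apply: sqr_ge0.
  by clear -hh nX0 B10; lra.
(* Precision e^2 forces c > e^-2, so that rounding c e down to an integer k changes the ratio k / (c
   e) by at most e. *)
move=> e e0 e1; set d := e ^+ 2.
have d0 : 0 < d by rewrite exprn_gt0.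
have de : d < e by rewrite /d expr2 gtr_pMr.
have d1 : d < 1 := lt_trans de e1.
have [g [c [Gg hc hn]]] := step1 d d0 d1.
have c0 : 0 < c by apply: lt_trans hc; rewrite invr_gt0.
have cd : c^-1 < d by rewrite -(invrK d) ltf_pV2 ?posrE ?invr_gt0.
pose k := Num.trunc (c * e).
have ce0 : 0 <= c * e by rewrite mulr_ge0 ?ltW.
have /andP[k1 k2] := truncn_itv ce0; rewrite -/k in k1 k2.
exists (g ^+ k).
  by elim: (k) => [|j Gj]; rewrite ?expr0 ?exprS; [exact: ug1|exact: ugM].
have nmg : nm (g - 1%:M) <= c^-1 * (nX + B1).
  rewrite -ler_pdivrMl ?invr_gt0 // invrK.
  have -> : c * nm (g - 1%:M) = nm ((c%:C%C *: (g - 1%:M) - X) + X).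
    by rewrite subrK nmZ cabsR gtr0_norm.
  apply: (le_trans (nmD _ _)); rewrite addrC lerD2l (le_trans hn) //.
  by rewrite ler_piMr // ltW.
pose t := k%:R / (c * e).
have ce_gt0 : 0 < c * e by rewrite mulr_gt0.
have t0 : 0 <= t by rewrite divr_ge0.
have t1 : t <= 1 by rewrite ler_pdivrMr // mul1r.
have t2 : 1 - t <= e.
  have -> : 1 - t = (c * e - k%:R) / (c * e) by rewrite /t mulrBl divff ?gt_eqF.
  rewrite ler_pdivrMr //; apply: (@le_trans _ _ 1).
    by rewrite lerBlDr addrC natr1 ltW.
  have : c * d >= 1 by rewrite -ler_pdivrMl // mulr1 ltW.
  by rewrite /d expr2 mulrA mulrC mulrA.
have -> : e^-1%:C%C *: (g ^+ k - 1%:M) - X =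
   e^-1%:C%C *: (g ^+ k - 1%:M - k%:R *: (g - 1%:M))
   + t%:C%C *: (c%:C%C *: (g - 1%:M) - X) + (t - 1)%:C%C *: X.
  have tc : t%:C%C * c%:C%C = e^-1%:C%C * k%:R :> C.
    have -> : (k%:R : C) = (k%:R : R)%:C%C by rewrite rmorph_nat.
    rewrite -!rmorphM /=; congr (_%:C%C).
    by rewrite /t; field; rewrite !gt_eqF.
  move: (g ^+ k - 1%:M) (g - 1%:M) => U D.
  rewrite !scalerBr !scalerA tc rmorphB /= scalerBl scale1r.
  by rewrite !addrA subrK subrK.
apply: (le_trans (nmD _ _)).
have hA : nm (e^-1%:C%C *: (g ^+ k - 1%:M - k%:R *: (g - 1%:M))) <=
   (nX + B1) ^+ 2 * K * e.
  rewrite nmZ cabsR gtr0_norm ?invr_gt0 // ler_pdivrMl //.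
  apply: (le_trans (step3 g k Gg)).
  have -> : e * ((nX + B1) ^+ 2 * K * e) = (e * (nX + B1)) ^+ 2 * K by ring.
  rewrite ler_wpM2r // ler_sqr ?nnegrE ?mulr_ge0 ?nm_ge0 ?(ltW e0) //; last by rewrite addr_ge0.
  apply: (@le_trans _ _ (c * e * (c^-1 * (nX + B1)))).
    by apply: ler_pM; rewrite ?nm_ge0.
  by rewrite mulrACA divff ?gt_eqF // mul1r.
have hB : nm (t%:C%C *: (c%:C%C *: (g - 1%:M) - X)) <= B1 * e.
  rewrite nmZ cabsR ger0_norm //.
  apply: (@le_trans _ _ (1 * (B1 * d))); first by apply: ler_pM; rewrite ?nm_ge0.
  by rewrite mul1r ler_wpM2l // ltW.
have hC : nm ((t - 1)%:C%C *: X) <= nX * e.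
  rewrite nmZ cabsR distrC ger0_norm ?subr_ge0 // mulrC ler_wpM2l //.
apply: (@le_trans _ _ ((nX + B1) ^+ 2 * K * e + B1 * e + nX * e)).
  by apply: lerD => //; apply: (le_trans (nmD _ _)); apply: lerD.
have -> : ((nX + B1) ^+ 2 * K + B1 + nX + B1) * e =
  (nX + B1) ^+ 2 * K * e + B1 * e + nX * e + B1 * e by rewrite !mulrDl.
by rewrite lerDl mulr_ge0 // ltW.
Qed.

Lemma tang0 : tang 0.
Proof.
move=> e e0; exists 1%:M, (e^-1 + 1); split; first exact: ug1.
  by rewrite ger0_norm ?ltrDl // addr_ge0 // invr_ge0 ltW.
by rewrite subrr scaler0 subr0 nm0.
Qed.

Let scale_big (e : R) : 0 < e -> e < 1 -> (2 * e)^-1 < `|e^-1|.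
Proof.
move=> e0 e1; rewrite ger0_norm ?invr_ge0 ?ltW //.
by rewrite ltf_pV2 ?posrE ?mulr_gt0 // ltr_pMl //; lra.
Qed.

Lemma tang_unscale (X : M) (B : R) : 0 <= B ->
  (forall eps : R, 0 < eps -> eps < 1 -> exists2 g : M, G g &
    nm (eps^-1%:C%C *: (g - 1%:M) - X) <= B * eps) -> tang X.
Proof.
move=> B0 h; apply: (@tang_bound X B) => // e e0 e1.
(* Halving makes the scale (e / 2)^-1 strictly larger than e^-1, as [tang] demands. *)
have e20 : 0 < e / 2 by rewrite divr_gt0.
have e21 : e / 2 < 1 by lra.
have [g Gg hg] := h _ e20 e21; exists g, ((e / 2)^-1); split => //.
  have := scale_big e20 e21.
  by have -> : 2 * (e / 2) = e by field.
by apply: (le_trans hg); rewrite ler_wpM2l //; lra.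
Qed.

Let nm_step (X : M) (B e : R) g : 0 <= B -> 0 < e -> e < 1 ->
  nm (e^-1%:C%C *: (g - 1%:M) - X) <= B * e -> nm (g - 1%:M) <= (nm X + B) * e.
Proof.
move=> B0 e0 e1 h.
have : nm (e^-1%:C%C *: (g - 1%:M)) <= nm X + B.
  rewrite -[_ *: _](subrK X); apply: (le_trans (nmD _ _)).
  by rewrite addrC lerD2l (le_trans h) // ler_piMr // ltW.
by rewrite nmZ cabsR gtr0_norm ?invr_gt0 // ler_pdivrMl // mulrC.
Qed.

(** For approximants g and h at a common scale, g h - 1 = (g - 1) + (h - 1) + (g - 1) (h - 1), and
    the last term is of second order. The need for a common scale is the reason for [tang_scale]. *)
Lemma tangD (X Y : M) : tang X -> tang Y -> tang (X + Y).
Proof.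
move=> /tang_scale [BX BX0 hX] /tang_scale [BY BY0 hY].
apply: (@tang_unscale _ (BX + BY + (nm X + BX) * (nm Y + BY))) => [|e e0 e1].
  by rewrite !addr_ge0 ?mulr_ge0 ?addr_ge0 ?nm_ge0.
have [g Gg hg] := hX e e0 e1; have [h Gh hh] := hY e e0 e1.
exists (g *m h); first exact: ugM.
have -> : e^-1%:C%C *: (g *m h - 1%:M) - (X + Y) =
    (e^-1%:C%C *: (g - 1%:M) - X) + (e^-1%:C%C *: (h - 1%:M) - Y)
     + e^-1%:C%C *: ((g - 1%:M) *m (h - 1%:M)).
  rewrite mulmxBl mulmxBr mulmx1 mul1mx.
  by move: (g *m h) (1%:M) => a b; apply/matrixP => i j; rewrite !mxE; ring.
apply: (le_trans (nmD _ _)); rewrite mulrDl lerD //.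
  by apply: (le_trans (nmD _ _)); rewrite mulrDl lerD.
rewrite nmZ cabsR gtr0_norm ?invr_gt0 // ler_pdivrMl //.
apply: (le_trans (nmM _ _)).
have -> : e * ((nm X + BX) * (nm Y + BY) * e) = (nm X + BX) * e * ((nm Y + BY) * e).
  by ring.
by apply: ler_pM; rewrite ?nm_ge0 // nm_step.
Qed.

Lemma tangZ (a : R) (X : M) : tang X -> tang (a%:C%C *: X).
Proof.
move=> tX; have [->|a0] := eqVneq a 0; first by rewrite scale0r; apply: tang0.
have na : 0 < `|a| by rewrite normr_gt0.
move=> e e0; have m0 : 0 < Num.min (e * `|a|) (e / `|a|) by rewrite lt_min mulr_gt0 ?divr_gt0.
have [g [c [Gg hc hn]]] := tX _ m0.
exists g, (a * c); split => //.
  rewrite normrM -ltr_pdivrMl //; apply: le_lt_trans hc.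
  have -> : `|a|^-1 * e^-1 = (e * `|a|)^-1 by rewrite invfM mulrC.
  by rewrite lef_pV2 ?posrE ?mulr_gt0 // ge_min lexx.
rewrite rmorphM /= -scalerA -scalerBr nmZ cabsR -ltr_pdivlMl //.
by apply: (lt_le_trans hn); rewrite ge_min; apply/orP; right; rewrite mulrC.
Qed.

Lemma tangN (X : M) : tang X -> tang (- X).
Proof. by move=> /(tangZ (-1)); rewrite rmorphN1 scaleN1r. Qed.

Lemma tangB (X Y : M) : tang X -> tang Y -> tang (X - Y).
Proof. by move=> tX /tangN; apply: tangD. Qed.

Lemma tang_conj (h X : M) : G h -> tang X -> tang (h *m X *m h^H).
Proof.
move=> Gh tX; apply: (@tang_bound _ (K * K)); first exact: mulr_ge0.
move=> e e0 e1; have [g [c [Gg hc hn]]] := tX e e0.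
exists (h *m g *m h^H), c; split => //.
  by do 2?apply: (ugM GG) => //; apply: ugV.
have -> : c%:C%C *: (h *m g *m h^H - 1%:M) - h *m X *m h^H =
   h *m (c%:C%C *: (g - 1%:M) - X) *m h^H.
  rewrite -(ugU GG Gh) mulmxBr mulmxBl -scalemxAr -scalemxAl; congr (_ *: _ - _).
  by rewrite (ugU GG Gh) mulmxBr mulmxBl mulmx1 (ugU GG Gh).
apply: (le_trans (nmM _ _)); rewrite mulrC mulrAC -mulrA.
apply: ler_pM; rewrite ?nm_ge0 // ?ug_nm //; first exact: ugV.
apply: (le_trans (nmM _ _)); rewrite mulrC.
by apply: ler_pM; rewrite ?nm_ge0 // ?ug_nm // ltW.
Qed.

Lemma tang_closed (X : M) (B : R) : 0 <= B ->
  (forall eps : R, 0 < eps -> eps < 1 ->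
     exists2 Y, tang Y & nm (Y - X) <= B * eps) -> tang X.
Proof.
move=> B0 h; apply: (@tang_bound _ (1 + B)) => [|e e0 e1]; first exact: addr_ge0.
have [Y tY hY] := h e e0 e1; have [g [c [Gg hc hn]]] := tY e e0.
exists g, c; split=> //.
have -> : c%:C%C *: (g - 1%:M) - X = (c%:C%C *: (g - 1%:M) - Y) + (Y - X).
  by rewrite addrA subrK.
by apply: (le_trans (nmD _ _)); rewrite mulrDl mul1r lerD // ltW.
Qed.

(** The bracket is the derivative of the conjugation of Y along X: each quotient e^-1 (g Y g^H - Y)
    is tangent, and [tang_closed] passes to the limit. *)
Lemma tang_bracket (X Y : M) : tang X -> tang Y -> tang (X *m Y - Y *m X).
Proof.
move=> /tang_scale [BX BX0 hX] tY.
pose B := 2 * BX * nm Y + 2 * (nm X + BX) * nm Y * (nm X + BX).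
have B0 : 0 <= B.
  by rewrite /B addr_ge0 // ?mulr_ge0 ?nm_ge0 // addr_ge0 ?nm_ge0.
apply: (@tang_closed _ B) => // e e0 e1.
have [g Gg hg] := hX e e0 e1.
exists (e^-1%:C%C *: (g *m Y *m g^H - Y)).
  by apply: tangZ; apply: tangB => //; apply: tang_conj.
set D := g - 1%:M; have nD : nm D <= (nm X + BX) * e by apply: nm_step hg.
set Z := e^-1%:C%C *: D; set W := Z - X.
have gY : g *m Y *m g^H - Y = (D *m Y - Y *m D) *m g^H.
  have -> : D *m Y - Y *m D = g *m Y - Y *m g.
    by rewrite /D mulmxBl mulmxBr mul1mx mulmx1 opprB addrA subrK.
  by rewrite [RHS]mulmxBl -[Y *m g *m _]mulmxA (ugU GG Gg) mulmx1.
have -> : e^-1%:C%C *: (g *m Y *m g^H - Y) - (X *m Y - Y *m X) =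
   (W *m Y - Y *m W) + (Z *m Y - Y *m Z) *m (g^H - 1%:M).
  rewrite gY.
  have -> : e^-1%:C%C *: ((D *m Y - Y *m D) *m g^H) = (Z *m Y - Y *m Z) *m g^H.
    by rewrite /Z -scalemxAr -scalemxAl -scalerBr -scalemxAl.
  rewrite [_ *m (g^H - 1%:M)]mulmxBr mulmx1 /W [(Z - X) *m Y]mulmxBl.
  rewrite [Y *m (Z - X)]mulmxBr.
  move: ((Z *m Y - Y *m Z) *m g^H) (X *m Y) (Y *m X) (Z *m Y) (Y *m Z) => a b c d f.
  by apply/matrixP => i j; rewrite !mxE; ring.
apply: (le_trans (nmD _ _)); rewrite /B mulrDl lerD //.
  apply: (le_trans (nmB _ _)).
  have h1 : nm (W *m Y) <= BX * e * nm Y.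
    by apply: (le_trans (nmM _ _)); rewrite ler_wpM2r ?nm_ge0.
  have h2 : nm (Y *m W) <= BX * e * nm Y.
    by apply: (le_trans (nmM _ _)); rewrite mulrC ler_wpM2r ?nm_ge0.
  have -> : 2 * BX * nm Y * e = BX * e * nm Y + BX * e * nm Y by ring.
  exact: lerD.
have nZ : nm Z <= nm X + BX.
  rewrite -[Z](subrK X); apply: (le_trans (nmD _ _)).
  by rewrite addrC lerD2l (le_trans hg) // ler_piMr // ltW.
apply: (le_trans (nmM _ _)).
have -> : g^H - 1%:M = D^H by rewrite adjB adj1.
rewrite nmH -mulrA; apply: ler_pM; rewrite ?nm_ge0 //.
apply: (le_trans (nmB _ _)).
have h1 : nm (Z *m Y) <= (nm X + BX) * nm Y.
  by apply: (le_trans (nmM _ _)); rewrite ler_wpM2r ?nm_ge0.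
have h2 : nm (Y *m Z) <= (nm X + BX) * nm Y.
  by apply: (le_trans (nmM _ _)); rewrite mulrC ler_wpM2r ?nm_ge0.
have -> : 2 * (nm X + BX) * nm Y = (nm X + BX) * nm Y + (nm X + BX) * nm Y by ring.
exact: lerD.
Qed.

(** Unitarity of g = 1 + D reads D^H + D + D D^H = 0, whose last term is of second order. *)
Lemma tang_skew (X : M) : tang X -> X^H = - X.
Proof.
move=> /tang_scale [B B0 h].
suff: nm (X^H + X) <= 0 by move=> /nm_eq0/eqP; rewrite addr_eq0 => /eqP.
pose B' := 2 * B + (nm X + B) ^+ 2.
have B'0 : 0 <= B' by apply: addr_ge0; [apply: mulr_ge0 | apply: sqr_ge0].
have hB : forall e : R, 0 < e -> e < 1 -> nm (X^H + X) <= B' * e; last first.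
  apply/ler_addgt0Pl => d d0; rewrite addr0.
  pose e := Num.min (2^-1) (d / (B' + 1)).
  have B1 : 0 < B' + 1 by lra.
  have e0 : 0 < e by rewrite lt_min divr_gt0 // andbT; lra.
  have e1 : e < 1 by rewrite gt_min; apply/orP; left; lra.
  apply: (le_trans (hB e e0 e1)).
  have : e * (B' + 1) <= d by rewrite -ler_pdivlMr // /e ge_min lexx orbT.
  by apply: le_trans; rewrite mulrC ler_wpM2l ?ltW // ltrDl.
move=> e e0 e1; have [g Gg hg] := h e e0 e1.
set D := g - 1%:M in hg; have nD : nm D <= (nm X + B) * e by apply: nm_step hg.
have uD : D^H + D + D *m D^H = 0.
  rewrite /D adjB adj1 mulmxBl mulmxBr (ugU GG Gg) mulmx1 mul1mx.
  move: (g^H) (1%:M : M) => a b.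
  by apply/matrixP => i j; rewrite !mxE; ring.
set W := e^-1%:C%C *: D - X in hg.
have -> : X^H + X = - (W^H + W) - e^-1%:C%C *: (D *m D^H).
  have -> : D *m D^H = - (D^H + D) by apply/eqP; rewrite -addr_eq0 addrC uD.
  rewrite /W adjB adjZ conjc_real.
  by apply/matrixP => i j; rewrite !mxE; ring.
apply: (le_trans (nmB _ _)); rewrite /B' mulrDl lerD //.
  rewrite nmN; apply: (le_trans (nmD _ _)); rewrite nmH.
  have -> : 2 * B * e = B * e + B * e by ring.
  exact: lerD.
rewrite nmZ cabsR gtr0_norm ?invr_gt0 // ler_pdivrMl //.
apply: (le_trans (nmM _ _)); rewrite nmH.
have -> : e * ((nm X + B) ^+ 2 * e) = (nm X + B) * e * ((nm X + B) * e) by ring.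
by apply: ler_pM; rewrite ?nm_ge0.
Qed.

(* If [e] is a one-parameter group with velocity [X], the element of [G] close to
   [e (1 / k)] has its [k]-th power close to [e 1]. *)
Lemma tang_exp (X : M) (f : R -> M) (B : R) :
  tang X -> 0 <= B -> (forall t, nm (f t) <= B) -> f 0 = 1%:M ->
  (forall s t, f (s + t) = f s *m f t) ->
  (forall eps : R, 0 < eps -> exists2 d : R, 0 < d &
     forall t, 0 < t -> t < d -> nm (f t - 1%:M - t%:C%C *: X) <= eps * t) ->
  forall eps : R, 0 < eps -> exists2 g, G g & nm (g - f 1) < eps.
Proof.
move=> /tang_scale [BX BX0 hX] B0 nf f0 fD hf eps eps0.
pose B1 := K * B + 1.
have B10 : 0 < B1 by rewrite /B1 ltr_wpDl // mulr_ge0.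
have [d d0 hd] := hf (eps / (4 * B1)) (divr_gt0 eps0 (mulr_gt0 (ltr0Sn _ _) B10)).
(* The three summands ensure that t = 1 / k is below 1, below d, and small enough for the error of g
   against the velocity X. *)
pose T := 2 + d^-1 + 4 * B1 * BX / eps.
pose k := (Num.trunc T).+1.
have kT : T < k%:R by apply: truncnS_gt.
have T1 : 0 <= d^-1 by rewrite invr_ge0 ltW.
have T2 : 0 <= 4 * B1 * BX / eps by rewrite divr_ge0 ?mulr_ge0 // ltW.
have k0 : 0 < k%:R :> R by [].
set t : R := k%:R^-1.
have t0 : 0 < t by rewrite invr_gt0.
have t1 : t < 1 by rewrite /t invf_lt1 //; apply: lt_trans kT; rewrite /T; lra.
have td : t < d.
  by rewrite /t -[d]invrK ltf_pV2 ?posrE ?invr_gt0 //; apply: le_lt_trans kT; rewrite /T; lra.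
have tB : t * BX <= eps / (4 * B1).
  rewrite /t ler_pdivrMl // mulrA ler_pdivlMr ?mulr_gt0 //.
  have : 4 * B1 * BX / eps < k%:R by apply: le_lt_trans kT; rewrite /T; lra.
  by rewrite ltr_pdivrMr // => /ltW; rewrite [BX * _]mulrC.
have [g Gg hg] := hX t t0 t1; have hft := hd t t0 td.
have gf : nm (g - f t) <= eps / (2 * B1) * t.
  have -> : g - f t = t%:C%C *: (t^-1%:C%C *: (g - 1%:M) - X) - (f t - 1%:M - t%:C%C *: X).
    rewrite scalerBr scalerA -rmorphM /= divff ?gt_eqF // scale1r.
    move: (1%:M : M) => b.
    by apply/matrixP => i j; rewrite !mxE; ring.
  apply: (le_trans (nmB _ _)); rewrite nmZ cabsR gtr0_norm //.
  have -> : eps / (2 * B1) * t = t * (eps / (4 * B1)) + eps / (4 * B1) * t.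
    by field; rewrite gt_eqF.
  apply: lerD => //; rewrite ler_wpM2l ?(ltW t0) //.
  by apply: (le_trans hg); rewrite mulrC.
have Gk j : G (g ^+ j).
  by elim: j => [|j Gj]; rewrite ?expr0 ?exprS; [exact: ug1|exact: ugM].
have fk j : f (j%:R * t) = f t ^+ j.
  elim: j => [|j IH]; first by rewrite mul0r f0 expr0.
  by rewrite -natr1 mulrDl mul1r fD IH exprSr.
(* A telescoping sum; the free factor g^i lets the induction shift powers of g to the left while
   every factor stays uniformly bounded. *)
have tel j : forall i, nm (g ^+ i *m (g ^+ j - f t ^+ j)) <= j%:R * (K * B * nm (g - f t)).
  elim: j => [|j IH] i; first by rewrite !expr0 subrr mulmx0 nm0 mul0r.
  have -> : g ^+ i *m (g ^+ j.+1 - f t ^+ j.+1) =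
     g ^+ i.+1 *m (g ^+ j - f t ^+ j) + g ^+ i *m (g - f t) *m f t ^+ j.
    have eS (h : M) l : h ^+ l.+1 = h *m h ^+ l by rewrite exprS.
    have -> : g ^+ i.+1 = g ^+ i *m g by rewrite exprSr.
    rewrite !eS -!mulmxA -mulmxDr; congr (_ *m _).
    by rewrite mulmxBr mulmxBl addrA subrK.
  apply: (le_trans (nmD _ _)); rewrite -natr1 mulrDl mul1r lerD //.
  apply: (le_trans (nmM _ _)); rewrite mulrAC; apply: ler_pM; rewrite ?nm_ge0 //.
    apply: (le_trans (nmM _ _)); rewrite ler_wpM2r ?nm_ge0 //; exact: ug_nm.
  by rewrite -fk.
exists (g ^+ k) => //.
have kt : k%:R * t = 1 by rewrite divff ?gt_eqF.
rewrite -kt fk; have := tel k 0%N; rewrite expr0 mul1mx => h.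
apply: (le_lt_trans h).
apply: (@le_lt_trans _ _ (k%:R * (B1 * (eps / (2 * B1) * t)))).
  rewrite ler_wpM2l ?(ltW k0) //; apply: ler_pM; rewrite ?nm_ge0 ?mulr_ge0 //.
  by rewrite /B1 lerDl.
have -> : k%:R * (B1 * (eps / (2 * B1) * t)) = k%:R * t * (eps / 2).
  by field; rewrite gt_eqF.
rewrite kt; lra.
Qed.

(** The complexification L of the overview. Both components remain tangent vectors, which are
    skew-Hermitian, so L is stable under adjoints and its skew part can be recovered. *)
Definition ctang (X : M) : Prop :=
  exists A B : M, [/\ tang A, tang B & X = A + 'i%C *: B].

Lemma ctangT X : tang X -> ctang X.
Proof. by move=> tX; exists X, 0; rewrite scaler0 addr0; split=> //; apply: tang0. Qed.

Lemma ctang0 : ctang 0. Proof. exact: ctangT tang0. Qed.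

Lemma ctangD X Y : ctang X -> ctang Y -> ctang (X + Y).
Proof.
move=> [A [B [tA tB ->]]] [A' [B' [tA' tB' ->]]].
by exists (A + A'), (B + B'); split; [exact: tangD..|rewrite scalerDr addrACA].
Qed.

Lemma ctangZ z X : ctang X -> ctang (z *: X).
Proof.
move=> [A [B [tA tB ->]]]; case: z => a b.
exists (a%:C%C *: A - b%:C%C *: B), (a%:C%C *: B + b%:C%C *: A).
split; [by apply: tangB; apply: tangZ | by apply: tangD; apply: tangZ |].
have i2 : 'i%C * 'i%C = -1 :> C by rewrite -expr2 sqr_i.
have -> : (a +i* b)%C = a%:C%C + 'i%C * b%:C%C :> C.
  by rewrite [LHS]complexE.
apply/matrixP => i j; rewrite !mxE; apply/eqP; rewrite -subr_eq0; apply/eqP.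
transitivity (('i%C * 'i%C + 1) * (b%:C%C * B i j)); first ring.
by rewrite i2 addNr mul0r.
Qed.

Lemma ctangN X : ctang X -> ctang (- X).
Proof. by rewrite -scaleN1r; apply: ctangZ. Qed.

Lemma ctangB X Y : ctang X -> ctang Y -> ctang (X - Y).
Proof. by move=> cX /ctangN; apply: ctangD. Qed.

Lemma ctang_sum (I : Type) (r : seq I) (P : pred I) (F : I -> M) :
  (forall i, P i -> ctang (F i)) -> ctang (\sum_(i <- r | P i) F i).
Proof. by move=> h; elim/big_ind: _ => //; [exact: ctang0 | exact: ctangD]. Qed.

Lemma ctang_conj h X : G h -> ctang X -> ctang (h *m X *m h^H).
Proof.
move=> Gh [A [B [tA tB ->]]].
exists (h *m A *m h^H), (h *m B *m h^H); split; [exact: tang_conj.. |].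
by rewrite mulmxDr mulmxDl -scalemxAr -scalemxAl.
Qed.

Lemma ctang_bracket X Y : ctang X -> ctang Y -> ctang (X *m Y - Y *m X).
Proof.
move=> [A [B [tA tB ->]]] [A' [B' [tA' tB' ->]]].
have h P Q : tang P -> tang Q -> ctang (P *m Q - Q *m P).
  by move=> tP tQ; apply: ctangT; apply: tang_bracket.
have -> : (A + 'i%C *: B) *m (A' + 'i%C *: B') - (A' + 'i%C *: B') *m (A + 'i%C *: B)
  = (A *m A' - A' *m A) + ('i%C *: (A *m B' - B' *m A) + ('i%C *: (B *m A' - A' *m B) +
      ('i%C * 'i%C) *: (B *m B' - B' *m B))).
  rewrite !mulmxDl !mulmxDr -!scalemxAr -!scalemxAl !scalerA.
  move: (A *m A') (A' *m A) (A *m B') (B' *m A) (B *m A') (A' *m B) (B *m B') (B' *m B).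
  by move=> a b c d f g' k l; apply/matrixP => i j; rewrite !mxE; ring.
apply: ctangD; first exact: h.
by apply: ctangD; [|apply: ctangD]; apply: ctangZ; apply: h.
Qed.

Lemma ctangH X : ctang X -> ctang (X^H).
Proof.
move=> [A [B [tA tB ->]]]; exists (- A), B; split=> //; first exact: tangN.
rewrite adjD adjZ (tang_skew tA) (tang_skew tB).
by rewrite scalerN -scaleNr; congr (_ + _ *: _); rewrite -rmorphN /=; simpc.
Qed.

(** For skew A and B the summand i B is Hermitian, so A + i B is skew only if B = 0. *)
Lemma ctang_tang X : ctang X -> X^H = - X -> tang X.
Proof.
move=> [A [B [tA tB ->]]]; rewrite adjD adjZ (tang_skew tA) (tang_skew tB) opprD.
move=> /addrI; rewrite scalerN -scaleNr.
have -> : - ('i%C^*)%C = 'i%C :> C by rewrite -rmorphN /=; simpc.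
move=> /eqP; rewrite -addr_eq0 -scalerDl scaler_eq0 => /orP[|/eqP ->].
  by rewrite -mulr2n mulrn_eq0 /= => /eqP[]/eqP; rewrite oner_eq0.
by rewrite scaler0 addr0.
Qed.

End Tangent.

(** * Quantum integers *)

Section Numbers.
Variables (R : realType) (b : bool) (r : nat).
Local Notation C := R[i].
Local Notation th := (pi / r%:R : R).

(** The exponential of i x or - i x; the sign b treats both admissible choices of q together. *)
Definition cis (x : R) : C := Complex (cos x) ((if b then 1 else -1) * sin x).

Lemma cisD x y : cis (x + y) = cis x * cis y.
Proof.
have s2 : (if b then 1 else -1 : R) ^+ 2 = 1 by case: b; rewrite ?sqrrN expr1n.
rewrite /cis cosD sinD; set s := (if b then _ else _) in s2 *.
apply/eqP; rewrite eq_complex /=; apply/andP; split; apply/eqP; last ring.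
transitivity (cos x * cos y - s ^+ 2 * (sin x * sin y)); last ring.
by rewrite s2 mul1r.
Qed.

Lemma cis0 : cis 0 = 1.
Proof. by rewrite /cis cos0 sin0 mulr0. Qed.

Lemma cisX x k : cis x ^+ k = cis (k%:R * x).
Proof.
elim: k => [|k IH]; first by rewrite expr0 mul0r cis0.
by rewrite exprSr IH -cisD -natr1 mulrDl mul1r.
Qed.

Lemma cisJ x : (cis x)^*%C = cis (- x).
Proof. by rewrite /cis cosN sinN mulrN. Qed.

Lemma cis_unit x : cis x * (cis x)^*%C = 1.
Proof. by rewrite cisJ -cisD subrr cis0. Qed.

Lemma cisJD x : cis x + (cis x)^*%C = (2 * cos x)%:C%C.
Proof. by rewrite addcJ /= rmorphM rmorph_nat. Qed.

Local Notation q := (qq R b r).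

Lemma qqE : q = cis (2 * th).
Proof. by rewrite -cisX. Qed.

Lemma qq_unit : q * q^*%C = 1.
Proof. by rewrite qqE cis_unit. Qed.

Hypothesis r5 : (5 <= r)%N.

Let r0 : 0 < r%:R :> R. Proof. by rewrite ltr0n; apply: leq_trans r5. Qed.

Lemma th_gt0 : 0 < th. Proof. by rewrite divr_gt0 ?pi_gt0. Qed.

Lemma sin_mth (m : nat) : (0 < m < r)%N -> 0 < sin (m%:R * th).
Proof.
move=> /andP[m0 mr]; apply: sin_gt0_pi; rewrite mulr_gt0 ?th_gt0 ?ltr0n //=.
by rewrite mulrCA gtr_pMr ?pi_gt0 // ltr_pdivrMr // mul1r ltr_nat.
Qed.

Lemma qq_neqN1 : 1 + q != 0.
Proof.
rewrite qqE; apply/eqP => /(congr1 (@complex.Im R)) /= /eqP.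
rewrite add0r mulf_eq0 => /orP[|]; first by case: b; rewrite ?oppr_eq0 oner_eq0.
by apply/negP; rewrite gt_eqF // (@sin_mth 2) //; apply: leq_trans r5.
Qed.

Lemma qq_neqJ : q - q^*%C != 0.
Proof.
rewrite qqE; apply/eqP => /(congr1 (@complex.Im R)) /= /eqP.
rewrite opprK -mulr2n mulrn_eq0 /= mulf_eq0 => /orP[|].
  by case: b; rewrite ?oppr_eq0 oner_eq0.
by apply/negP; rewrite gt_eqF // (@sin_mth 2) //; apply: leq_trans r5.
Qed.

Definition qn (m : nat) : R := sin (m%:R * th) / sin th.

Lemma sin_th : 0 < sin th.
Proof. by rewrite -[th]mul1r (@sin_mth 1) //; apply: leq_trans r5. Qed.

Lemma qn0 : qn 0 = 0. Proof. by rewrite /qn mul0r sin0 mul0r. Qed.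

Lemma qn1 : qn 1 = 1. Proof. by rewrite /qn mul1r divff // gt_eqF ?sin_th. Qed.

Lemma qnr : qn r = 0.
Proof. by rewrite /qn [r%:R * _]mulrC divfK ?gt_eqF // sinpi mul0r. Qed.

Lemma qn_gt0 m : (0 < m < r)%N -> 0 < qn m.
Proof. by move=> hm; rewrite divr_gt0 ?sin_mth ?sin_th. Qed.

Lemma qn2E : qn 2 = 2 * cos th.
Proof.
rewrite /qn mulr_natl mulr2n sinD; have := sin_th => h; field.
by rewrite gt_eqF.
Qed.

Lemma qn_rec j : qn j.+2 + qn j = qn 2 * qn j.+1.
Proof.
rewrite qn2E /qn.
have -> : j.+2%:R * th = j.+1%:R * th + th by rewrite -natr1 mulrDl mul1r.
have -> : j%:R * th = j.+1%:R * th - th by rewrite -[j.+1%:R]natr1; ring.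
rewrite sinD sinB; have := sin_th => h; field; rewrite gt_eqF //.
Qed.

Lemma qn2_gt0 : 0 < qn 2. Proof. by apply: qn_gt0; apply: leq_trans r5. Qed.

(** The value of [alpha] when the two steps start at height j, where the axial distance is j + 1;
    [bc] is the corresponding [beta]. *)
Definition ac (j : nat) : R := qn j.+2 / (qn 2 * qn j.+1).
Definition bc (j : nat) : R := Num.sqrt (ac j * (1 - ac j)).

Lemma ac1 j : (j <= r - 2)%N -> 1 - ac j = qn j / (qn 2 * qn j.+1).
Proof.
move=> hj; have h : 0 < qn j.+1 by apply: qn_gt0; lia.
have := qn2_gt0 => h2; have e : qn j = qn 2 * qn j.+1 - qn j.+2 by rewrite -qn_rec addrAC subrr add0r.
by rewrite e /ac; field; rewrite !gt_eqF.
Qed.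

Lemma ac_0 : ac 0 = 1.
Proof. by rewrite /ac qn1 mulr1 divff // gt_eqF ?qn2_gt0. Qed.

Lemma ac_r : ac (r - 2) = 0.
Proof. by rewrite /ac -addn2 subnK ?qnr ?mul0r //; lia. Qed.

Lemma qn_ge0 m : (m <= r)%N -> 0 <= qn m.
Proof.
rewrite leq_eqVlt => /orP[/eqP ->|mr]; first by rewrite qnr.
by case: m mr => [|m mr]; rewrite ?qn0 // ltW // qn_gt0.
Qed.

Lemma ac_ge0 j : (j <= r - 2)%N -> 0 <= ac j.
Proof. by move=> hj; apply: divr_ge0; [|apply: mulr_ge0]; apply: qn_ge0; lia. Qed.

Lemma ac_le1 j : (j <= r - 2)%N -> 0 <= 1 - ac j.
Proof. by move=> hj; rewrite ac1 //; apply: divr_ge0; [|apply: mulr_ge0]; apply: qn_ge0; lia. Qed.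

Lemma bc_sqr j : (j <= r - 2)%N -> bc j ^+ 2 = ac j * (1 - ac j).
Proof. by move=> hj; rewrite sqr_sqrtr // mulr_ge0 ?ac_ge0 ?ac_le1. Qed.

Lemma bc_0 : bc 0 = 0.
Proof. by rewrite /bc ac_0 subrr mulr0 sqrtr0. Qed.

Lemma bc_r : bc (r - 2) = 0.
Proof. by rewrite /bc ac_r mul0r sqrtr0. Qed.

Lemma bc_gt0 j : (0 < j)%N -> (j <= r - 3)%N -> 0 < bc j.
Proof.
move=> j0 jr; rewrite sqrtr_gt0 ac1; last lia.
by apply: mulr_gt0; apply: divr_gt0; [|apply: mulr_gt0| |apply: mulr_gt0]; apply: qn_gt0; lia.
Qed.

Lemma qq_normD1 : (1 + q) * (1 + q)^*%C = (qn 2 ^+ 2)%:C%C.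
Proof.
have -> : (1 + q) * ((1 + q)^*)%C = 1 + q * q^*%C + (q + q^*%C).
  by rewrite rmorphD rmorph1; ring.
rewrite qq_unit.
rewrite qqE cisJD -[1 + 1]/(2%:R) -(rmorph_nat (real_complex R) 2) -rmorphD /=; congr (_%:C%C).
have -> : 2 * th = th + th by ring.
by rewrite qn2E cosD; have := cos2Dsin2 th; lra.
Qed.

End Numbers.

(** * The path representation *)

(* Paths are stored with their last step first; [true] is a step up. *)
Fixpoint ht (s : seq bool) : nat :=
  match s with
  | [::] => 0
  | true :: x => (ht x).+1
  | false :: x => (ht x).-1
  end.

Fixpoint adm (r : nat) (s : seq bool) : bool :=
  match s with
  | [::] => true
  | true :: x => adm r x && (ht x < r - 2)%N
  | false :: x => adm r x && (0 < ht x)%N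
  end.

Definition flip (s : seq bool) : seq bool :=
  match s with c :: d :: x => d :: c :: x | _ => s end.

(* The steps number [k] and [k.+1], counted from the end of the path. *)
Definition flipk (k : nat) (s : seq bool) : seq bool := take k s ++ flip (drop k s).

Lemma flipK s : flip (flip s) = s. Proof. by case: s => [|c [|d x]]. Qed.

Lemma size_flip s : size (flip s) = size s. Proof. by case: s => [|c [|d x]]. Qed.

Lemma size_flipk k s : size (flipk k s) = size s.
Proof. by rewrite size_cat size_flip -size_cat cat_take_drop. Qed.

Lemma drop_flipk k s : drop k (flipk k s) = flip (drop k s).
Proof.
rewrite /flipk; case: (leqP (size s) k) => h.
  by rewrite drop_oversize ?(drop_oversize h) // size_cat size_take_min /=; lia.
by rewrite drop_size_cat // size_take h.
Qed.

Lemma take_flipk k s : take k (flipk k s) = take k s.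
Proof.
rewrite /flipk; case: (leqP (size s) k) => h.
  by rewrite (drop_oversize h) /= cats0 take_takel.
by rewrite take_size_cat // size_take h.
Qed.

Lemma flipkK k s : flipk k (flipk k s) = s.
Proof. by rewrite {1}/flipk drop_flipk take_flipk flipK cat_take_drop. Qed.

Lemma flipk_add j k s : flipk (j + k) s = take j s ++ flipk k (drop j s).
Proof. by rewrite /flipk takeD drop_drop catA addnC. Qed.

Lemma adm_catr r w s : adm r (w ++ s) -> adm r s.
Proof. by elim: w => [//|c w IH]; case: c => /= /andP[/IH]. Qed.

Lemma adm_drop r k s : adm r s -> adm r (drop k s).
Proof. by rewrite -{1}(cat_take_drop k s); apply: adm_catr. Qed.

Lemma ht_cat w s s' : ht s = ht s' -> ht (w ++ s) = ht (w ++ s').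
Proof. by move=> h; elim: w => [//|[] w /= ->]. Qed.

Lemma adm_cat r w s s' : adm r s -> adm r s' -> ht s = ht s' ->
  adm r (w ++ s) = adm r (w ++ s').
Proof.
move=> a a' h; elim: w => [|c w IH]; first by rewrite /= a a'.
by case: c => /=; rewrite IH (ht_cat w h).
Qed.

Lemma adm_ht r s : adm r s -> (ht s <= r - 2)%N.
Proof. by elim: s => [//|[] s IH] /= /andP[/IH]; lia. Qed.

Section Paths.
Variables (R : realType) (b : bool) (r n : nat).
Local Notation C := R[i].
Local Notation q := (qq R b r).
Hypothesis r5 : (5 <= r)%N.

(** [dco] and [bco] are alpha and beta for the last two steps. Equal steps mean neighbouring boxes
    of one row, with d = -1, so [d + 1] = 0 and both coefficients vanish. *)
Definition dco (s : seq bool) : R :=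
  match s with
  | true :: false :: x => 1 - ac R r (ht x)
  | false :: true :: x => ac R r (ht x)
  | _ => 0
  end.

Definition bco (s : seq bool) : R :=
  match s with
  | true :: false :: x | false :: true :: x => bc R r (ht x)
  | _ => 0
  end.

Lemma bco_flip s : bco (flip s) = bco s.
Proof. by case: s => [|[] [|[] x]]. Qed.

(** A flip out of the strip would start at height 0 or r - 2, where [bc_0] and [bc_r] apply. *)
Lemma bco_adm s : adm r s -> bco s != 0 -> adm r (flip s) && (ht (flip s) == ht s).
Proof.
case: s => [|[] [|[] x]] //=; rewrite ?eqxx //.
- rewrite -andbA => /and3P[ax h1 h2] hb.
  have h3 : (ht x < r - 2)%N.
    rewrite ltn_neqAle (adm_ht ax) andbT; apply: contra hb => /eqP ->.
    by rewrite (bc_r _ r5).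
  by rewrite ax h3 /= prednK.
- rewrite -andbA => /and3P[ax h1 h2] hb.
  have h3 : (0 < ht x)%N.
    by rewrite lt0n; apply: contra hb => /eqP ->; rewrite (bc_0 _ r5).
  rewrite ax h3 /= prednK // eqxx andbT; lia.
Qed.

Definition np : nat := #|[set t : n.-tuple bool | adm r t]|.

Definition pth (i : 'I_np) : seq bool := tval (enum_val i).

Lemma pth_adm i : adm r (pth i).
Proof. by have := enum_valP i; rewrite inE. Qed.

Lemma pth_size i : size (pth i) = n. Proof. exact: size_tuple. Qed.

Lemma pth_inj : injective pth.
Proof. by move=> i j /val_inj/enum_val_inj. Qed.

Lemma pth_ex s : adm r s -> size s = n -> exists i, pth i = s.
Proof.
move=> a /eqP sz; have h : Tuple sz \in [set t : n.-tuple bool | adm r t] by rewrite inE.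
by exists (enum_rank_in h (Tuple sz)); rewrite /pth enum_rankK_in.
Qed.

Lemma sum_pth s (F : seq bool -> C) : adm r s -> size s = n ->
  \sum_i (pth i == s)%:R * F (pth i) = F s.
Proof.
move=> a sz; have [i hi] := pth_ex a sz.
rewrite (bigD1 i) //= hi eqxx mul1r big1 ?addr0 // => j ji.
rewrite -hi; case: eqP => [/pth_inj jj|]; last by rewrite mul0r.
by rewrite jj eqxx in ji.
Qed.

Definition mxf (H : seq bool -> seq bool -> C) : 'M[C]_np :=
  \matrix_(i, j) H (pth i) (pth j).

Definition genE k (s u : seq bool) : C :=
  (u == s)%:R * (dco (drop k s))%:C%C + (u == flipk k s)%:R * (bco (drop k s))%:C%C.

Definition Ek k : 'M[C]_np := mxf (genE k).

Lemma flipk_adm k s : adm r s -> bco (drop k s) != 0 ->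
  adm r (flipk k s) && (ht (flipk k s) == ht s).
Proof.
move=> a h; have /andP[a' /eqP h'] := bco_adm (adm_drop k a) h.
rewrite /flipk; have ad := adm_drop k a.
rewrite (adm_cat (take k s) a' ad h') cat_take_drop a /=.
by rewrite (ht_cat (take k s) h') cat_take_drop.
Qed.

Lemma Ek_mul k H : Ek k *m mxf H =
  mxf (fun s t => (dco (drop k s))%:C%C * H s t + (bco (drop k s))%:C%C * H (flipk k s) t).
Proof.
apply/matrixP => i j; rewrite !mxE.
under eq_bigr do rewrite !mxE /genE mulrDl -!mulrA.
rewrite big_split /=; congr (_ + _).
  exact: (sum_pth (fun p => _ * H p _) (pth_adm i) (pth_size i)).
(* With a zero coefficient the flipped sequence need not be a path, so [sum_pth] is available only
   in the other case. *)
have [->|h] := eqVneq (bco (drop k (pth i))) 0.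
  by rewrite mul0r big1 // => l _; rewrite mul0r mulr0.
have /andP[a _] := flipk_adm (pth_adm i) h.
by rewrite (sum_pth (fun p => _ * H p _) a) // size_flipk pth_size.
Qed.

Lemma genE_sym k s u : genE k s u = genE k u s.
Proof.
rewrite /genE; congr (_ + _).
  by case: eqP => [->|h]; case: eqP => // h'; rewrite ?mul0r //; case: h.
case: eqP => [->|h]; first by rewrite flipkK eqxx drop_flipk bco_flip.
by case: eqP => [e|]; rewrite ?mul0r //; case: h; rewrite e flipkK.
Qed.

Lemma mxf_adj H : (mxf H)^H = mxf (fun s t => (H t s)^*%C).
Proof. by apply/matrixP => i j; rewrite !mxE. Qed.

Lemma Ek_adj k : (Ek k)^H = Ek k.
Proof.
rewrite mxf_adj; apply/matrixP => i j; rewrite !mxE genE_sym /genE rmorphD !rmorphM.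
by rewrite !rmorph_nat /= !oppr0.
Qed.

Lemma dco_flip s : bco s != 0 -> dco (flip s) = 1 - dco s.
Proof. by case: s => [|[] [|[] x]] /=; rewrite ?eqxx // ?opprB ?addrA ?[1 + _]addrC ?addrK. Qed.

Lemma dco_sqr s : adm r s -> dco s ^+ 2 + bco s ^+ 2 = dco s.
Proof.
case: s => [|[] [|[] x]] /=; rewrite ?expr0n ?addr0 //= -andbA => /and3P[ax _ _].
  by rewrite (bc_sqr _ r5) ?(adm_ht ax) //; ring.
by rewrite (bc_sqr _ r5) ?(adm_ht ax) //; ring.
Qed.

Lemma Ek_idem k : Ek k *m Ek k = Ek k.
Proof.
rewrite Ek_mul; apply/matrixP => i j; rewrite !mxE /genE.
set s := pth i; set t := pth j.
rewrite drop_flipk bco_flip flipkK.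
have as_ : adm r (drop k s) by apply: adm_drop; apply: pth_adm.
have := dco_sqr as_; set d := dco _; set c := bco _ => h.
have [c0|c0] := eqVneq c 0.
  rewrite c0 expr0n addr0 in h *.
  by rewrite !mulr0 !mul0r !addr0 mulrCA -rmorphM /= -expr2 h.
have -> : dco (flip (drop k s)) = 1 - d by apply: dco_flip.
have hC : c%:C%C * c%:C%C = d%:C%C - d%:C%C * d%:C%C :> C.
  by rewrite -!rmorphM -rmorphB /=; congr (_%:C%C); clear -h; lra.
rewrite rmorphB rmorph1; set A := (_ == s)%:R; set B := (_ == _)%:R.
transitivity (A * (d%:C%C * d%:C%C + c%:C%C * c%:C%C) + B * c%:C%C); first ring.
by rewrite hC; ring.
Qed.

Definition Sk k : 'M[C]_np := q *: 1%:M - (1 + q) *: Ek k.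

Lemma Sk_unitary k : Sk k *m (Sk k)^H = 1%:M.
Proof.
rewrite /Sk adjB !adjZ adj1 Ek_adj; set p := 1 + q.
transitivity ((q * q^*%C) *: 1%:M + (p * p^*%C - q * p^*%C - p * q^*%C) *: Ek k).
  rewrite mulmxBl !mulmxBr -!scalemxAl -!scalemxAr !mul1mx mulmx1 Ek_idem.
  by move: (1%:M) (Ek k) => I E; apply/matrixP => i j; rewrite !mxE; ring.
have h := qq_unit R b r; rewrite h scale1r.
suff -> : p * p^*%C - q * p^*%C - p * q^*%C = 0 by rewrite scale0r addr0.
rewrite /p rmorphD rmorph1.
by transitivity (1 - q * q^*%C); [ring | rewrite h subrr].
Qed.

(* The matrix unit for initial segments [s], [t], tensored with the identity on the
   remaining steps. *)
Definition eu (s t : seq bool) : 'M[C]_np := mxf (fun p p' =>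
  [&& drop (n - size s) p == s, drop (n - size s) p' == t &
      take (n - size s) p == take (n - size s) p']%:R).

(** Exactly one intermediate path contributes, namely the given one with its initial segment s
    replaced by t. It is admissible because s and t end at the same height. *)
Lemma eu_mul s t u : size s = size t -> size u = size t -> (size t <= n)%N ->
  adm r s -> adm r t -> ht s = ht t -> eu s t *m eu t u = eu s u.
Proof.
move=> st ut tn as_ at_ hst; apply/matrixP => i j; rewrite !mxE.
under eq_bigr do rewrite !mxE.
rewrite st; set m := (n - size t)%N.
have [di|di] /= := eqVneq (drop m (pth i)) s; last first.
  by rewrite big1 // => l _; rewrite mul0r.
have szt : size (take m (pth i)) = m.
  by rewrite size_take_min pth_size; apply/minn_idPl; rewrite leq_subr.
have a1 : adm r (take m (pth i) ++ t).
  by rewrite -(adm_cat _ as_ at_ hst) -di cat_take_drop pth_adm.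
have a2 : size (take m (pth i) ++ t) = n by rewrite size_cat szt subnK.
pose F p : C := [&& drop m p == t, drop m (pth j) == u & take m p == take m (pth j)]%:R.
rewrite -[RHS](_ : F (take m (pth i) ++ t) = _); last first.
  by rewrite /F drop_size_cat // take_size_cat // eqxx.
rewrite -(sum_pth F a1 a2); apply: eq_bigr => l _; congr (_%:R * _).
rewrite -[in RHS](cat_take_drop m (pth l)) eqseq_cat; last first.
  by rewrite szt size_take_min pth_size; apply/minn_idPl; rewrite leq_subr.
by rewrite andbC [take m (pth l) == _]eq_sym.
Qed.

Lemma eu_mul0 s t t' u : size s = size t -> size t' = size t -> t != t' ->
  eu s t *m eu t' u = 0.
Proof.
move=> st tt' tne; apply/matrixP => i j; rewrite !mxE big1 // => l _; rewrite !mxE.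
rewrite st tt'; have [->|h] := eqVneq (drop _ (pth l)) t.
  by rewrite (negPf tne) mulr0.
by rewrite andbF mul0r.
Qed.

Lemma eu_nadm s t : (size s <= n)%N -> ~~ adm r s -> eu s t = 0.
Proof.
move=> sn h; apply/matrixP => i j; rewrite !mxE.
have [e|//] := eqVneq (drop _ (pth i)) s.
by move: h; rewrite -e adm_drop ?pth_adm.
Qed.

Lemma eu_adj s t : size s = size t -> (eu s t)^H = eu t s.
Proof.
move=> st; rewrite mxf_adj; apply/matrixP => i j; rewrite !mxE rmorph_nat st.
by rewrite andbCA eq_sym [take _ _ == _]eq_sym [drop _ (pth j) == _]eq_sym; congr (_%:R); rewrite ![_ == drop _ _]eq_sym.
Qed.

Lemma eu_split s t : size s = size t -> (size s < n)%N ->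
  eu s t = eu (true :: s) (true :: t) + eu (false :: s) (false :: t).
Proof.
move=> st sn; apply/matrixP => i j; rewrite !mxE /=.
set m := (n - (size s).+1)%N; have -> : (n - size s)%N = m.+1 by rewrite /m; lia.
have hm p : size p = n -> drop m p = nth true p m :: drop m.+1 p /\
    take m.+1 p = rcons (take m p) (nth true p m).
  by move=> hp; rewrite -drop_nth ?(take_nth true) // hp /m; lia.
have [-> ->] := hm _ (pth_size i); have [-> ->] := hm _ (pth_size j).
rewrite eqseq_rcons !eqseq_cons.
case: (nth true (pth i) m); case: (nth true (pth j) m) => /=;
  rewrite ?andbF ?andbT ?add0r ?addr0 //.
Qed.

Lemma Ek_eu j s t : (size s <= n)%N ->
  Ek (n - size s + j) *m eu s t =
  (dco (drop j s))%:C%C *: eu s t + (bco (drop j s))%:C%C *: eu (flipk j s) t.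
Proof.
move=> sn; rewrite /eu Ek_mul; apply/matrixP => i l; rewrite !mxE size_flipk.
set m := (n - size s)%N.
rewrite addnC -drop_drop; congr (_ + _).
  by have [->//|h] := eqVneq (drop m (pth i)) s; rewrite !mulr0.
have sz : size (take m (pth i)) = m.
  by rewrite size_take_min pth_size; apply/minn_idPl; rewrite leq_subr.
rewrite addnC flipk_add drop_size_cat // take_size_cat //.
have -> : (flipk j (drop m (pth i)) == s) = (drop m (pth i) == flipk j s).
  by apply/eqP/eqP => [<-|->]; rewrite flipkK.
have [->|h] := eqVneq (drop m (pth i)) (flipk j s); last by rewrite !mulr0.
by rewrite drop_flipk bco_flip.
Qed.

End Paths.

(** * Tableaux as paths *)

Lemma adm_rev r w : adm r (rev w) =
  [forall k : 'I_(size w).+1, (count negb (take k w) <= count id (take k w))%N &&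
     (count id (take k w) - count negb (take k w) <= r - 2)%N].
Proof.
(* The height formula is carried along, since admissibility of one more step is a condition on the
   height. *)
suff [h _] : adm r (rev w) = [forall k : 'I_(size w).+1, (count negb (take k w) <= count id (take k w))%N &&
     (count id (take k w) - count negb (take k w) <= r - 2)%N] /\
   (adm r (rev w) -> (ht (rev w) + count negb w = count id w)%N) by [].
elim/last_ind: w => [|w c [IH1 IH2]].
  by split=> //=; apply/esym/forallP => k.
rewrite rev_rcons -cats1 !count_cat /= addn0; split; last first.
  by case: c => /= /andP[/IH2 <-]; lia.
apply/idP/forallP => [h [k _]|h] /=.
  have aw : adm r (rev w) by case: (c) h => /andP[].
  have hw := IH2 aw; move: aw; rewrite IH1 => /forallP aw.
  case: (leqP k (size w)) => kw.
    by rewrite takel_cat //; have := aw (Ordinal (kw : k < (size w).+1)%N).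
  have sk : (size (w ++ [:: c]) <= k)%N by rewrite size_cat addn1.
  rewrite (take_oversize sk).
  have := aw ord_max; rewrite take_size.
  by rewrite !count_cat /=; case: (c) h => /= /andP[_]; lia.
have aw : adm r (rev w).
  rewrite IH1; apply/forallP => k.
  have := h (widen_ord _ k); rewrite /= takel_cat; last by rewrite -ltnS.
  by apply; rewrite size_cat addn1.
have hw := IH2 aw; have := h ord_max; rewrite take_size !count_cat /=.
by case: c {h} => /=; rewrite aw /=; lia.
Qed.

Lemma ht_rev r w : adm r (rev w) -> (ht (rev w) + count negb w = count id w)%N.
Proof.
elim/last_ind: w => [|w c IH] //; rewrite rev_rcons -cats1 !count_cat /= addn0.
by case: c => /= /andP[/IH <-]; lia.
Qed.

Section Tableaux.
Variables (n : nat) (lam : seq nat).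
Local Notation tabl := (tabl 2 n).

Definition rows (t : tabl) : seq bool := [seq p.1 == ord0 | p <- t].

Lemma size_rows t : size (rows t) = n.
Proof. by rewrite size_map size_tuple. Qed.

Lemma nth_rows t (a : 'I_n) : nth false (rows t) a = ((tnth t a).1 == ord0).
Proof. by rewrite (nth_map (tnth t a)) ?size_tuple // -tnth_nth. Qed.

Lemma ord2_eq (i j : 'I_2) : (i == j) = ((i == ord0) == (j == ord0)).
Proof. by case: i => [[|[|//]] ?]; case: j => [[|[|//]] ?]. Qed.

Lemma count_take (p : pred ('I_2 * 'I_n)) (t : tabl) (a : 'I_n) :
  count p (take a t) = #|[set c : 'I_n | (c < a)%N && p (tnth t c)]|.
Proof.
have an : (a <= n)%N by apply: ltnW.
rewrite -sum1_count (big_nth (tnth t a)) size_take size_tuple ltn_ord -[RHS]sum1_card.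
rewrite (eq_bigl (fun c : 'I_n => (c < a)%N && p (tnth t c))); last by move=> c; rewrite inE.
rewrite (eq_bigl (fun c : 'I_n => p (nth (tnth t a) t c) && (c < a)%N)); last first.
  by move=> c; rewrite andbC -tnth_nth.
rewrite -(big_mkord (fun c => p (nth (tnth t a) t c) && (c < a)%N) (fun=> 1%N)).
rewrite -(big_nat_widen _ _ _ (fun c => p (nth (tnth t a) t c))) //.
rewrite [LHS]big_nat_cond [RHS]big_nat_cond; apply: eq_bigl => c.
by case h : (_ <= _ < _)%N => //=; rewrite nth_take //; case/andP: h.
Qed.

(** Both sides count the boxes to the left of the given box in its row, which in a standard tableau
    hold precisely the smaller entries of that row. Hence the rows of the entries determine the
    tableau. *)
Lemma col_count (t : tabl) (a : 'I_n) : standard 2 n lam t ->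
  nat_of_ord (tnth t a).2 = count (fun p => p.1 == (tnth t a).1) (take a t).
Proof.
case/and5P => ut /allP shp /forallP full /forallP row _.
rewrite (count_take (fun p => p.1 == (tnth t a).1)).
have inj : injective (tnth t) by apply/tuple_uniqP.
rewrite -(card_imset _ inj).
transitivity #|[set ((tnth t a).1, d) | d : 'I_n in [set d : 'I_n | (d < (tnth t a).2)%N]]|.
  rewrite card_imset; last by move=> d e [].
  set m := (tnth t a).2; transitivity #|[set widen_ord (ltnW (ltn_ord m)) e | e : 'I_m]|.
    by rewrite card_imset ?card_ord // => d e /(congr1 val) /= /val_inj.
  congr #|pred_of_set _|; apply/setP => d; rewrite inE; apply/imsetP/idP.
    by case=> e _ ->; rewrite /= ltn_ord.
  by move=> h; exists (Ordinal h) => //; apply: val_inj.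
congr #|pred_of_set _|; apply/setP => p; apply/imsetP/imsetP => -[].
  move=> d; rewrite inE => dm ->.
  have := full ((tnth t a).1, d); rewrite /in_shape /=.
  have := shp _ (mem_tnth a t); rewrite /in_shape => ha.
  rewrite (ltn_trans dm ha) => /tnthP[c hc]; exists c => //; rewrite inE -hc /= eqxx andbT.
  by have /forallP/(_ a) := row c; rewrite -hc /= eqxx dm.
move=> c; rewrite inE => /andP[ca /eqP rc] ->; exists (tnth t c).2; last by rewrite -rc [LHS]surjective_pairing.
rewrite inE ltn_neqAle; apply/andP; split.
  apply: contraTneq ca => e; rewrite -leqNgt; have -> : c = a; last by [].
  by apply: inj; rewrite [LHS]surjective_pairing rc [RHS]surjective_pairing; congr pair; apply: val_inj.
rewrite leqNgt; apply/negP => h; have /forallP/(_ c) := row a.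
by rewrite rc eqxx h /= ltnNge (ltnW ca).
Qed.

Lemma col_rows (t : tabl) (a : 'I_n) : standard 2 n lam t ->
  nat_of_ord (tnth t a).2 = count (pred1 (nth false (rows t) a)) (take a (rows t)).
Proof.
move=> st; rewrite (col_count _ st) /rows -map_take count_map; apply: eq_count => p /=.
by rewrite -/(rows t) nth_rows -ord2_eq.
Qed.

Definition tpath (t : tabl) : seq bool := rev (rows t).

Lemma size_tpath t : size (tpath t) = n.
Proof. by rewrite size_rev size_rows. Qed.

Lemma tpath_inj t t' : standard 2 n lam t -> standard 2 n lam t' ->
  tpath t = tpath t' -> t = t'.
Proof.
move=> st st' /(can_inj revK) e; apply: eq_from_tnth => a.
rewrite [LHS]surjective_pairing [RHS]surjective_pairing; congr pair.
  by apply/eqP; rewrite ord2_eq -!nth_rows e.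
by apply: val_inj; rewrite /= (col_rows _ st) (col_rows _ st') e.
Qed.

Lemma adm_tablE r (t : tabl) : adm_tabl 2 r n t = adm r (tpath t).
Proof.
rewrite adm_rev; have e i : adm_diag 2 r (shape_sub 2 n t i) =
    (count negb (take (n - i) (rows t)) <= count id (take (n - i) (rows t)))%N &&
    (count id (take (n - i) (rows t)) - count negb (take (n - i) (rows t)) <= r - 2)%N.
  rewrite /adm_diag /young_diag /shape_sub /= andbT.
  rewrite -map_take !count_map.
  rewrite (eq_count (a1 := fun p : 'I_2 * 'I_n => nat_of_ord p.1 == 0%N) (a2 := preim (fun p => p.1 == ord0) id)) //.
  by rewrite (eq_count (a1 := fun p : 'I_2 * 'I_n => nat_of_ord p.1 == 1%N) (a2 := preim (fun p => p.1 == ord0) negb)) // => -[[[|[|//]] ?] ?].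
apply/forallP/forallP => h i.
  have hi : (n - i <= n)%N by apply: leq_subr.
  have i_n : (i <= n)%N by case: (i) => j /=; rewrite size_rows ltnS.
  by have := h (Ordinal (hi : n - i < n.+1)%N); rewrite e /= subKn.
rewrite e; have hi : (n - i < (size (rows t)).+1)%N by rewrite size_rows ltnS leq_subr.
exact: (h (Ordinal hi)).
Qed.

Lemma count_row0 (t : tabl) : standard 2 n lam t -> (nth 0%N lam 0 <= n)%N ->
  count id (rows t) = nth 0%N lam 0.
Proof.
move=> /and5P[ut /allP shp /forallP full _ _] ln.
rewrite count_map -sum1_count big_tuple sum1_card.
have inj : injective (tnth t) by apply/tuple_uniqP.
rewrite -(card_imset _ inj) -[RHS]card_ord.
rewrite -(card_imset (f := fun e => (ord0 : 'I_2, widen_ord ln e))); last first.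
  by move=> d e [] /val_inj.
congr #|pred_of_set _|; apply/setP => p; apply/imsetP/imsetP => -[].
  move=> c hc ->; have := shp _ (mem_tnth c t); rewrite /in_shape.
  have c0 : (tnth t c).1 = ord0 by apply/eqP.
  rewrite c0 /= => h; exists (Ordinal h) => //.
  by rewrite [LHS]surjective_pairing c0; congr pair; apply: val_inj.
move=> d _ ->; have := full (ord0, widen_ord ln d); rewrite /in_shape /= ltn_ord /=.
by case/tnthP => c hc; exists c => //; rewrite unfold_in /= -hc.
Qed.

Lemma in_LambdaE r : in_Lambda 2 r n lam -> exists l0 l1 : nat,
  [/\ lam = [:: l0; l1], (l1 <= l0)%N, (l0 + l1 = n)%N & (l0 - l1 <= r - 2)%N].
Proof.
case/andP => /andP[/andP[]]; case: lam => [|l0 [|l1 [|]]] //= _.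
by rewrite andbT addn0 => h1 h2 /eqP h3; exists l0, l1.
Qed.

Lemma ht_tpath r (t : tabl) : in_Lambda 2 r n lam -> t \in Defs.basis 2 r n lam ->
  ht (tpath t) = (nth 0%N lam 0 - nth 0%N lam 1)%N.
Proof.
move=> /in_LambdaE [l0 [l1 [el l10 ln lr]]]; rewrite inE adm_tablE => /andP[st ad].
have c0 := count_row0 st; rewrite el /= in c0 *.
have := ht_rev ad; have := count_predC id (rows t); rewrite size_rows c0; last by rewrite -ln leq_addr.
have -> : count (predC id) (rows t) = count negb (rows t) by apply: eq_count.
rewrite -/(tpath t) => h1 h2; lia.
Qed.

End Tableaux.

Definition flip_at (w : seq bool) (i : nat) : seq bool :=
  take i.-1 w ++ [:: nth false w i; nth false w i.-1] ++ drop i.+1 w.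

Lemma split_at (w : seq bool) i : (0 < i < size w)%N ->
  w = take i.-1 w ++ [:: nth false w i.-1; nth false w i] ++ drop i.+1 w.
Proof.
move=> /andP[i0 iw]; rewrite -[LHS](cat_take_drop i.-1) (drop_nth false); last lia.
by rewrite prednK // (drop_nth false).
Qed.

Lemma drop_rev_at (w : seq bool) i : (0 < i < size w)%N ->
  drop (size w - i - 1) (rev w) = [:: nth false w i, nth false w i.-1 & rev (take i.-1 w)].
Proof.
move=> h; rewrite {2}(split_at h) !rev_cat -!catA drop_size_cat //.
by rewrite size_rev size_drop; lia.
Qed.

Lemma rev_flip_at (w : seq bool) i : (0 < i < size w)%N ->
  rev (flip_at w i) = flipk (size w - i - 1) (rev w).
Proof.
move=> h; rewrite /flipk drop_rev_at // /flip_at !rev_cat -catA; congr (_ ++ _).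
rewrite {3}(split_at h) !rev_cat -!catA take_size_cat //.
by rewrite size_rev size_drop; lia.
Qed.

(** * Quantum integers as quotients of sines *)

Section QuantumIntegers.
Variables (R : realType) (b : bool) (r : nat).
Local Notation C := R[i].
Hypothesis r5 : (5 <= r)%N.
Local Notation th := (pi / r%:R : R).

Lemma qhalfE : qhalf R b r = cis b th. Proof. by []. Qed.

Lemma cisV (x : R) : (cis b x)^-1 = cis b (- x).
Proof.
have h : cis b x * cis b (- x) = 1 by rewrite -cisD subrr cis0.
have h0 : cis b x != 0 by apply/eqP => e; move/eqP: h; rewrite e mul0r eq_sym oner_eq0.
by apply: (mulfI h0); rewrite h mulfV.
Qed.

(** The factor [cis b (pi / 2)], which is i or - i, cancels between numerator and denominator of
    [qint], and with it the dependence on b. *)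
Lemma cisB (x : R) : cis b x - cis b (- x) = (cis b (pi / 2)) * (2 * sin x)%:C%C.
Proof.
rewrite /cis cos_pihalf sin_pihalf cosN sinN; set s := (if b then _ else _).
by apply/eqP; rewrite eq_complex /=; apply/andP; split; apply/eqP; ring.
Qed.

Lemma qint_nat (m : nat) : qint R b r m = (qn R r m)%:C%C.
Proof.
rewrite /qint qhalfE -exprnP -exprnN cisX !cisV !cisB /qn.
have s0 := sin_th R r5; have h0 : cis b (pi / 2) != 0 :> C.
  by apply/eqP => e; have := cis_unit b (pi / 2 : R); rewrite e mul0r => /eqP; rewrite eq_sym oner_eq0.
rewrite -mulf_div mulfV // mul1r fmorph_div !rmorphM /= -mulf_div mulfV ?mul1r //.
by rewrite rmorph_nat pnatr_eq0.
Qed.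

Lemma qintN (m : int) : qint R b r (- m) = - qint R b r m.
Proof. by rewrite /qint opprK -mulNr opprB. Qed.

End QuantumIntegers.

(** An adjacent transposition reverses the order of no pair but the transposed one, so standardness
    after a swap has to be examined only there. *)
Lemma tperm_lt n (a a' c d : 'I_n) : a' = a.+1 :> nat ->
  (tperm a a' c < tperm a a' d)%N -> (c < d)%N \/ tperm a a' c = a /\ tperm a a' d = a'.
Proof.
move=> aa; case: (tpermP a a' c) => [->|->|/eqP hc /eqP hc'];
  case: (tpermP a a' d) => [->|->|/eqP hd /eqP hd'] h; try (by right); left;
  rewrite -?val_eqE /= ?ltnn // in h *; try lia.
- by move: hd'; rewrite -val_eqE /=; lia.
- by move: hc; rewrite -val_eqE /=; lia.
Qed.

(** * Exchanging two consecutive entries *)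

Section Swap.
Variables (n : nat) (t : tabl 2 n) (i : nat).
Hypothesis i_n : (0 < i < n)%N.
Let i0 : (0 < i)%N. Proof. by case/andP: i_n. Qed.
Let lt_i : (i < n)%N. Proof. by case/andP: i_n. Qed.
Let lt_i1 : (i.-1 < n)%N. Proof. by rewrite (leq_ltn_trans (leq_pred i)). Qed.
Let w := rows t.

Lemma tnth_swap (a a' c : 'I_n) : a = i.-1 :> nat -> a' = i :> nat ->
  tnth (swap_tabl 2 n t i) c = tnth t (tperm a a' c).
Proof.
move=> ea ea'; rewrite tnth_mktuple; congr tnth; apply: val_inj.
case: tpermP => [->|->|/eqP h /eqP h'] /=.
- by rewrite ea eqxx val_insubd lt_i ea'.
- by rewrite ea' eqxx -{1}(prednK i0) eqn_leq ltnn val_insubd lt_i1 ea.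
have -> : (nat_of_ord c == i.-1) = false by rewrite -ea; apply: negbTE.
by have -> : (nat_of_ord c == i) = false by rewrite -ea'; apply: negbTE.
Qed.

Lemma rows_swap : rows (swap_tabl 2 n t i) = flip_at w i.
Proof.
have sw : size w = n by apply: size_rows.
apply: (@eq_from_nth _ false).
  rewrite size_rows /flip_at !size_cat size_take size_drop sw lt_i1 /=; lia.
move=> m; rewrite size_rows => mn; rewrite (nth_rows _ (Ordinal mn)) (@tnth_swap (Ordinal lt_i1) (Ordinal lt_i)) // -nth_rows -/w.
rewrite /flip_at nth_cat size_take sw lt_i1.
case: tpermP => [/(congr1 val) /= ->|/(congr1 val) /= ->|/eqP h /eqP h'] /=.
- by rewrite ltnn subnn.
- have -> : (i < i.-1)%N = false by lia.
  by have -> : (i - i.-1 = 1)%N by lia.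
case: ltnP => hm; first by rewrite nth_take.
have {}h : m != i.-1 by []. have {}h' : m != i by [].
have -> : (m - i.-1 = (m - i.+1).+2)%N by lia.
by rewrite /= nth_drop; congr nth; lia.
Qed.

Lemma tpath_swap : tpath (swap_tabl 2 n t i) = flipk (n - i - 1) (tpath t).
Proof. by rewrite /tpath rows_swap rev_flip_at size_rows. Qed.

End Swap.

(** * The coefficients of a tableau read off its path *)

Section Generators.
Variables (R : realType) (b : bool) (r n : nat) (lam : seq nat).
Local Notation C := R[i].
Hypothesis r5 : (5 <= r)%N.
Local Notation tabl := (tabl 2 n).
Local Notation std := (standard 2 n lam).

Variables (t : tabl) (i : nat).
Hypothesis i_n : (0 < i < n)%N.
Let i0 : (0 < i)%N. Proof. by case/andP: i_n. Qed.
Let lt_i : (i < n)%N. Proof. by case/andP: i_n. Qed.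
Let lt_i1 : (i.-1 < n)%N. Proof. by rewrite (leq_ltn_trans (leq_pred i)). Qed.
Let a : 'I_n := Ordinal lt_i1.
Let a' : 'I_n := Ordinal lt_i.
Let w := rows t.
Let x := rev (take i.-1 w).

Lemma rowE (c : 'I_n) : nat_of_ord (tnth t c).1 = ~~ nth false w c.
Proof. by rewrite nth_rows; case: (tnth t c).1 => [[|[|//]] ?]. Qed.

Lemma pos_ord (c : 'I_n) : pos 2 n t c.+1 = (nat_of_ord (tnth t c).1, nat_of_ord (tnth t c).2).
Proof. by rewrite /pos /= (nth_map (tnth t c)) ?size_tuple // -tnth_nth. Qed.

Let drop_path : drop (n - i - 1) (tpath t) = [:: nth false w i, nth false w i.-1 & x].
Proof. by rewrite /tpath -{1}(size_rows t) drop_rev_at // size_rows. Qed.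

Lemma dcontE : std t -> dcont 2 n t i i.+1 =
  (count (pred1 (nth false w i.-1)) x)%:Z
  - (count (pred1 (nth false w i)) x + (nth false w i.-1 == nth false w i))%:Z
  - ((~~ nth false w i.-1)%:Z - (~~ nth false w i)%:Z).
Proof.
move=> st; rewrite /dcont; have -> : pos 2 n t i = pos 2 n t a.+1 by rewrite /= prednK.
rewrite (pos_ord a) (pos_ord a') /= !rowE !(col_rows _ st) /= -/w.
have hw : (i.-1 < size w)%N by rewrite size_rows.
have -> : take i w = rcons (take i.-1 w) (nth false w i.-1) by rewrite -take_nth // prednK.
by rewrite /x !count_rev -cats1 count_cat /= addn0.
Qed.

Hypothesis st : std t.
Hypothesis ad : adm r (tpath t).

Let adx : adm r x.
Proof. by have := adm_drop (n - i - 1) ad; rewrite drop_path; do 2![case: (nth _ _ _) => /= /andP[+ _]]. Qed.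

Let htx : (ht x + count (pred1 false) x = count (pred1 true) x)%N.
Proof.
have := ht_rev (w := rev x); rewrite revK !count_rev => /(_ _ adx).
rewrite (eq_count (a1 := negb) (a2 := pred1 false)); last by case.
by rewrite (eq_count (a1 := id) (a2 := pred1 true)) //; case.
Qed.

Lemma alpha_dco : alpha R b r 2 n t i = (dco R r (drop (n - i - 1) (tpath t)))%:C%C.
Proof.
rewrite /alpha (dcontE st) drop_path.
have h2 := qn2_gt0 R r5; have hx := adm_ht adx.
have E (m : nat) : qint R b r m = (qn R r m)%:C%C := qint_nat R b r5 m.
have E2 : qint R b r 2 = (qn R r 2)%:C%C := E 2%N.
case: (nth _ _ i.-1) (nth _ _ i) => -[] /=; rewrite ?eqxx ?addn1 ?addn0 ?subrr ?subr0.
- have -> : (count (pred1 true) x)%:Z - (count (pred1 true) x).+1%:Z + 1 = 0%N%:Z by lia.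
  by rewrite E qn0 rmorph0 mul0r.
- have -> : (count (pred1 true) x)%:Z - (count (pred1 false) x)%:Z - (0%N%:Z - 1%N%:Z) = (ht x).+1%:Z by lia.
  have -> : (ht x).+1%:Z + 1 = (ht x).+2%:Z by lia.
  by rewrite E2 !E /ac -rmorphM -fmorph_div.
- have -> : (count (pred1 false) x)%:Z - (count (pred1 true) x)%:Z - 1%N%:Z = - (ht x).+1%:Z by lia.
  have -> : - (ht x).+1%:Z + 1 = - (ht x)%:Z by lia.
  by rewrite !qintN E2 !E ac1 // mulrN invrN mulrNN -rmorphM -fmorph_div.
have -> : (count (pred1 false) x)%:Z - (count (pred1 false) x).+1%:Z + 1 = 0%N%:Z by lia.
by rewrite E qn0 rmorph0 mul0r.
Qed.

Lemma beta_bco : beta R b r 2 n t i = (bco R r (drop (n - i - 1) (tpath t)))%:C%C.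
Proof.
rewrite /beta alpha_dco; set d := dco _ _ _.
have -> : d%:C%C * (1 - d%:C%C) = (d * (1 - d))%:C%C :> C by rewrite rmorphM rmorphB rmorph1.
rewrite /= /d drop_path; congr (_%:C%C).
case: (nth _ _ i.-1) (nth _ _ i) => -[] //=; rewrite ?mul0r ?sqrtr0 // /bc.
by rewrite subKr mulrC.
Qed.

(** A nonzero coefficient puts i and i + 1 in different rows; they are not in one column either,
    since i + 1 below i means that the path returns to its height before both steps, which is then
    0, where [bc_0] applies. *)
Lemma swap_basis : bco R r (drop (n - i - 1) (tpath t)) != 0 ->
  std (swap_tabl 2 n t i) /\ adm r (tpath (swap_tabl 2 n t i)).
Proof.
move=> h; split; last first.
  by rewrite tpath_swap; have /andP[] := flipk_adm r5 ad h.
have hx0 : nth false w i = false -> (count (pred1 true) x != count (pred1 false) x)%N.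
  move=> e; apply: contra h => /eqP h0; have hx : ht x = 0%N by clear -htx h0; lia.
  by rewrite drop_path e; case: (nth _ _ _) => //=; rewrite hx bc_0.
have hne : nth false w i.-1 != nth false w i.
  by apply: contra h => /eqP e; rewrite drop_path e; case: (nth _ _ _).
have /and5P[ut shp full row col] := st.
have pe : perm_eq (swap_tabl 2 n t i) t.
  apply/tuple_permP; exists (tperm a a'); apply: (congr1 val).
  by apply: eq_from_tnth => c; rewrite (tnth_swap _ i_n _ (a := a) (a' := a')) // tnth_mktuple.
have tp (c d : 'I_n) : (tperm a a' c < tperm a a' d)%N -> (c < d)%N \/ tperm a a' c = a /\ tperm a a' d = a'.
  by apply: tperm_lt; rewrite /= prednK.
have step : std (swap_tabl 2 n t i); last exact: step.
apply/and5P; split.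
- by rewrite (perm_uniq pe).
- by rewrite (perm_all _ pe).
- apply/forallP => p; rewrite (perm_mem pe); exact: (forallP full).
- apply/forallP => c; apply/forallP => d; rewrite !(tnth_swap _ i_n _ (a := a) (a' := a')) //; apply/implyP => h1.
  have /forallP/(_ (tperm a a' d)) := forallP row (tperm a a' c).
  rewrite h1 => /tp[//|[ec ed]]; move: h1; rewrite ec ed => /andP[+ _].
  by rewrite ord2_eq -!nth_rows (negPf hne).
apply/forallP => c; apply/forallP => d; rewrite !(tnth_swap _ i_n _ (a := a) (a' := a')) //; apply/implyP => h1.
have /forallP/(_ (tperm a a' d)) := forallP col (tperm a a' c).
rewrite h1 => /tp[//|[ec ed]]; move: h1; rewrite ec ed => /andP[/eqP/(congr1 val) /= e2].
rewrite !rowE /= -/w => hr; have wi : nth false w i = false by case: (nth _ _ i) hr => //; rewrite ltn0.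
have wi1 : nth false w i.-1 = true by rewrite wi in hne; case: (nth _ _ i.-1) hne.
move: e2; rewrite !(col_rows _ st) /= -/w wi wi1.
have hw : (i.-1 < size w)%N by rewrite size_rows.
have -> : take i w = rcons (take i.-1 w) (nth false w i.-1) by rewrite -take_nth // prednK.
rewrite -cats1 count_cat wi1 /= !addn0 => e2.
by have := hx0 wi; rewrite /x !count_rev e2 eqxx.
Qed.

End Generators.

(** * The induction on the number of steps *)

Section Braids.
Variables (R : realType) (b : bool) (r n : nat).
Local Notation C := R[i].
Local Notation q := (qq R b r).
Hypothesis r5 : (5 <= r)%N.
Local Notation Sk := (@Sk R b r n).
Local Notation eu := (@eu R r n).
Local Notation ac := (ac R r).
Local Notation bc := (bc R r).

(** Positions are counted from the end of the path, so sigma_i acts at n - i - 1. Its inverse is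
    written as the adjoint. *)
Definition sig (x : nat * bool) : 'M[C]_(np r n) :=
  if x.2 then Sk (n - x.1 - 1) else (Sk (n - x.1 - 1))^H.

Definition repw (w : seq (nat * bool)) : 'M[C]_(np r n) :=
  foldr (fun x M => sig x *m M) 1%:M w.

Definition Gr (g : 'M[C]_(np r n)) : Prop := exists2 w, braid_word n w & g = repw w.

Lemma repw_cat u v : repw (u ++ v) = repw u *m repw v.
Proof. by elim: u => [|x u IH] /=; rewrite ?mul1mx // IH mulmxA. Qed.

Lemma sig_unitary x : sig x *m (sig x)^H = 1%:M.
Proof.
rewrite /sig; case: x.2; first exact: Sk_unitary.
by rewrite adjK; apply: mulmx1C; apply: Sk_unitary.
Qed.

Lemma Gr_group : unitary_group Gr.
Proof.
split.
- by exists [::].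
- move=> _ _ [u hu ->] [v hv ->]; exists (u ++ v); last by rewrite repw_cat.
  by rewrite /braid_word all_cat; apply/andP.
- move=> _ [w hw ->]; exists (rev [seq (x.1, ~~ x.2) | x <- w]).
    by rewrite /braid_word all_rev all_map.
  elim: w {hw} => [|x w IH] /=; first by rewrite adj1.
  rewrite adjM IH rev_cons -cats1 repw_cat /= mulmx1; congr (_ *m _).
  by rewrite /sig /=; case: x.2; rewrite //= adjK.
- move=> _ [w _ ->]; elim: w => [|x w IH] /=; first by rewrite adj1 mulmx1.
  by rewrite adjM -mulmxA [repw w *m (_ *m _)]mulmxA IH mul1mx sig_unitary.
Qed.

Lemma Gr_Sk m j : (j + 2 <= m)%N -> (m <= n)%N -> Gr (Sk (n - m + j)).
Proof.
move=> jm mn; exists [:: ((m - 1 - j)%N, true)]; last first.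
  by rewrite /= mulmx1 /sig /=; congr Sk; lia.
by rewrite /= andbT; lia.
Qed.

Definition Ac (s : seq bool) : C := q - (1 + q) * (dco R r s)%:C%C.
Definition Bc (s : seq bool) : C := - (1 + q) * (bco R r s)%:C%C.

Lemma Sk_eu j s t : (size s <= n)%N ->
  Sk (n - size s + j) *m eu s t =
  Ac (drop j s) *: eu s t + Bc (drop j s) *: eu (flipk j s) t.
Proof.
move=> sn; rewrite /Sk mulmxBl -!scalemxAl mul1mx (Ek_eu R r5) // scalerDr !scalerA.
by rewrite opprD addrA -scalerBl /Bc mulNr scaleNr.
Qed.

Lemma Sk_eu0 c d x t : (size x + 2 <= n)%N ->
  Sk (n - (size x).+2) *m eu (c :: d :: x) t =
  Ac (c :: d :: x) *: eu (c :: d :: x) t + Bc (c :: d :: x) *: eu (d :: c :: x) t.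
Proof. by move=> sn; have := @Sk_eu 0 (c :: d :: x) t; rewrite addn0 => -> //=; lia. Qed.

Lemma eu_SkH0 c d x s : size s = (size x).+2 -> (size x + 2 <= n)%N ->
  eu s (c :: d :: x) *m (Sk (n - (size x).+2))^H =
  (Ac (c :: d :: x))^*%C *: eu s (c :: d :: x) + (Bc (c :: d :: x))^*%C *: eu s (d :: c :: x).
Proof.
move=> ss sn; rewrite -[LHS]adjK adjM adjK eu_adj // Sk_eu0 // adjD !adjZ.
by rewrite !eu_adj.
Qed.

Lemma AcTT c x : Ac (c :: c :: x) = q.
Proof. by rewrite /Ac; case: c; rewrite /= rmorph0 mulr0 subr0. Qed.

Lemma BcTT c x : Bc (c :: c :: x) = 0.
Proof. by rewrite /Bc; case: c; rewrite /= rmorph0 mulr0. Qed.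

Local Notation L := (ctang Gr).

Definition node m l (s : seq bool) := [&& size s == m, adm r s & ht s == l].

Lemma nodeP m l s : reflect [/\ size s = m, adm r s & ht s = l] (node m l s).
Proof. by apply: (iffP and3P) => -[/eqP ? ? /eqP ?]. Qed.

Lemma node_size m l s : node m l s -> size s = m. Proof. by case/nodeP. Qed.

Lemma node_T m l s : node m l s -> (l < r - 2)%N -> node m.+1 l.+1 (true :: s).
Proof. by case/nodeP => h1 h2 h3 hl; rewrite /node /= h1 h2 h3 hl !eqxx. Qed.

Lemma node_F m l s : node m l.+1 s -> node m.+1 l (false :: s).
Proof. by case/nodeP => h1 h2 h3; rewrite /node /= h1 h2 h3 !eqxx. Qed.

Lemma node_Tinv m l s : node m.+1 l (true :: s) -> exists2 l', l = l'.+1 & node m l' s.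
Proof.
case/nodeP => /= -[h1] /andP[h2 h3] h4; exists (ht s) => //.
by rewrite /node h1 h2 !eqxx.
Qed.

Lemma node_Finv m l s : node m.+1 l (false :: s) -> node m l.+1 s.
Proof.
case/nodeP => /= -[h1] /andP[h2 h3] h4.
by rewrite /node h1 h2 -h4 prednK // !eqxx.
Qed.

Lemma node_le m l s : node m l s -> (l <= r - 2)%N.
Proof. by case/nodeP => _ /adm_ht h <-. Qed.

Lemma eu_mulN m l s t u : (m <= n)%N -> node m l s -> node m l t -> size u = m ->
  eu s t *m eu t u = eu s u.
Proof.
move=> mn /nodeP[s1 s2 s3] /nodeP[t1 t2 t3] u1.
by apply: eu_mul; rewrite ?s1 ?t1 ?u1 ?s3 ?t3.
Qed.

(* [good m l] concerns the initial segments of length [m] and final height [l]. *)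
Definition good m l := forall s t, node m l s -> node m l t -> s != t -> L (eu s t).

Lemma L_mul m l s t u : (m <= n)%N -> node m l s -> node m l t -> size u = m ->
  s != u -> L (eu s t) -> L (eu t u) -> L (eu s u).
Proof.
move=> mn hs ht_ hu su h1 h2; have := ctang_bracket Gr_group h1 h2.
rewrite (eu_mulN mn hs ht_ hu) eu_mul0 ?subr0 // ?(node_size hs) ?(node_size ht_) //.
by rewrite eq_sym.
Qed.

Lemma L_adj s t : size s = size t -> L (eu s t) -> L (eu t s).
Proof. by move=> st /(ctangH Gr_group); rewrite eu_adj. Qed.

Lemma L_lift m s t : size s = m -> size t = m -> (m < n)%N -> L (eu s t) ->
  L (eu (true :: s) (true :: t) + eu (false :: s) (false :: t)).
Proof. by move=> sm tm mn; rewrite eu_split // sm. Qed.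

(** Bracketing with the lift of e_{g,g0} replaces g0 by any g: the half of the lift that acts on
    paths with a final step up contributes nothing, as k and g end at different heights. Adjoints
    and products through [g0] or [k0] then give the remaining units. *)
Lemma spread m l g0 k0 : (m < n)%N -> (l < r - 2)%N -> good m l.+2 -> node m l.+2 g0 -> node m l k0 ->
  (forall k, node m l k -> L (eu (false :: g0) (true :: k))) -> good m.+1 l.+1.
Proof.
move=> mn lr gd hg0 hk0 hk.
have FT g k : node m l.+2 g -> node m l k -> L (eu (false :: g) (true :: k)).
  move=> hg nk; have [->|gg0] := eqVneq g g0; first exact: hk.
  have h := L_lift (node_size hg) (node_size hg0) mn (gd g g0 hg hg0 gg0).
  have := ctang_bracket Gr_group h (hk k nk).
  have sg := node_size hg; have sg0 := node_size hg0; have sk := node_size nk.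
  rewrite mulmxDl mulmxDr ![eu (false :: g0) (true :: k) *m _]eu_mul0 //=; rewrite ?sg ?sg0 ?sk //.
    rewrite (@eu_mul0 _ _ _ (true :: g)) //= ?sg ?sg0 //.
    rewrite (@eu_mulN m.+1 l.+1) ?addr0 ?add0r ?subr0 //=; rewrite ?sk //.
      exact: node_F.
    exact: node_F.
  apply/eqP => -[kg]; move: nk; rewrite kg => /nodeP[_ _ e].
  by case/nodeP: hg => _ _; rewrite e; lia.
have TF g k : node m l.+2 g -> node m l k -> L (eu (true :: k) (false :: g)).
  move=> hg nk; apply: L_adj; last exact: FT.
  by rewrite /= (node_size hg) (node_size nk).
have NT k : node m l k -> node m.+1 l.+1 (true :: k).
  by move=> nk; apply: node_T.
move=> [|[] s] [|[] t] hs ht_ st; try by case/nodeP: hs; case/nodeP: ht_.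
- have [_ [<-] ns] := node_Tinv hs; have [_ [<-] nt] := node_Tinv ht_.
  apply: (@L_mul m.+1 l.+1 _ (false :: g0)) => //; rewrite ?(node_size ht_) //.
  + exact: node_F.
  + exact: TF.
  + exact: FT.
- have [_ [<-] ns] := node_Tinv hs.
  by apply: TF => //; apply: node_Finv.
- have [_ [<-] nt] := node_Tinv ht_.
  by apply: FT => //; apply: node_Finv.
have ns := node_Finv hs; have nt := node_Finv ht_.
apply: (@L_mul m.+1 l.+1 _ (true :: k0)) => //; rewrite ?(node_size ht_) //.
- exact: NT.
- exact: FT.
- exact: TF.
Qed.

Lemma Bc_neq0 l x : (0 < l)%N -> (l <= r - 3)%N -> ht x = l ->
  Bc (true :: false :: x) != 0 /\ Bc (false :: true :: x) != 0.
Proof.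
move=> l0 lr hx; have h : - (1 + q) * (bc l)%:C%C != 0.
  rewrite mulf_neq0 ?oppr_eq0 ?(qq_neqN1 R b r5) //.
  have := bc_gt0 R r5 l0 lr; rewrite lt0r => /andP[h _].
  by apply: contra h => /eqP h; apply/eqP; apply: complexI; rewrite h rmorph0.
by rewrite /Bc /= hx.
Qed.

Lemma node_parity m l s : node m l s -> (l <= m)%N /\ odd l = odd m.
Proof.
elim: m l s => [|m IH] l [|[] s] /nodeP [] //=; first by move=> _ _ <-.
- move=> -[sm] /andP[a h] <-; have [|h1 h2] := IH (ht s) s; first by rewrite /node sm a !eqxx.
  by rewrite /= h2 ltnS.
- move=> -[sm] /andP[a h] <-; have [|h1 h2] := IH (ht s) s; first by rewrite /node sm a !eqxx.
  split; first by apply: leq_trans (leqW h1); apply: leq_pred.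
  by rewrite -h2 -[in RHS](prednK h) /= negbK.
Qed.

Lemma node_top m s : node m m s -> s = nseq m true.
Proof.
elim: m s => [|m IH] [|c s] h //; try by case/nodeP: h.
case: c h => h; first by have [_ [<-] h'] := node_Tinv h; rewrite /= -(IH s h').
by have [] := node_parity (node_Finv h); rewrite ltnNge leqnSn.
Qed.

Lemma node_alt j : node j.*2 0 (iter j (fun x => false :: true :: x) [::]).
Proof.
elim: j => [|j IH]; first by rewrite /node !eqxx.
by rewrite doubleS iterS; apply: node_F; apply: node_T => //; lia.
Qed.

Lemma node_ex m l : (l <= m)%N -> odd l = odd m -> (l <= r - 2)%N -> exists s, node m l s.
Proof.
move=> lm om lr; have [j hj] : exists j, m = (j.*2 + l)%N.
  exists (m - l)./2; rewrite halfK oddB // om addbb subn0 subnK //.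
rewrite {}hj; elim: l lr {lm om} => [|l IH] lr.
  by exists (iter j (fun x => false :: true :: x) [::]); rewrite addn0; apply: node_alt.
have [s hs] := IH (ltnW lr); exists (true :: s); rewrite addnS; exact: node_T.
Qed.

Lemma node0_other m g : (4 <= m)%N -> ~~ odd m -> exists2 k, node m 0 k & k != g.
Proof.
move=> m4 om; have [w hw] : exists w, node (m - 4)%N 0 w.
  by apply: node_ex => //; rewrite oddB // (negPf om).
have h1 : node m 0 [:: false, true, false, true & w].
  rewrite -(subnK m4) addn4; apply: node_F; apply: node_T; last lia.
  by apply: node_F; apply: node_T => //; lia.
have h2 : node m 0 [:: false, false, true, true & w].
  rewrite -(subnK m4) addn4; apply: node_F; apply: node_F.
  by apply: node_T; [apply: node_T|] => //; lia.
have [e|h] := eqVneq [:: false, true, false, true & w] g.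
  by exists [:: false, false, true, true & w] => //; rewrite -e.
by exists [:: false, true, false, true & w].
Qed.

(** The lift v + w has v at height l + 2 and w at height l. The braid generator on the last two
    steps multiplies equal steps by q and mixes different ones, so conjugation brings in v' and w'.
    Each of these links a path that ends with a step down to one that ends with a step up, as
    [spread] requires. *)
Lemma bridge p l x z (A := Ac (true :: false :: x)) (B := Bc (true :: false :: x))
    (A' := (Ac (false :: true :: z))^*%C) (B' := (Bc (false :: true :: z))^*%C)
    (v := eu [:: true, false & x] [:: true, true & z])
    (v' := eu [:: false, true & x] [:: true, true & z])
    (w := eu [:: false, false & x] [:: false, true & z])
    (w' := eu [:: false, false & x] [:: true, false & z]) :
  (p.+2 <= n)%N -> node p l.+2 x -> node p l z -> good p.+1 l.+1 ->
  L (v + w) /\ L (q^*%C *: (A *: v + B *: v') + q *: (A' *: w + B' *: w')).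
Proof.
move=> pn nx nz gd.
have ns : node p.+1 l.+1 (false :: x) by exact: node_F.
have nt : node p.+1 l.+1 (true :: z).
  by apply: node_T => //; move: (node_le nx); lia.
have sx := node_size nx; have sz := node_size nz.
have h0 : L (v + w).
  by apply: (@L_lift p.+1); rewrite ?(node_size ns) ?(node_size nt) //; apply: gd.
split => //.
have GS : Gr (Sk (n - p.+2)) by rewrite -[(n - p.+2)%N]addn0; apply: Gr_Sk; lia.
have := ctang_conj Gr_group GS h0.
have pn2 : (p + 2 <= n)%N by rewrite addn2.
have e1 := @Sk_eu0 true false x [:: true, true & z].
have e2 := @Sk_eu0 false false x [:: false, true & z].
have f1 s : size s = p.+2 -> _ := fun h => @eu_SkH0 true true z s (etrans h (congr1 (addn 2) (esym sz))).
have f2 s : size s = p.+2 -> _ := fun h => @eu_SkH0 false true z s (etrans h (congr1 (addn 2) (esym sz))).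
rewrite sx AcTT BcTT scale0r addr0 in e1 e2; rewrite sz AcTT BcTT rmorph0 in f1 f2.
rewrite mulmxDr mulmxDl /v /w e1 // e2 // !mulmxDl -!scalemxAl.
rewrite !f1 ?f2 /= ?sx // !scale0r !addr0 -/A -/B -/A' -/B' -/v -/v' -/w -/w'.
by rewrite !scalerDr !scalerA ![_ * q^*%C]mulrC.
Qed.

(* One unit linking a path ending with a step down to one ending with a step up
   yields all of them, by brackets with the units for one step less. *)
Lemma spread1 m l g0 k0 : (m < n)%N -> (l < r - 2)%N -> good m l -> good m l.+2 ->
  node m l.+2 g0 -> node m l k0 -> L (eu (false :: g0) (true :: k0)) -> good m.+1 l.+1.
Proof.
move=> mn lr gl gd hg0 hk0 h0; apply: (spread mn lr gd hg0 hk0) => k nk.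
have [->//|kk0] := eqVneq k k0; rewrite eq_sym in kk0.
have h := L_lift (node_size hk0) (node_size nk) mn (gl k0 k hk0 nk kk0).
have := ctang_bracket Gr_group h0 h.
have sk := node_size nk; have sk0 := node_size hk0; have sg0 := node_size hg0.
rewrite mulmxDr mulmxDl ![_ *m eu (false :: g0) (true :: k0)]eu_mul0 /= ?sk ?sk0 ?sg0 //.
  rewrite [_ *m eu (false :: k0) _]eu_mul0 /= ?sk0 ?sk ?sg0 //.
  have nF := node_F hg0; have nT := node_T hk0 lr.
  by rewrite (eu_mulN mn nF nT) /= ?sk // !addr0 subr0.
apply/eqP => -[kg]; move: nk; rewrite kg => /nodeP[_ _ e].
by case/nodeP: hg0 => _ _; rewrite e; lia.
Qed.

Lemma L_scale (c : C) X : c != 0 -> L (c *: X) -> L X.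
Proof.
by move=> c0 /(ctangZ Gr_group c^-1); rewrite scalerA mulVf // scale1r.
Qed.

(** Trace and determinant of a block with eigenvalues -1 and q. *)
Lemma Ac_pair x (A := Ac (true :: false :: x)) (A' := Ac (false :: true :: x))
    (B := Bc (true :: false :: x)) : adm r x ->
  A + A' = q - 1 /\ A * A' - B ^+ 2 = - q.
Proof.
move=> ax; rewrite /A /A' /B /Ac /Bc /=; set a : C := (ac (ht x))%:C%C.
rewrite rmorphB rmorph1 -/a; split; first ring.
have : (bc (ht x))%:C%C ^+ 2 = a * (1 - a) :> C.
  by rewrite -rmorphXn /= (bc_sqr R r5) ?(adm_ht ax) // rmorphM rmorphB rmorph1.
set y := (bc _)%:C%C => h.
transitivity (q * q - q * (1 + q) + (1 + q) ^+ 2 * (a * (1 - a) - y ^+ 2)); first ring.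
by rewrite h; ring.
Qed.

Lemma qqJ_neq0 : q^*%C != 0.
Proof.
apply/eqP => h; have := qq_unit R b r; rewrite h mulr0 => /eqP.
by rewrite eq_sym oner_eq0.
Qed.

(* [S] rotates the pair [v, v'] by a matrix with trace [q - 1] and determinant
   [- q]; the combination free of [w] and its conjugate span both vectors since
   [q ^ 2 != 1]. *)
Lemma rotate_out (S v v' w : 'M[C]_(np r n)) (A A' B : C) :
  Gr S -> A + A' = q - 1 -> A * A' - B ^+ 2 = - q -> B != 0 ->
  S *m v *m S^H = q^*%C *: (A *: v + B *: v') ->
  S *m v' *m S^H = q^*%C *: (B *: v + A' *: v') ->
  L (v + w) -> L (q^*%C *: (A *: v + B *: v') - q *: w) -> L v'.
Proof.
move=> GS e1 e2 B0 Sv Sv' h1 h2.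
set y1 := q^*%C * A + q; set y2 := q^*%C * B.
have hy : L (y1 *: v + y2 *: v').
  have := ctangD Gr_group h2 (ctangZ Gr_group q h1).
  by congr (L _); apply/matrixP => i j; rewrite !mxE /y1 /y2; ring.
pose z1 := q^*%C * (y1 * A + y2 * B); pose z2 := q^*%C * (y1 * B + y2 * A').
have hz : L (z1 *: v + z2 *: v').
  have := ctang_conj Gr_group GS hy.
  rewrite mulmxDr mulmxDl -!scalemxAr -!scalemxAl Sv Sv'.
  by congr (L _); apply/matrixP => i j; rewrite !mxE /z1 /z2; ring.
have det : y1 * z2 - y2 * z1 = q^*%C * B * ((1 + q) * (q - q^*%C)).
  rewrite /z1 /z2 /y1 /y2; have qu := qq_unit R b r.
  set qb := q^*%C in qu *.
  have hA : A' = q - 1 - A by rewrite -e1; ring.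
  have hB : B ^+ 2 = A * (q - 1 - A) + q.
    by rewrite -[X in _ + X]opprK -e2 hA; ring.
  rewrite hA.
  transitivity (qb * B * (((qb * A + q) ^+ 2 + (qb * A + q) * qb * (q - 1 - A) - qb * A * (qb * A + q) - qb ^+ 2 * B ^+ 2))); first ring.
  rewrite hB.
  transitivity (qb * B * (q ^+ 2 + (q * qb) * (q - 1) - (q * qb) * qb)); first ring.
  by transitivity (qb * B * (q ^+ 2 + q - q * qb - qb)); [rewrite qu|]; ring.
suff: L ((y1 * z2 - y2 * z1) *: v').
  by apply: L_scale; rewrite det !mulf_neq0 ?(qq_neqN1 R b r5) ?(qq_neqJ R b r5) ?qqJ_neq0.
have := ctangB Gr_group (ctangZ Gr_group y1 hz) (ctangZ Gr_group z1 hy).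
by congr (L _); apply/matrixP => i j; rewrite !mxE; ring.
Qed.

(** If l > 0, the units w and w' of height l are known and can be subtracted. If l = 0, the
    coefficient of w' vanishes and conjugation only multiplies w by - q, which is the situation of
    [rotate_out]. *)
Lemma bridge_key p l x z : (p.+2 <= n)%N -> (l <= r - 5)%N ->
  node p l.+2 x -> node p l z -> good p.+1 l.+1 -> (0 < l -> good p.+2 l)%N ->
  L (eu [:: false, true & x] [:: true, true & z]).
Proof.
move=> pn lr nx nz gd gl; have [h1 h2] := bridge pn nx nz gd.
have /nodeP[sx ax hx] := nx; have /nodeP[sz az hz] := nz.
have lr3 : (l.+2 <= r - 3)%N by lia.
have [B0 _] := @Bc_neq0 l.+2 x isT lr3 hx.
have q0 := qqJ_neq0.
set v := eu [:: true, false & x] _ in h1 h2; set v' := eu _ _ in h2 *.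
set w := eu [:: false, false & x] _ in h1 h2; set w' := eu _ [:: true, false & z] in h2.
set A := Ac [:: true, false & x] in h2; set B := Bc [:: true, false & x] in B0 h2.
have [l0|l0] := posnP l; last first.
  have g2 := gl l0; have nFF : node p.+2 l [:: false, false & x].
    by apply: node_F; apply: node_F.
  have nFT : node p.+2 l [:: false, true & z].
    by apply: node_F; apply: node_T => //; lia.
  have nTF : node p.+2 l [:: true, false & z].
    rewrite -(prednK l0); apply: node_T; last lia.
    by apply: node_F; rewrite prednK.
  have Lw : L w by apply: g2.
  have Lw' : L w' by apply: g2.
  have Lv : L v by rewrite -(addrK w v); apply: (ctangB Gr_group).
  have h3 : L (q^*%C *: (A *: v + B *: v')).
    rewrite -[X in L X](addrK (q *: ((Ac [:: false, true & z])^*%C *: w +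
          (Bc [:: false, true & z])^*%C *: w'))).
    apply: (ctangB Gr_group) => //; apply: (ctangZ Gr_group).
    by apply: (ctangD Gr_group); apply: (ctangZ Gr_group).
  have {}h3 := L_scale q0 h3; apply: (L_scale B0).
  by rewrite -[X in L X](addKr (A *: v)) addrC; apply: (ctangB Gr_group) => //; apply: (ctangZ Gr_group).
have Aw : (Ac [:: false, true & z])^*%C = - 1.
  have -> : Ac [:: false, true & z] = - 1; last by rewrite rmorphN1.
  by rewrite /Ac /dco hz l0 (ac_0 R r5) rmorph1 mulr1 opprD addrCA subrr addr0.
have Bw : (Bc [:: false, true & z])^*%C = 0.
  have -> : Bc [:: false, true & z] = 0; last by rewrite rmorph0.
  by rewrite /Bc /bco hz l0 (bc_0 R r5) rmorph0 mulr0.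
rewrite Aw Bw scale0r addr0 scaleN1r scalerN in h2.
have [e1 e2] := Ac_pair ax; rewrite -/A -/B in e1 e2.
have GS : Gr (Sk (n - p.+2)) by rewrite -[(n - p.+2)%N]addn0; apply: Gr_Sk; lia.
have pn2 : (p + 2 <= n)%N by rewrite addn2.
have f1 := @Sk_eu0 true false x [:: true, true & z].
have f2 := @Sk_eu0 false true x [:: true, true & z].
have f3 s : size s = p.+2 -> _ := fun h => @eu_SkH0 true true z s (etrans h (congr1 (addn 2) (esym sz))).
rewrite sx in f1 f2; rewrite sz AcTT BcTT rmorph0 in f3.
apply: (@rotate_out (Sk (n - p.+2)) v v' w A (Ac [:: false, true & x]) B) => //.
- by rewrite /v f1 // mulmxDl -!scalemxAl !f3 /= ?sx // !scale0r !addr0 scalerDr !scalerA ![_ * q^*%C]mulrC.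
- by rewrite /v' f2 // mulmxDl -!scalemxAl !f3 /= ?sx // !scale0r !addr0 scalerDr !scalerA ![_ * q^*%C]mulrC addrC.
Qed.

(** Only the path without a step down reaches height p, and parity excludes height p - 1. *)
Lemma node_gap p l s t : node p l s -> node p l t -> s != t -> (l.+2 <= p)%N.
Proof.
move=> hs ht_ st; have [lp op] := node_parity hs.
have l1 : l != p.
  by apply: contra st => /eqP e; move: hs ht_; rewrite e => /node_top -> /node_top ->.
have l2 : l.+1 != p by apply/eqP => e; move: op; rewrite -e /=; case: odd.
lia.
Qed.

Lemma good_succ_ge2 p l : (p.+2 <= n)%N -> (l <= r - 5)%N ->
  (forall k, good p.+1 k) -> (0 < l -> good p.+2 l)%N -> good p.+2 l.+2.
Proof.
move=> pn lr gd gl s t hs ht_ st.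
have lp := node_gap hs ht_ st; have [_ op] := node_parity hs.
have {}op : odd l = odd p by move: op => /=; rewrite !negbK.
have [x nx] : exists x, node p l.+2 x by apply: node_ex => //=; rewrite ?negbK //; lia.
have [z nz] : exists z, node p l z by apply: node_ex => //; lia.
have key := bridge_key pn lr nx nz (gd _) gl.
have lr2 : (l.+2 < r - 2)%N by lia.
have g0 : node p.+1 l.+3 (true :: x) by apply: node_T.
have k0 : node p.+1 l.+1 (true :: z) by apply: node_T => //; lia.
have lr1 : (l.+1 < r - 2)%N by lia.
exact: (spread1 pn lr1 (gd _) (gd _) g0 k0 key).
Qed.

Lemma bracket_last N (v v' w w' h : 'M[C]_N) (c A B c' A' B' : C) :
  v *m h = 0 -> v' *m h = 0 -> w *m h = 0 ->
  h *m v = 0 -> h *m v' = 0 -> h *m w = 0 -> h *m w' = 0 ->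
  (c *: (A *: v + B *: v') + c' *: (A' *: w + B' *: w')) *m h
    - h *m (c *: (A *: v + B *: v') + c' *: (A' *: w + B' *: w'))
  = (c' * B') *: (w' *m h).
Proof.
move=> h1 h2 h3 h4 h5 h6 h7.
rewrite !(mulmxDl, mulmxDr) -!scalemxAl -!scalemxAr !(mulmxDl, mulmxDr).
rewrite -!scalemxAl -!scalemxAr h1 h2 h3 h4 h5 h6 h7.
by rewrite !(scaler0, addr0, add0r, subr0) scalerA.
Qed.

(** No lower height is available here, so w' is isolated by a bracket. A unit between two paths that
    end at height 0 lifts to a single unit, because a further step down is not admissible;
    bracketing with it kills v, v' and w. Two distinct such paths exist as p + 1 is even and at
    least 4. *)
Lemma good_succ_1 p : (p.+2 <= n)%N -> (2 <= p)%N ->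
  (forall k, good p.+1 k) -> good p.+2 1.
Proof.
move=> pn p2 gd s t hs ht_ st.
have [_ op] := node_parity hs; have {}op : odd p by move: op => /=; rewrite negbK.
have p3 : (3 <= p)%N by case: (p) p2 op => [|[|[|[]]]].
have [x nx] : exists x, node p 3 x by apply: node_ex => //; lia.
have [z nz] : exists z, node p 1 z by apply: node_ex => //; lia.
have r31 : (1 <= r - 3)%N by lia.
have lr1 : (0 < r - 2)%N by lia.
have op1 : ~~ odd p.+1 by rewrite /= negbK.
have ng : node p.+1 0 (false :: z) by exact: node_F.
have nW' : node p.+2 1 [:: true, false & z] by apply: node_T.
have nFF : node p.+2 1 [:: false, false & x] by apply: node_F; apply: node_F.
have [h1 h2] := bridge pn nx nz (gd _).
have /nodeP[sx ax hx] := nx; have /nodeP[sz az hz] := nz.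
have [_ B0] := @Bc_neq0 1 z isT r31 hz.
have [k nk kg] := @node0_other p.+1 (false :: z) p3 op1.
rewrite eq_sym in kg; have sk := node_size nk; have ak : adm r k by case/nodeP: nk.
have h := L_lift (node_size ng) sk pn (gd _ _ _ ng nk kg).
rewrite [eu [:: false, false & z] _]eu_nadm ?addr0 /= in h; first last.
- by rewrite hz andbF.
- by rewrite sz.
have := ctang_bracket Gr_group h2 h.
have kT : true :: k != [:: true, false & x].
  by apply/eqP => -[e]; move: nk; rewrite e => /nodeP[_ _ /=]; rewrite hx.
have kF : true :: k != [:: false, true & x] by [].
have kFF : true :: k != [:: false, false & x] by [].
rewrite bracket_last; try by rewrite eu_mul0 //= ?sk ?sx ?sz.
rewrite (eu_mulN pn nFF nW'); last by rewrite /= sk.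
move=> /L_scale key.
have g0 : node p.+1 2 (false :: x) by exact: node_F.
apply: (spread1 pn lr1 (gd _) (gd _) g0 nk) => //.
apply: key; apply: mulf_neq0; last by rewrite conjc_eq0.
by apply/eqP => h0; have := qq_unit R b r; rewrite h0 mul0r => /eqP; rewrite eq_sym oner_eq0.
Qed.

(** Heights 1 to r - 3 are reached by an induction on l with step 2. At the extreme heights 0 and r
    - 2 the last step is forced, so their units are lifts minus the part at height 2 or r - 4. *)
Lemma step m : (3 <= m)%N -> (m < n)%N -> (forall l, good m l) -> forall l, good m.+1 l.
Proof.
case: m => [//|p] p3 pn gd.
have gi l : (0 < l)%N -> (l <= r - 3)%N -> good p.+2 l.
  elim/ltn_ind: l => -[//|[|l]] IH _ lr; first exact: good_succ_1.
  by apply: good_succ_ge2 => //; [lia | move=> l0; apply: IH => //; lia].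
have sub s t : good p.+1 (ht s) -> node p.+1 (ht s) s -> node p.+1 (ht s) t -> s != t ->
    L (eu (true :: s) (true :: t) + eu (false :: s) (false :: t)).
  move=> g hs ht_ st; apply: (L_lift (node_size hs) (node_size ht_) pn).
  exact: g.
move=> l s t hs ht_ st; have lr := node_le hs.
have [l0|l0] := posnP l.
  rewrite l0 in hs ht_.
  case: s hs st => [|[] s] hs st; first by case/nodeP: hs.
    by have [? []] := node_Tinv hs.
  case: t ht_ st => [|[] t] ht_ st; first by case/nodeP: ht_.
    by have [? []] := node_Tinv ht_.
  have ns := node_Finv hs; have nt := node_Finv ht_.
  have hs1 : ht s = 1%N by case/nodeP: ns.
  have h : L (eu (true :: s) (true :: t) + eu (false :: s) (false :: t)).
    by apply: sub; rewrite ?hs1.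
  rewrite -(addKr (eu (true :: s) (true :: t)) (eu _ _)) addrC.
  apply: (ctangB Gr_group) => //.
  by apply: (gi 2) => //; [lia|apply: node_T => //; lia..].
have [l3|l3] := leqP l (r - 3); first exact: (gi l).
have el : l = (r - 2)%N by lia.
have hF u : node p.+2 l u -> exists2 u', u = true :: u' & node p.+1 (r - 3)%N u'.
  case: u => [|[] u] hu; first by case/nodeP: hu.
    exists u => //; have [l' e nu] := node_Tinv hu.
    by rewrite (_ : (r - 3)%N = l') //; lia.
  by have := node_le (node_Finv hu); lia.
have [s' es ns] := hF _ hs; have [t' et nt] := hF _ ht_; subst s t.
have hs1 : ht s' = (r - 3)%N by case/nodeP: ns.
have h : L (eu (true :: s') (true :: t') + eu (false :: s') (false :: t')).
  by apply: sub; rewrite ?hs1.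
rewrite -(addrK (eu (false :: s') (false :: t')) (eu _ _)).
apply: (ctangB Gr_group) => //.
have er : (r - 3 = (r - 4).+1)%N by lia.
rewrite er in ns nt.
by apply: (gi (r - 4)%N); [lia|lia|exact: node_F|exact: node_F|].
Qed.

End Braids.

(** * Sectors inside the path representation *)

Section Embedding.
Variables (R : realType) (b : bool) (r n : nat).
Local Notation C := R[i].
Hypothesis r5 : (5 <= r)%N.

Section Sector.
Variable lam : seq nat.
Local Notation d := (dimV 2 r n lam).
Local Notation tb := (tabl 2 n).

Definition vpath (x : 'I_d) : seq bool := tpath (enum_val x : tb).

Lemma vpath_std (x : 'I_d) : standard 2 n lam (enum_val x).
Proof. by have := enum_valP x; rewrite inE => /andP[]. Qed.

Lemma vpath_adm x : adm r (vpath x).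
Proof. by have := enum_valP x; rewrite inE adm_tablE => /andP[]. Qed.

Lemma vpath_size x : size (vpath x) = n. Proof. exact: size_tpath. Qed.

Lemma vpath_inj : injective vpath.
Proof. by move=> x y /(tpath_inj (vpath_std x) (vpath_std y))/enum_val_inj. Qed.

(** The isometry that identifies a sector with the span of its paths. *)
Definition Jm : 'M[C]_(np r n, d) := \matrix_(i, x) (pth i == vpath x)%:R.

Lemma mxf_Jm (H : seq bool -> seq bool -> C) : @mxf R r n H *m Jm = \matrix_(i, x) (H (pth i) (vpath x) : C).
Proof.
apply/matrixP => i x; rewrite !mxE; under eq_bigr do rewrite !mxE mulrC.
exact: (sum_pth (fun p => H (pth i) p) (vpath_adm x) (vpath_size x)).
Qed.

Lemma Jm_orthonormal : Jm^T *m Jm = 1%:M.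
Proof.
apply/matrixP => x y; rewrite !mxE; under eq_bigr do rewrite !mxE mulrC.
rewrite (sum_pth (fun p => (p == vpath x)%:R : C) (vpath_adm y) (vpath_size y)).
by rewrite eq_sym (inj_eq vpath_inj).
Qed.

Lemma Ek_Jm i : (0 < i < n)%N -> Ek R r n (n - i - 1) *m Jm = Jm *m Emx R b 2 r n lam i.
Proof.
move=> i_n; rewrite mxf_Jm; apply/matrixP => j y; rewrite !mxE genE_sym.
have sty := vpath_std y; have ady := vpath_adm y.
under [RHS]eq_bigr do rewrite !mxE mulrDr.
rewrite big_split /= /genE; congr (_ + _).
  rewrite (bigD1 y) //= eqxx big1 ?addr0 => [|x xy]; last first.
    by rewrite (inj_eq enum_val_inj) (negPf xy) mulr0.
  by rewrite (alpha_dco R b r5 i_n sty ady).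
rewrite (beta_bco R b r5 i_n sty ady) -/(vpath y).
have [->|h] := eqVneq (bco R r (drop (n - i - 1) (vpath y))) 0.
  by rewrite rmorph0 mulr0 big1 // => x _; case: ifP; rewrite mulr0.
have [st' ad'] := swap_basis r5 i_n sty ady h.
have hb : swap_tabl 2 n (enum_val y) i \in Defs.basis 2 r n lam by rewrite inE st' adm_tablE ad'.
rewrite (bigD1 (enum_rank_in hb (swap_tabl 2 n (enum_val y) i))) //= enum_rankK_in // eqxx.
rewrite /vpath enum_rankK_in // tpath_swap // big1 ?addr0 // => x xy.
have [e|_] := enum_val x =P swap_tabl 2 n (enum_val y) i; last by rewrite mulr0.
by case/eqP: xy; apply: enum_val_inj; rewrite enum_rankK_in.
Qed.

Local Notation s := (rho_gen R b 2 r n lam).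

Lemma Sk_Jm i : (0 < i < n)%N -> Sk R b r n (n - i - 1) *m Jm = Jm *m s i.
Proof.
by move=> i_n; rewrite mulmxBl mulmxBr -!scalemxAl -!scalemxAr mul1mx mulmx1 Ek_Jm.
Qed.

Lemma Jm_adj (A : 'M[C]_d) : (Jm *m A *m Jm^T)^H = Jm *m A^H *m Jm^T.
Proof.
have Jr : map_mx (@conjc R) Jm = Jm by apply/matrixP => i x; rewrite !mxE rmorph_nat.
by rewrite /adjmx !map_mxM /= -map_trmx Jr !trmx_mul trmxK mulmxA.
Qed.

Lemma Jm_inj k (A B : 'M[C]_(d, k)) : Jm *m A = Jm *m B -> A = B.
Proof.
by move=> h; rewrite -[A]mul1mx -[B]mul1mx -Jm_orthonormal -!mulmxA h.
Qed.

Lemma SkH_Jm i : (0 < i < n)%N -> (Sk R b r n (n - i - 1))^H *m Jm = Jm *m invmx (s i).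
Proof.
(* The candidate for the inverse is what S^H induces on the sector; composing with the isometry
   transfers S^H S = 1 to it. *)
move=> i_n; pose t := (qq R b r)^*%C *: 1%:M - (1 + qq R b r)^*%C *: Emx R b 2 r n lam i.
have h : (Sk R b r n (n - i - 1))^H *m Jm = Jm *m t.
  rewrite adjB !adjZ adj1 Ek_adj mulmxBl mulmxBr -!scalemxAl -!scalemxAr mul1mx mulmx1.
  by rewrite Ek_Jm.
have ts : t *m s i = 1%:M.
  apply: Jm_inj; rewrite mulmxA -h -mulmxA -Sk_Jm // mulmxA mulmx1.
  by rewrite (mulmx1C (Sk_unitary R b n r5 (n - i - 1))) mul1mx.
have us : s i \in unitmx by case/mulmx1_unit: ts.
by rewrite h; congr (_ *m _); rewrite -[t]mulmx1 -(mulmxV us) mulmxA ts mul1mx.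
Qed.

Lemma repw_Jm w : braid_word n w -> repw R b r n w *m Jm = Jm *m rho_word R b 2 r n lam w.
Proof.
elim: w => [|[i e] w IH] /=; first by rewrite /rho_word big_nil mul1mx mulmx1.
move=> /andP[i_n hw]; rewrite /rho_word big_cons /= -mulmxA IH // mulmxA.
rewrite -[_ * \prod_(_ <- _) _]/(_ *m rho_word R b 2 r n lam w) mulmxA; congr (_ *m _).
by case: e; [apply: Sk_Jm | apply: SkH_Jm].
Qed.

Lemma Jm_delta x y : Jm *m delta_mx x y *m Jm^T = eu R r n (vpath x) (vpath y).
Proof.
apply/matrixP => i j; rewrite !mxE vpath_size subnn !drop0 !take0 eqxx andbT.
rewrite (bigD1 y) //= big1 ?addr0 => [|k ky]; last first.
  by rewrite !mxE big1 ?mul0r // => l _; rewrite !mxE (negPf ky) andbF mulr0.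
rewrite !mxE (bigD1 x) //= big1 ?addr0 => [|l lx]; last first.
  by rewrite !mxE (negPf lx) mulr0.
by rewrite !mxE !eqxx mulr1 -natrM mulnb.
Qed.

Hypothesis hl : in_Lambda 2 r n lam.

Lemma vpath_node x : node r n (nth 0%N lam 0 - nth 0%N lam 1)%N (vpath x).
Proof.
by apply/nodeP; split; [exact: vpath_size|exact: vpath_adm|exact: ht_tpath (enum_valP x)].
Qed.

End Sector.

Lemma Jm_orthogonal lam mu : in_Lambda 2 r n lam -> in_Lambda 2 r n mu -> lam != mu ->
  (Jm lam)^T *m Jm mu = 0.
Proof.
move=> hl hm lm; apply/matrixP => x y; rewrite !mxE big1 // => i _; rewrite !mxE.
case: eqP => [e|_]; last by rewrite mul0r.
case: eqP => [e'|_]; last by rewrite mulr0.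
have /nodeP[_ _ hx] := vpath_node hl x; have /nodeP[_ _ hy] := vpath_node hm y.
have [l0 [l1 [el l10 ln lr]]] := in_LambdaE hl; have [m0 [m1 [em m10 mn mr]]] := in_LambdaE hm.
move: hx; rewrite -e e' hy el em /= => h; case/eqP: lm; rewrite el em; congr [:: _; _]; lia.
Qed.

End Embedding.

(** * Three strands *)

Section Analysis.
Variable R : realType.
Local Notation C := R[i].
Local Open Scope classical_set_scope.

Lemma cabs_Re_Im (z : C) : cabs z <= `|complex.Re z| + `|complex.Im z|.
Proof.
rewrite {1}[z]complexE; apply: (le_trans (cabsD _ _)).
rewrite cabsM !cabsR; suff -> : cabs 'i%C = 1 :> R by rewrite mul1r.
by rewrite /cabs normc_def /= expr0n expr1n add0r sqrtr1.
Qed.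

Lemma Re_cabs (z : C) : `|complex.Re z| <= cabs z.
Proof. by rewrite -lecR cabsE normc_ge_Re. Qed.

Lemma Im_cabs (z : C) : `|complex.Im z| <= cabs z.
Proof.
rewrite /cabs normc_def /= -sqrtr_sqr ler_wsqrtr // lerDr sqr_ge0 //.
Qed.

(** Bolzano-Weierstrass in the plane, phrased without subsequences. *)
Lemma bounded_cluster (z : nat -> C) (B : R) : (forall j, cabs (z j) <= B) ->
  exists w : C, forall (eps : R) (M : nat), 0 < eps ->
    exists2 j, (M <= j)%N & cabs (z j - w) < eps.
Proof.
move=> zB; pose u j : R * R := (complex.Re (z j), complex.Im (z j)).
have cK : compact (`[- B, B]%classic `*` `[- B, B]%classic : set (R * R)%type).
  by apply: compact_setX; apply: segment_compact.
have FK : (u @ \oo) (`[- B, B]%classic `*` `[- B, B]%classic).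
  exists 0%N => // j _; rewrite /= !in_itv /= -!ler_norml.
  by rewrite (le_trans (Re_cabs _)) ?(le_trans (Im_cabs _)).
have [[x y] [_ cl]] := cK _ _ FK.
exists (Complex x y) => eps M e0.
have e20 : 0 < eps / 2 by rewrite divr_gt0.
have hA : (u @ \oo) [set p | exists2 j, (M <= j)%N & p = u j].
  by exists M => // j /= Mj; exists j.
have hB : nbhs (x, y) (ball (x, y) (eps / 2)) by apply: nbhsx_ballx.
have [p [[j Mj ->] /= [h1 h2]]] := cl _ _ hA hB.
exists j => //; apply: (le_lt_trans (cabs_Re_Im _)).
have -> : complex.Re (z j - Complex x y) = complex.Re (z j) - x by case: (z j).
have -> : complex.Im (z j - Complex x y) = complex.Im (z j) - y by case: (z j).
move: h1 h2; rewrite /ball /= /ball_ /= ![`|_ - complex.Re _|]distrC ![`|_ - complex.Im _|]distrC => h1 h2.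
by rewrite [eps]splitr ltrD.
Qed.

Lemma sin_le_id (x : R) : 0 <= x -> `|sin x| <= x.
Proof.
move=> x0; have [c _] := @MVT_segment R sin cos 0 x x0 (fun y _ => is_derive_sin y)
  (continuous_subspaceT (@continuous_sin R)).
rewrite sin0 !subr0 => ->; rewrite normrM (ger0_norm x0) ler_piMl //.
by rewrite ler_norml cos_geN1 cos_le1.
Qed.

Lemma cos_bound (x : R) : 0 <= x -> `|cos x - 1| <= x ^+ 2.
Proof.
move=> x0; have [c] := @MVT_segment R cos (fun y => - sin y) 0 x x0
  (fun y _ => is_derive_cos y) (continuous_subspaceT (@continuous_cos R)).
rewrite in_itv /= => /andP[c0 cx]; rewrite cos0 subr0 => ->.
rewrite normrM normrN (ger0_norm x0) expr2 ler_wpM2r //.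
exact: le_trans (sin_le_id c0) cx.
Qed.

Lemma sin_bound (x : R) : 0 <= x -> `|sin x - x| <= x ^+ 2 * x.
Proof.
move=> x0; have [c] := @MVT_segment R sin cos 0 x x0 (fun y _ => is_derive_sin y)
  (continuous_subspaceT (@continuous_sin R)).
rewrite in_itv /= => /andP[c0 cx]; rewrite sin0 !subr0 => ->.
rewrite -[X in _ - X]mul1r -mulrBl normrM (ger0_norm x0) ler_wpM2r //.
by apply: (le_trans (cos_bound c0)); rewrite ler_sqr.
Qed.

(** For c = cos (pi / 3) the triple angle formula gives 4 c^3 - 3 c + 1 = (c + 1) (2 c - 1)^2 = 0,
    and c > 0. *)
Lemma cos_pi3 : cos (pi / 3%:R) = 2^-1 :> R.
Proof.
set x : R := pi / 3%:R; set c := cos x.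
have c0 : 0 < c.
  apply: cos_gt0_pihalf; have := pi_gt0 R; rewrite /x => h.
  by apply/andP; split; lra.
have e : cos (x + x + x) = -1.
  by rewrite -cospi; congr cos; rewrite /x; field.
rewrite cosD cosD sinD -/c in e.
have h := cos2Dsin2 x; rewrite -/c in h.
have {}e : (c + 1) * (2 * c - 1) ^+ 2 = 0.
  have hs : sin x ^+ 2 = 1 - c ^+ 2 by rewrite -h; ring.
  transitivity ((c * c - sin x * sin x) * c - (sin x * c + c * sin x) * sin x + 1
      - 3 * c * (1 - c ^+ 2 - sin x ^+ 2)); first ring.
  by rewrite e hs; ring.
move/eqP: e; rewrite mulf_eq0 expf_eq0 /= => /orP[|] /eqP; lra.
Qed.

End Analysis.

(** An odd k as close to r / 2 as possible without being equal to it. The middle third is where |2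
    cos (k pi / r)| < 1, and 2 k = r would make it 0. For r = 6 and r = 10 the only odd number in
    the open middle third is r / 2. *)
Lemma middle_third_odd (r : nat) : (5 <= r)%N -> r <> 6%N -> r <> 10%N ->
  exists k, [/\ odd k, (r < 3 * k)%N, (3 * k < 2 * r)%N & (2 * k != r)%N].
Proof.
move=> r5 r6 r10.
have e := divn_eq r 4; have h := ltn_mod r 4; set a := (r %/ 4)%N in e; set c := (r %% 4)%N in e h.
have [|[|[]]] : c = 0 \/ c = 1 \/ c = 2 \/ c = 3 by move: h; clear; lia.
- move=> c0; exists (2 * a - 1)%N; split; try lia.
- move=> c0; exists (2 * a + 1)%N; split; try lia.
- move=> c0; exists (2 * a - 1)%N; split; try lia.
- move=> c0; exists (2 * a + 1)%N; split; try lia.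
Qed.

(** * The modulus of 1 + q^k *)

Section Base3.
Variables (R : realType) (b : bool) (r n : nat).
Local Notation C := R[i].
Local Notation q := (qq R b r).
Hypothesis r5 : (5 <= r)%N.
Local Notation th := (pi / r%:R : R).

Lemma qX_normD1 k : (1 + q ^+ k) * (1 + q ^+ k)^*%C = ((2 * cos (k%:R * th)) ^+ 2)%:C%C.
Proof.
rewrite qqE cisX; set x := k%:R * _.
rewrite rmorphD rmorph1.
transitivity (1 + cis b x * (cis b x)^*%C + (cis b x + (cis b x)^*%C)); first ring.
rewrite cis_unit cisJD -[1 + 1]/(2%:R) -(rmorph_nat (real_complex R) 2) -rmorphD /=.
congr (_%:C%C); have -> : x = k%:R * th + k%:R * th by rewrite /x; ring.
by rewrite cosD; have := cos2Dsin2 (k%:R * th); lra.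
Qed.

Lemma qX_norm_lt1 k : (r < 3 * k)%N -> (3 * k < 2 * r)%N -> (2 * k != r)%N ->
  0 < (2 * cos (k%:R * th)) ^+ 2 < 1.
Proof.
move=> h1 h2 h3; set x := k%:R * th; have p0 := pi_gt0 R.
have r0 : 0 < r%:R :> R by rewrite ltr0n; lia.
have x1 : pi / 3%:R < x.
  rewrite /x mulrCA ltr_pM2l // ltr_pdivlMr // mulrC ltr_pdivrMr // mulrC -natrM ltr_nat //.
have x2 : x < 2 * (pi / 3%:R).
  have -> : 2 * (pi / 3%:R) = pi * (2 / 3%:R) :> R by field.
  rewrite /x mulrCA ltr_pM2l // ltr_pdivrMr // mulrAC ltr_pdivlMr // mulrC -!natrM ltr_nat //.
have c1 : cos x < 2^-1.
  by rewrite -cos_pi3 ltr_cos // in_itv /=; apply/andP; split; lra.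
have c2 : - 2^-1 < cos x.
  have -> : - 2^-1 = cos (pi - pi / 3%:R) :> R by rewrite addrC cosDpi cosN cos_pi3.
  by rewrite ltr_cos ?in_itv /=; first lra; apply/andP; split; lra.
have c3 : cos x != 0.
  apply/eqP => e; have /cos_inj : cos x = cos (pi / 2) by rewrite e cos_pihalf.
  rewrite !in_itv /= => h; have {h} : x = pi / 2 by apply: h; apply/andP; split; lra.
  rewrite /x mulrCA => /(mulfI (lt0r_neq0 p0)) => h.
  have {}h : (k%:R * 2%:R : R) = r%:R.
    apply: (mulIf (x := r%:R^-1)); first by rewrite invr_eq0 gt_eqF.
    by rewrite divff ?gt_eqF // mulrAC h mulVf // pnatr_eq0.
  by move: h3; rewrite mulnC -(eqr_nat R) natrM h eqxx.
have c4 : 0 < cos x ^+ 2 by rewrite exprn_even_gt0.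
apply/andP; split; nra.
Qed.

End Base3.

(** * Two by two blocks *)

Section MatrixUnits.
Variables (R : realType) (N : nat) (e11 e12 e21 e22 : 'M[R[i]]_N).
Local Notation C := R[i].

Definition mk2 (a c d f : C) : 'M[C]_N := a *: e11 + c *: e12 + d *: e21 + f *: e22.

Definition matrix_units : Prop :=
  [/\ [/\ e11 *m e11 = e11, e11 *m e12 = e12, e11 *m e21 = 0 & e11 *m e22 = 0],
      [/\ e12 *m e11 = 0, e12 *m e12 = 0, e12 *m e21 = e11 & e12 *m e22 = e12],
      [/\ e21 *m e11 = e21, e21 *m e12 = e22, e21 *m e21 = 0 & e21 *m e22 = 0] &
      [/\ e22 *m e11 = 0, e22 *m e12 = 0, e22 *m e21 = e21 & e22 *m e22 = e22]].

Lemma mk2M a c d f a' c' d' f' : matrix_units ->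
  mk2 a c d f *m mk2 a' c' d' f' =
  mk2 (a * a' + c * d') (a * c' + c * f') (d * a' + f * d') (d * c' + f * f').
Proof.
case=> -[h1 h2 h3 h4] [k1 k2 k3 k4] [l1 l2 l3 l4] [m1 m2 m3 m4].
rewrite /mk2 !mulmxDl !mulmxDr -!scalemxAl -!scalemxAr h1 h2 h3 h4 k1 k2 k3 k4.
rewrite l1 l2 l3 l4 m1 m2 m3 m4 !scaler0 !addr0 !add0r !scalerA !scalerDl.
by rewrite -!addrA; apply/matrixP => i j; rewrite !mxE; ring.
Qed.

Lemma mk2D a c d f a' c' d' f' :
  mk2 a c d f + mk2 a' c' d' f' = mk2 (a + a') (c + c') (d + d') (f + f').
Proof. by apply/matrixP => i j; rewrite !mxE; ring. Qed.

Lemma mk2Z z a c d f : z *: mk2 a c d f = mk2 (z * a) (z * c) (z * d) (z * f).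
Proof. by apply/matrixP => i j; rewrite !mxE; ring. Qed.

Lemma mk2H a c d f : e11^H = e11 -> e12^H = e21 -> e21^H = e12 -> e22^H = e22 ->
  (mk2 a c d f)^H = mk2 a^*%C d^*%C c^*%C f^*%C.
Proof.
move=> h1 h2 h3 h4; rewrite /mk2 !adjD !adjZ h1 h2 h3 h4.
by congr (_ + _); rewrite addrAC.
Qed.

Lemma nm_mk2 a c d f : nm (mk2 a c d f) <=
  (cabs a + cabs c + cabs d + cabs f) * (nm e11 + nm e12 + nm e21 + nm e22).
Proof.
have h (x y : R) : 0 <= x -> 0 <= y -> 0 <= x * y by exact: mulr_ge0.
apply: (@le_trans _ _ (cabs a * nm e11 + cabs c * nm e12 + cabs d * nm e21 + cabs f * nm e22)).
  rewrite /mk2; do 3?[apply: (le_trans (nmD _ _)); apply: lerD]; rewrite nmZ //.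
move: (cabs_ge0 a) (cabs_ge0 c) (cabs_ge0 d) (cabs_ge0 f).
move: (nm_ge0 e11) (nm_ge0 e12) (nm_ge0 e21) (nm_ge0 e22).
move: (nm e11) (nm e12) (nm e21) (nm e22) (cabs a) (cabs c) (cabs d) (cabs f).
move=> x y z t u v w s x0 y0 z0 t0 u0 v0 w0 s0; rewrite !mulrDr !mulrDl -subr_ge0.
set lhs := (X in 0 <= X).
have -> : lhs = u * y + u * z + u * t + v * x + v * z + v * t + w * x + w * y + w * t
   + s * x + s * y + s * z by rewrite /lhs; ring.
by rewrite !addr_ge0 // mulr_ge0.
Qed.

End MatrixUnits.

Local Open Scope classical_set_scope.

(** * A complex reflection and nearly commuting conjugates *)

Section ReflectionPair.
Variables (R : realType) (N : nat) (G : 'M[R[i]]_N -> Prop).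
Local Notation C := R[i].
Hypothesis GG : unitary_group G.
Variables (e11 e12 e21 e22 : 'M[C]_N).
Hypothesis MU : matrix_units e11 e12 e21 e22.
Hypotheses (h11 : e11^H = e11) (h12 : e12^H = e21) (h21 : e21^H = e12) (h22 : e22^H = e22).
Local Notation mk := (mk2 e11 e12 e21 e22).
Local Notation P := e11.

Let mkM a c d f a' c' d' f' : mk a c d f *m mk a' c' d' f' =
  mk (a * a' + c * d') (a * c' + c * f') (d * a' + f * d') (d * c' + f * f').
Proof. exact: mk2M. Qed.

Let mkH a c d f : (mk a c d f)^H = mk a^*%C d^*%C c^*%C f^*%C.
Proof. exact: mk2H. Qed.

Let PP : P *m P = P.
Proof. by case: MU => -[]. Qed.

Let PH : P^H = P. Proof. exact: h11. Qed.

Let PE : P = mk 1 0 0 0.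
Proof. by rewrite /mk2 !scale0r scale1r !addr0. Qed.

Let mk_eq a c d f a' c' d' f' : a = a' -> c = c' -> d = d' -> f = f' ->
  mk a c d f = mk a' c' d' f'.
Proof. by move=> -> -> -> ->. Qed.

Let PZ z : z *: P = mk z 0 0 0.
Proof. by rewrite /mk2 !scale0r !addr0. Qed.

Let PM a c d f : P *m mk a c d f = mk a c 0 0.
Proof. by rewrite [X in X *m _]PE mkM; apply: mk_eq; ring. Qed.

Let MP a c d f : mk a c d f *m P = mk a 0 d 0.
Proof. by rewrite [X in _ *m X]PE mkM; apply: mk_eq; ring. Qed.

Variables (rho kap : C) (mu : R) (Rk : 'M[C]_N).
Hypothesis GRk : G Rk.
Hypothesis RkE : Rk = rho *: 1%:M + kap *: P.
Hypothesis rho1 : rho * rho^*%C = 1.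
Hypothesis kapmu : kap * kap^*%C = mu%:C%C.
Hypothesis rhokap : rho * kap^*%C + rho^*%C * kap = - mu%:C%C.
Hypothesis mu01 : 0 < mu < 1.

(* [Y] maps [e_1] to [al e_1 + be e_2], and [x = |be| ^ 2]. *)
Record refl_state (x : R) (al be : C) (Y : 'M[C]_N) : Prop := ReflState {
  rs_G : G Y;
  rs_E : Y *m P = mk al 0 be 0;
  rs_al : al * al^*%C = (1 - x)%:C%C;
  rs_be : be * be^*%C = x%:C%C;
  rs_x : 0 < x < 1 }.

Lemma refl_conj x al be Y : refl_state x al be Y ->
  Y *m P *m Y^H = mk (1 - x)%:C%C (al * be^*%C) (be * al^*%C) x%:C%C.
Proof.
case=> GY EY hal hbe _.
have -> : Y *m P *m Y^H = (Y *m P) *m (Y *m P)^H.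
  rewrite adjM PH mulmxA -[Y *m P *m P]mulmxA PP.
  by [].
by rewrite EY mkH mkM -hal -hbe rmorph0; apply: mk_eq; ring.
Qed.

(** The new element Y Rk Y^H = rho + kap Y P Y^H has off-diagonal entry kap be al^* in its first
    column. Its squared modulus mu (1 - x) x is below mu x and never 0. *)
Lemma refl_next x al be Y : refl_state x al be Y ->
  exists al' be' Y', refl_state (mu * (1 - x) * x) al' be' Y'.
Proof.
move=> st; have cj := refl_conj st; case: st => GY EY hal hbe /andP[x0 x1].
have /andP[m0 m1] := mu01.
exists (rho + kap * (1 - x)%:C%C), (kap * (be * al^*%C)), (Y *m Rk *m Y^H).
split.
- by do 2?apply: (ugM GG) => //; apply: (ugV GG).
- have -> : Y *m Rk *m Y^H = rho *: 1%:M + kap *: (Y *m P *m Y^H).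
    rewrite RkE mulmxDr mulmxDl -[Y *m (rho *: _)]scalemxAr -[Y *m (kap *: _)]scalemxAr.
    by rewrite -!scalemxAl mulmx1 (ugU GG GY).
  rewrite cj mulmxDl -scalemxAl mul1mx -scalemxAl MP PZ mk2Z mk2D.
  by apply: mk_eq; ring.
- have yJ : ((1 - x)%:C^*)%C = (1 - x)%:C%C by rewrite conjc_real.
  have [y ey] : exists y : C, y = (1 - x)%:C%C by exists ((1 - x)%:C%C).
  rewrite -ey in yJ *.
  rewrite rmorphD rmorphM /= yJ.
  transitivity (rho * rho^*%C + (rho * kap^*%C + rho^*%C * kap) * y
     + kap * kap^*%C * y ^+ 2); first ring.
  rewrite ey rho1 rhokap kapmu -rmorphXn -rmorphN -!rmorphM -(rmorph1 (real_complex R)) -!rmorphD /=.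
  by congr (_%:C%C); ring.
- rewrite !rmorphM /= conjcK.
  transitivity (kap * kap^*%C * (al * al^*%C) * (be * be^*%C)); first ring.
  by rewrite kapmu hal hbe -!rmorphM.
- have h1 : 0 < 1 - x by lra.
  rewrite !mulr_gt0 //=.
  have : mu * (1 - x) < 1 by nra.
  have : 0 < mu * (1 - x) by rewrite mulr_gt0.
  nra.
Qed.

Hypothesis init : exists x al be Y, refl_state x al be Y.

Lemma refl_iter j : exists x al be Y, refl_state x al be Y /\ x <= mu ^+ j.
Proof.
elim: j => [|j [x [al [be [Y [st hx]]]]]].
  have [x [al [be [Y st]]]] := init; exists x, al, be, Y; split => //.
  by case: st => _ _ _ _ /andP[_ /ltW]; rewrite expr0.
have [al' [be' [Y' st']]] := refl_next st.
exists (mu * (1 - x) * x), al', be', Y'; split => //.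
have /andP[x0 x1] := rs_x st; have /andP[m0 m1] := mu01.
rewrite exprS -mulrA ler_wpM2l ?(ltW m0) //; apply: le_trans hx.
by rewrite ler_piMl ?(ltW x0) //; lra.
Qed.

Lemma refl_small : forall j : nat, exists p : (R * C * C) * 'M[C]_N,
  refl_state p.1.1.1 p.1.1.2 p.1.2 p.2 /\ p.1.1.1 <= mu ^+ j.
Proof. by move=> j; have [x [al [be [Y h]]]] := refl_iter j; exists ((x, al, be), Y). Qed.

(** The projections Y P Y^H tend to P, with a difference of order s = sqrt x. So the commutators of
    Rk and Y tend to 1 at the same rate, and rescaling by 1 / s leaves an off-diagonal limit. *)
Lemma tang_offdiag : exists2 w : C, w != 0 &
  tang G (mk 0 (- (kap * rho^*%C * w^*%C)) (rho * kap^*%C * w) 0).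
Proof.
have [f hf] := choice refl_small.
pose x j := (f j).1.1.1; pose al j := (f j).1.1.2; pose be j := (f j).1.2; pose Y j := (f j).2.
have st j : refl_state (x j) (al j) (be j) (Y j) by case: (hf j).
have xj j : x j <= mu ^+ j by case: (hf j).
have x01 j : 0 < x j < 1 := rs_x (st j).
pose s j := Num.sqrt (x j).
have s0 j : 0 < s j by rewrite sqrtr_gt0; case/andP: (x01 j).
have s2 j : s j ^+ 2 = x j by rewrite sqr_sqrtr // ltW //; case/andP: (x01 j).
(* The rescaled off-diagonal entry of Y P Y^H. Its squared modulus is 1 - x, so every cluster point
   is nonzero. *)
pose z j : C := (s j)^-1%:C%C * (be j * (al j)^*%C).
have z2 j : cabs (z j) ^+ 2 = 1 - x j.
  apply: complexI; rewrite cabs_sqr /z.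
  have [y ey] : exists y : C, y = (s j)^-1%:C%C by exists ((s j)^-1%:C%C).
  have yJ : y^*%C = y by rewrite ey conjc_real.
  rewrite -ey !rmorphM /= yJ conjcK.
  transitivity (y ^+ 2 * (al j * (al j)^*%C) * (be j * (be j)^*%C)); first ring.
  rewrite ey (rs_al (st j)) (rs_be (st j)) -s2 -rmorphXn -!rmorphM /=; congr (_%:C%C).
  by field; rewrite gt_eqF.
have z1 j : cabs (z j) <= 1.
  by rewrite -(@expr_le1 _ 2) ?cabs_ge0 // z2; have := x01 j; lra.
have [w hw] := bounded_cluster z1.
have /andP[m0 m1] := mu01.
have mu_small e : 0 < e -> exists M, forall j, (M <= j)%N -> x j < e.
  move=> e0; have /cvgrPdist_lt/(_ e e0)[M _ hM] : (fun j => mu ^+ j) @ \oo --> (0 : R).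
    by apply: cvg_expr; rewrite ger0_norm // ltW.
  exists M => j Mj; have := hM j Mj; rewrite /= sub0r normrN ger0_norm ?exprn_ge0 ?ltW //.
  exact: le_lt_trans.
exists w.
  apply/eqP => w0.
  have h2 : 0 < (2 : R)^-1 by rewrite invr_gt0.
  have [M hM] := mu_small _ h2.
  have [j Mj] := hw _ M h2; rewrite w0 subr0 => h.
  have := hM j Mj; have := z2 j; have := cabs_ge0 (z j); nra.
set X := mk _ _ _ _; set k1 := kap * rho^*%C; set k2 := rho * kap^*%C.
pose B0 := (cabs k1 + cabs k1 + cabs k2 + cabs k2) *
  (nm e11 + nm e12 + nm e21 + nm e22).
have B00 : 0 <= B0 by rewrite /B0 mulr_ge0 // !addr_ge0 ?cabs_ge0 ?nm_ge0.
apply: (@tang_bound _ _ _ _ B0) => // e e0 e1.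
have [M hM] := mu_small (e ^+ 2) (exprn_gt0 2 e0).
have [j Mj hj] := hw e M e0.
have GY := rs_G (st j).
have sje : s j < e.
  by rewrite -(@ltr_pXn2r _ 2) ?nnegrE ?(ltW e0) ?(ltW (s0 j)) // s2 hM.
(* This is the group commutator of Rk and Y; only the conjugated projection Y P Y^H enters it. *)
exists (Rk *m (Y j *m Rk^H *m (Y j)^H)), ((s j)^-1); split.
- by do 3?apply: (ugM GG) => //; apply: (ugV GG).
- by rewrite ger0_norm ?invr_ge0 ?(ltW (s0 j)) // ltf_pV2 ?posrE.
have sC : (s j)^-1%:C%C * (x j)%:C%C = (s j)%:C%C :> C.
  by rewrite -rmorphM -s2 /= expr2 mulKf ?gt_eqF.
have rk : k1 + k2 + kap * kap^*%C = 0.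
  by rewrite /k1 /k2 kapmu [k in k + _ + _]mulrC addrC [_ + (rho * _)]addrC rhokap subrr.
have -> : (s j)^-1%:C%C *: (Rk *m (Y j *m Rk^H *m (Y j)^H) - 1%:M) - X =
   mk ((s j)%:C%C * k1) (- (k1 * (z j - w)^*%C)) (k2 * (z j - w)) ((s j)%:C%C * k2).
  have -> : Y j *m Rk^H *m (Y j)^H = rho^*%C *: 1%:M + kap^*%C *: (Y j *m P *m (Y j)^H).
    rewrite RkE adjD !adjZ adj1 PH mulmxDr mulmxDl.
    rewrite -[Y j *m (rho^*%C *: _)]scalemxAr -[Y j *m (kap^*%C *: _)]scalemxAr.
    by rewrite -!scalemxAl mulmx1 (ugU GG GY).
  have key W : Rk *m (rho^*%C *: 1%:M + kap^*%C *: W) - 1%:M =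
      k1 *: P + k2 *: W + (kap * kap^*%C) *: (P *m W).
    rewrite RkE mulmxDl !mulmxDr -!scalemxAl -!scalemxAr !mul1mx mulmx1 !scalerA rho1.
    rewrite /k1 /k2; move: (P *m W) (1%:M : 'M[C]_N) => V I.
    by apply/matrixP => i l; rewrite !mxE; ring.
  rewrite key (refl_conj (st j)) PM PZ !mk2Z !mk2D mk2Z.
  rewrite -[- X]scaleN1r mk2Z mk2D.
  have -> : (1 - x j)%:C%C = 1 - (x j)%:C%C :> C by rewrite rmorphB rmorph1.
  have zJ : (z j)^*%C = (s j)^-1%:C%C * (al j * (be j)^*%C).
    have [y ey] : exists y : C, y = (s j)^-1%:C%C by exists ((s j)^-1%:C%C).
    have yJ : y^*%C = y by rewrite ey conjc_real.
    by rewrite /z -ey !rmorphM /= yJ conjcK [_^*%C * _]mulrC.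
  have kk : kap * kap^*%C = - (k1 + k2) by apply/eqP; rewrite -addr_eq0 addrC rk.
  rewrite kk rmorphB /= zJ -sC /X; apply: mk_eq; try by rewrite /z; ring.
  - by rewrite /k1 /k2; ring.
  - by rewrite /z /k1 /k2; ring.
apply: (le_trans (nm_mk2 _ _ _ _ _ _ _ _)); rewrite /B0 [X in _ <= X]mulrAC.
clearbody k1 k2.
rewrite ler_wpM2r ?addr_ge0 ?nm_ge0 // !mulrDl !cabsM cabsN !cabsM cabsJ cabsR.
rewrite (gtr0_norm (s0 j)).
have h1 := cabs_ge0 k1; have h2 := cabs_ge0 k2.
have b1 : cabs k1 * cabs (z j - w) <= cabs k1 * e by rewrite ler_wpM2l // ltW.
have b2 : cabs k2 * cabs (z j - w) <= cabs k2 * e by rewrite ler_wpM2l // ltW.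
have b3 : s j * cabs k1 <= cabs k1 * e by rewrite mulrC ler_wpM2l // ltW.
have b4 : s j * cabs k2 <= cabs k2 * e by rewrite mulrC ler_wpM2l // ltW.
by rewrite !lerD.
Qed.
End ReflectionPair.

(** * Special unitary matrices and one-parameter groups *)

Section Spectral.
Variables (R : realType).
Local Notation C := R[i].
Local Notation e := (cis true).

Lemma adjmx_conj d (A : 'M[C]_d) : A^H = map_mx Num.conj A^T.
Proof. by apply/matrixP => i j; rewrite !mxE. Qed.

Lemma unit_cis (z : C) : z * z^*%C = 1 -> exists x : R, z = e x.
Proof.
case: z => u v h; have uv : u ^+ 2 + v ^+ 2 = 1.
  by move/(congr1 (@complex.Re R)): h => /= <-; ring.
have u1 : -1 <= u <= 1.
  have h1 : u ^+ 2 <= 1 by rewrite -uv lerDl sqr_ge0.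
  by rewrite -ler_norml -(ler_pXn2r (n := 2)) ?nnegrE // expr1n real_normK ?num_real.
have [_ cu] := acos_def u1; have su := sin_acos u1.
have vE : `|v| = sin (acos u).
  by rewrite su -uv addrAC subrr add0r sqrtr_sqr.
have [v0|v0] := leP 0 v.
  exists (acos u); rewrite /cis cu mul1r -vE ger0_norm //.
exists (- acos u); rewrite /cis cosN sinN cu mul1r -vE ltr0_norm //.
by rewrite opprK.
Qed.

Lemma cis_sum (I : finType) (p : pred I) (th : I -> R) :
  \prod_(j | p j) e (th j) = e (\sum_(j | p j) th j).
Proof. by elim/big_ind2: _ => [|x y z t -> ->|//]; rewrite ?cis0 ?cisD. Qed.

(** Arbitrary angles sum to a multiple of 2 pi only. Replacing one of them by minus the sum of the
    others makes the sum 0, so that the generator becomes traceless. *)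
Lemma balanced_angles d (sp : 'I_d -> C) : (forall j, sp j * (sp j)^*%C = 1) ->
  \prod_j sp j = 1 -> exists2 th : 'I_d -> R, forall j, sp j = e (th j) & \sum_j th j = 0.
Proof.
move=> unit_sp prod_sp.
have [th hth] := boolp.choice (fun j => unit_cis (unit_sp j)).
have [d0|d0] := posnP d.
  by exists th => //; rewrite big1 // => j; have := ltn_ord j; rewrite {2}d0.
pose j0 := Ordinal d0; pose s := \sum_(j | j != j0) th j.
exists (fun j => if j == j0 then - s else th j).
  move=> j; case: eqP => [->|//]; have := prod_sp; rewrite (bigD1 j0) //=.
  under eq_bigr do rewrite hth.
  rewrite cis_sum -/s => h; have h' : e (- s) * e s = 1 by rewrite -cisD addNr cis0.
  have es0 : e s != 0 by apply/eqP => h0; move/eqP: h'; rewrite h0 mulr0 eq_sym oner_eq0.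
  by apply: (mulIf es0); rewrite h h'.
rewrite (bigD1 j0) // eqxx (eq_bigr th); last by move=> j /negPf ->.
exact: addNr.
Qed.

Lemma spectral_special_unitary d (U : 'M[C]_d) : U^H *m U = 1%:M -> \det U = 1 ->
  exists (P : 'M[C]_d) (th : 'I_d -> R),
    [/\ P *m P^H = 1%:M, U = P^H *m diag_mx (\row_j e (th j)) *m P & \sum_j th j = 0].
Proof.
move=> UU dU; have UU' := mulmx1C UU.
have nU : U \is normalmx by apply/normalmxP; rewrite -adjmx_conj UU UU'.
have := orthomx_spectralP nU; set P := spectralmx U; set sp := spectral_diag U => UE.
have uP : P \is unitarymx by apply: spectral_unitarymx.
have PP : P *m P^H = 1%:M by rewrite adjmx_conj; apply/unitarymxP.
have PP' := mulmx1C PP.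
have iP : invmx P = P^H by rewrite adjmx_conj invmx_unitary.
rewrite iP in UE; clearbody P sp.
have DE : diag_mx sp = P *m U *m P^H.
  by rewrite UE !mulmxA PP mul1mx -mulmxA PP mulmx1.
have DD : diag_mx sp *m (diag_mx sp)^H = 1%:M.
  rewrite DE !adjM adjK !mulmxA -[P *m U *m P^H *m P]mulmxA PP' mulmx1.
  by rewrite -[P *m U *m U^H]mulmxA UU' mulmx1.
have unit_sp j : sp 0 j * (sp 0 j)^*%C = 1.
  have /matrixP/(_ j j) := DD; rewrite !mxE eqxx (bigD1 j) //= big1 ?addr0.
    by rewrite !mxE eqxx !mulr1n.
  by move=> k kj; rewrite !mxE eq_sym (negPf kj) mulr0n mul0r.
have prod_sp : \prod_j sp 0 j = 1.
  rewrite -det_diag DE !det_mulmx mulrAC -mulrA [_ * \det U]mulrC dU mul1r.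
  by rewrite -det_mulmx PP det1.
have [th hth sth] := balanced_angles unit_sp prod_sp.
exists P, th; split; [exact: PP | | exact: sth].
have -> : \row_j e (th j) = sp by apply/rowP => j; rewrite mxE hth.
exact: UE.
Qed.

End Spectral.

(** * One-parameter groups supported on one sector *)

Section OneParameter.
Variables (R : realType) (N d : nat).
Local Notation C := R[i].
Local Notation e := (cis true).
Variables (J : 'M[C]_(N, d)) (P : 'M[C]_d) (th : 'I_d -> R).
Hypotheses (JJ : J^T *m J = 1%:M) (PP : P *m P^H = 1%:M).

Definition rotation (t : R) : 'M[C]_d := P^H *m diag_mx (\row_j e (t * th j)) *m P.
Definition rotation_gen : 'M[C]_d := P^H *m diag_mx (\row_j Complex 0 (th j)) *m P.
(* [A] on the range of the isometry [J], and the identity on its complement. *)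
Definition extend_id (A : 'M[C]_d) : 'M[C]_N := J *m A *m J^T + (1%:M - J *m J^T).

Lemma rotation0 : rotation 0 = 1%:M.
Proof.
rewrite /rotation; have -> : \row_j e (0 * th j) = const_mx 1 :> 'rV[C]_d.
  by apply/rowP => j; rewrite !mxE mul0r cis0.
by rewrite diag_const_mx mulmx1 (mulmx1C PP).
Qed.

Lemma rotationD s t : rotation (s + t) = rotation s *m rotation t.
Proof.
rewrite /rotation !mulmxA; congr (_ *m _).
rewrite -[_ *m P *m P^H]mulmxA PP mulmx1 -mulmxA mulmx_diag; congr (_ *m diag_mx _).
by apply/rowP => j; rewrite !mxE mulrDl cisD.
Qed.

Lemma rotation_gen_trace : \tr rotation_gen = Complex 0 (\sum_j th j).
Proof.
rewrite /rotation_gen -mulmxA mxtrace_mulC -mulmxA PP mulmx1 mxtrace_diag.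
under eq_bigr do rewrite mxE.
elim/big_ind2: _ => // x u y v -> ->.
by apply/eqP; rewrite eq_complex /= addr0 !eqxx.
Qed.

Lemma rotation_gen_skew : rotation_gen^H = - rotation_gen.
Proof.
rewrite /rotation_gen !adjM adjK mulmxA -mulNmx -mulmxN; congr (_ *m _ *m _).
apply/matrixP => j k; rewrite !mxE; have [->|jk] := eqVneq k j.
  by rewrite ?eqxx !mulr1n; apply/eqP; rewrite eq_complex /= oppr0 !eqxx.
by rewrite ?[j == k]eq_sym ?(negPf jk) !mulr0n rmorph0 oppr0.
Qed.

Lemma extend_id1 : extend_id 1%:M = 1%:M.
Proof. by rewrite /extend_id mulmx1 addrC subrK. Qed.

Lemma extend_idM A B : extend_id (A *m B) = extend_id A *m extend_id B.
Proof.
rewrite /extend_id; set K := 1%:M - _.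
have KJ : K *m J = 0 by rewrite mulmxBl -mulmxA JJ mulmx1 mul1mx subrr.
have JK : J^T *m K = 0 by rewrite mulmxBr mulmxA JJ mulmx1 mul1mx subrr.
have KK : K *m K = K by rewrite {2}/K mulmxBr mulmxA KJ mul0mx mulmx1 subr0.
clearbody K; rewrite mulmxDl !mulmxDr KK -[_ *m J^T *m K]mulmxA JK mulmx0 addr0 !mulmxA KJ !mul0mx add0r.
by rewrite -[J *m A *m J^T *m J]mulmxA JJ mulmx1.
Qed.

Lemma extend_id_J A : extend_id A *m J = J *m A.
Proof.
by rewrite mulmxDl mulmxBl mul1mx -!mulmxA JJ !mulmx1 subrr addr0.
Qed.

Lemma nm_diag (v : 'rV[C]_d) : nm (diag_mx v) = \sum_j cabs (v 0 j).
Proof.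
apply: eq_bigr => j _; rewrite (bigD1 j) //= mxE eqxx mulr1n big1 ?addr0 // => k kj.
by rewrite mxE eq_sym (negPf kj) mulr0n cabs0.
Qed.

Lemma cabs_cis x : cabs (e x : C) = 1.
Proof.
apply/eqP; rewrite -(eqrXn2 (n := 2)) ?cabs_ge0 // expr1n; apply/eqP; apply: complexI.
by rewrite cabs_sqr cis_unit.
Qed.

Let W := nm J * (nm (P^H) * nm P) * nm (J^T).

Let W0 : 0 <= W. Proof. by rewrite !mulr_ge0 ?nm_ge0. Qed.

Let nm_frame (v : 'rV[C]_d) : nm (J *m (P^H *m diag_mx v *m P) *m J^T) <= W * \sum_j cabs (v 0 j).
Proof.
apply: (le_trans (nmM _ _)); rewrite /W -nm_diag mulrAC ler_wpM2r ?nm_ge0 //.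
apply: (le_trans (nmM _ _)); rewrite -mulrA ler_wpM2l ?nm_ge0 //.
apply: (le_trans (nmM _ _)); rewrite mulrAC ler_wpM2r ?nm_ge0 //.
exact: nmM.
Qed.

Lemma nm_extend_rotation t :
  nm (extend_id (rotation t)) <= W * d%:R + nm (1%:M - J *m J^T).
Proof.
apply: (le_trans (nmD _ _)); rewrite lerD2r; apply: (le_trans (nm_frame _)).
rewrite ler_wpM2l // (eq_bigr (fun=> 1)) ?sumr_const ?card_ord // => j _.
by rewrite mxE cabs_cis.
Qed.

Lemma cis_taylor x : cabs (e x - 1 - Complex 0 x : C) <= x ^+ 2 + x ^+ 2 * `|x|.
Proof.
have ex : e x - 1 - Complex 0 x = Complex (cos x - 1) (sin x - x) :> C.
  by apply/eqP; rewrite eq_complex /=; apply/andP; split; apply/eqP; ring.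
rewrite ex; apply: (le_trans (cabs_Re_Im _)) => /=.
have hc := cos_bound (normr_ge0 x); have hs := sin_bound (normr_ge0 x).
rewrite real_normK ?num_real // in hc hs.
have [x0|x0] := leP 0 x; first by rewrite (ger0_norm x0) in hc hs *; apply: lerD.
rewrite (ltr0_norm x0) cosN sinN in hc hs *; apply: lerD => //.
by rewrite -normrN opprD.
Qed.

Lemma extend_rotation_taylor : exists2 D : R, 0 <= D & forall t, 0 < t -> t <= 1 ->
  nm (extend_id (rotation t) - 1%:M - t%:C%C *: (J *m rotation_gen *m J^T)) <= D * t ^+ 2.
Proof.
exists (W * \sum_j (th j ^+ 2 + th j ^+ 2 * `|th j|)).
  apply: mulr_ge0 => //; apply: sumr_ge0 => j _.
  by apply: addr_ge0; [|apply: mulr_ge0]; rewrite ?sqr_ge0 ?normr_ge0.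
move=> t t0 t1.
have -> : extend_id (rotation t) - 1%:M - t%:C%C *: (J *m rotation_gen *m J^T) =
    J *m (P^H *m diag_mx (\row_j (e (t * th j) - 1 - Complex 0 (t * th j))) *m P) *m J^T.
  have -> : \row_j (e (t * th j) - 1 - Complex 0 (t * th j)) =
      \row_j e (t * th j) - const_mx 1 - t%:C%C *: (\row_j Complex 0 (th j)) :> 'rV[C]_d.
    apply/rowP => j; rewrite !mxE; congr (_ - _).
    by apply/eqP; rewrite eq_complex /=; apply/andP; split; apply/eqP; ring.
  have dB (u v : 'rV[C]_d) : diag_mx (u - v) = diag_mx u - diag_mx v by rewrite raddfB.
  have dZ (c : C) (u : 'rV[C]_d) : diag_mx (c *: u) = c *: diag_mx u by rewrite linearZ.
  rewrite !dB dZ diag_const_mx /extend_id /rotation /rotation_gen.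
  move: (diag_mx _) (diag_mx _) => A B; rewrite !(mulmxBr, mulmxBl) -!(scalemxAl, scalemxAr) mulmx1 (mulmx1C PP) mulmx1.
  move: (J *m (P^H *m A *m P) *m J^T) (J *m (P^H *m B *m P) *m J^T) (J *m J^T) 1%:M => M1 M2 M3 I.
  by apply/matrixP => i j; rewrite !mxE; ring.
apply: (le_trans (nm_frame _)); rewrite -mulrA ler_wpM2l // mulr_suml; apply: ler_sum => j _.
rewrite mxE; apply: (le_trans (cis_taylor _)); rewrite exprMn normrM gtr0_norm //.
have -> : (th j ^+ 2 + th j ^+ 2 * `|th j|) * t ^+ 2 = t ^+ 2 * th j ^+ 2 + t ^+ 2 * th j ^+ 2 * `|th j| by ring.
rewrite lerD2l; apply: ler_wpM2l; first by apply: mulr_ge0; apply: sqr_ge0.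
exact: ler_piMl.
Qed.

End OneParameter.

(** * Four strands for r = 10 *)

Section GoldenRotation.
Variable R : realType.
Local Notation C := R[i].

(* The pair [(a, b)] stands for [a + b y]; the entries of [golden_pair m] are
   [z ^ m + z ^- m] and its successor when [z + z^-1 = 3 - 2 y] and [y ^ 2 = y + 1]. *)
Fixpoint golden_pair (m : nat) : (int * int) * (int * int) :=
  match m with
  | 0 => ((2, 0), (3, -2))
  | k.+1 => let: ((a, b), (c, d)) := golden_pair k in
            ((c, d), (3 * c - 2 * d - a, d - 2 * c - b))
  end.

Definition golden_eval (y : R) (p : int * int) : R := p.1%:~R + p.2%:~R * y.

Lemma golden_pair_rec (y : R) m : y ^+ 2 = y + 1 ->
  golden_eval y (golden_pair m.+1).2 =
  (3 - 2 * y) * golden_eval y (golden_pair m.+1).1 - golden_eval y (golden_pair m).1.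
Proof.
move=> hy /=; case: (golden_pair m) => -[a b] [c d] /=; rewrite /golden_eval /=.
rewrite !rmorphB !rmorphM /= -[3%:~R]/(3%:R) -[2%:~R]/(2%:R).
transitivity ((3 - 2 * y) * (c%:~R + d%:~R * y) - (a%:~R + b%:~R * y)
  + 2 * d%:~R * (y ^+ 2 - y - 1)); first ring.
by rewrite hy; ring.
Qed.

Lemma golden_pair_shift m : (golden_pair m).2 = (golden_pair m.+1).1.
Proof. by rewrite /=; case: (golden_pair m) => -[a b] [c d]. Qed.

(** For the negative root the coefficient 3 - 2 y of the recursion exceeds 2, so the sequence
    increases strictly from its initial value 2. *)
Lemma golden_grow (y : R) m : y ^+ 2 = y + 1 -> y < 0 ->
  2 <= golden_eval y (golden_pair m).1 /\
  golden_eval y (golden_pair m).1 < golden_eval y (golden_pair m).2.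
Proof.
move=> hy y0; elim: m => [|m [h1 h2]].
  rewrite /golden_eval /= mul0r addr0; split => //.
  have -> : (3%:~R : R) = 3 by []. have -> : ((-2)%:~R : R) = -2 by [].
  have -> : (2%:~R : R) = 2 by [].
  nra.
have e := golden_pair_rec m hy; rewrite -golden_pair_shift in e *.
split; first by apply: ltW; apply: le_lt_trans h2.
move: e h1 h2; move: (golden_eval _ _) => a; move: (golden_eval _ _) => c.
move: (golden_eval _ _) => d -> h1 h2; nra.
Qed.

(** If b > 0, the exponents of 5 on the two sides have different parities. *)
Lemma five_not_square (x b : nat) : (x ^ 2 = 5 * b ^ 2)%N -> b = 0%N.
Proof.
move=> h; apply/eqP; apply: contraT; rewrite -lt0n => b0.
have x0 : (0 < x)%N.
  by rewrite lt0n; apply/eqP => x0; move: h; rewrite x0 => /esym/eqP; rewrite muln_eq0 expn_eq0 => /orP[//|/andP[/eqP e _]]; rewrite e in b0.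
have b2 : (0 < b ^ 2)%N by rewrite expn_gt0 b0.
have := congr1 (logn 5) h; rewrite lognM // !lognX (_ : logn 5 5 = 1%N) //.
by move: (logn 5 x) (logn 5 b) => i j; clear; lia.
Qed.

(** Since (2 y - 1)^2 = 5, a relation p = b y makes 5 b^2 the square of 2 p - b. *)
Lemma golden_irrational (y : R) (p b : int) : y ^+ 2 = y + 1 ->
  p%:~R = b%:~R * y -> b = 0.
Proof.
move=> hy h.
have e : (2 * p - b) ^+ 2 = 5 * b ^+ 2 :> int.
  apply: (@intr_inj R); rewrite !expr2 !intrM intrD mulrNz intrM h.
  rewrite -[2%:~R]/(2%:R) -[5%:~R]/(5%:R).
  transitivity (b%:~R ^+ 2 * (4 * y ^+ 2 - 4 * y + 1)); first ring.
  by rewrite hy; ring.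
have := congr1 absz e; rewrite abszM !abszX => /five_not_square /eqP.
by rewrite absz_eq0 => /eqP.
Qed.

(* If [z ^ m = 1] then [golden_pair m] evaluates to [2] at [y], hence also at the
   other root of [y ^ 2 = y + 1], which is negative; there it grows. *)
Lemma golden_no_root (y : R) (z : C) m : y ^+ 2 = y + 1 -> 1 < y -> z * z^*%C = 1 ->
  z + z^*%C = (3 - 2 * y)%:C%C -> (0 < m)%N -> z ^+ m != 1.
Proof.
move=> hy y1 zu zy m0; apply/eqP => zm.
have tE k : z ^+ k + (z^*%C) ^+ k = (golden_eval y (golden_pair k).1)%:C%C /\
   z ^+ k.+1 + (z^*%C) ^+ k.+1 = (golden_eval y (golden_pair k).2)%:C%C.
  elim: k => [|k [h1 h2]].
    rewrite !expr0 !expr1 zy /golden_eval /= mul0r addr0; split.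
      by rewrite -[2%:~R]/(2%:R) rmorph_nat.
    congr (_%:C%C); rewrite -[3%:~R]/(3%:R) -[(-2)%:~R]/(- 2%:R); ring.
  split; first by rewrite -golden_pair_shift.
  rewrite golden_pair_rec // -golden_pair_shift.
  transitivity ((3 - 2 * y)%:C%C * (golden_eval y (golden_pair k).2)%:C%C
     - (golden_eval y (golden_pair k).1)%:C%C); last by rewrite -rmorphM -rmorphB.
  rewrite -h1 -h2 -zy !exprS.
  transitivity ((z + z^*%C) * (z * z ^+ k + z^*%C * z^*%C ^+ k)
     - (z * z^*%C) * (z ^+ k + z^*%C ^+ k)); first ring.
  by rewrite zu mul1r.
have [h _] := tE m; rewrite -rmorphXn zm rmorph1 in h.
have {}h : golden_eval y (golden_pair m).1 = 2.
  by apply: complexI; rewrite -h rmorph_nat.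
have [a [b [e hb]]] : exists a b : int, (golden_pair m).1 = (a, b) /\ b = 0.
  case E : (golden_pair m).1 => [a b]; exists a, b; split => //.
  rewrite E /golden_eval /= in h; apply: (@golden_irrational y (2 - a)) => //.
  by rewrite rmorphB /= -[2%:~R]/(2%:R) -h addrAC subrr add0r.
have hy' : (1 - y) ^+ 2 = (1 - y) + 1 by rewrite -[RHS]addr0 -(subrr (y ^+ 2)) {2}hy; ring.
have y'0 : 1 - y < 0 by lra.
case: m m0 {zm} e h => // m _ e h.
have [_] := golden_grow m hy' y'0; rewrite golden_pair_shift.
have [+ _] := golden_grow m hy' y'0.
move: h; rewrite /golden_eval e /= hb !mul0r !addr0 => -> h1 h2.
by have := le_lt_trans h1 h2; rewrite ltxx.
Qed.

End GoldenRotation.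

(** * Unitary matrices with eigenvalues 1, z and the conjugate of z *)

Section Rotation.
Variables (R : realType) (N : nat) (G : 'M[R[i]]_N -> Prop).
Local Notation C := R[i].
Hypothesis GG : unitary_group G.
Variables (u : 'M[C]_N) (t : R) (z : C).
Hypothesis Gu : G u.
Local Notation V := (u - u^H).
Local Notation W := (u + u^H - 1%:M - 1%:M).
Hypothesis uW : W *m (u - 1%:M) = (t - 2)%:C%C *: (u - 1%:M).
Hypothesis t2 : - 2 < t < 2.
Hypothesis zu : z * z^*%C = 1.
Hypothesis zt : z + z^*%C = t%:C%C.
Hypothesis z_inf : forall m, (0 < m)%N -> z ^+ m != 1.

Let s : R := complex.Im z.

Let subJ (v : C) : v - v^*%C = (2 * complex.Im v)%:C%C * 'i%C.
Proof. by case: v => x y; apply/eqP; rewrite eq_complex /=; apply/andP; split; apply/eqP; ring. Qed.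

Let tC : z + z^*%C - 2 = (t - 2)%:C%C.
Proof. by rewrite zt rmorphB rmorph_nat. Qed.

Let t2_neq0 : z + z^*%C - 2 != 0.
Proof.
rewrite tC; apply/eqP => /complexI h; move: t2; rewrite -[t](subrK 2) h; lra.
Qed.

Let s4 : (2 * s) ^+ 2 = 4 - t ^+ 2.
Proof.
have h1 : complex.Re z ^+ 2 + s ^+ 2 = 1.
  by apply: complexI; rewrite add_Re2_Im2 sqr_normc zu rmorph1.
have h2 : 2 * complex.Re z = t.
  by apply: complexI; rewrite -zt addcJ rmorphM rmorph_nat.
have h3 : s ^+ 2 = 1 - complex.Re z ^+ 2 by rewrite -h1 addrAC subrr add0r.
by rewrite -h2; transitivity (4 * s ^+ 2); [ring | rewrite h3; ring].
Qed.

Let zz_neq0 : z - z^*%C != 0.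
Proof.
have : (2 * s) ^+ 2 != 0 by rewrite s4; apply/eqP; have := t2; nra.
apply: contra => /eqP h; move: h; rewrite subJ -/s => /eqP.
rewrite mulf_eq0 => /orP[/eqP/complexI -> //|]; first by rewrite expr0n.
by rewrite eq_complex /= oner_eq0 andbF.
Qed.

(* On the eigenvectors of [u] with eigenvalue [z] or [z^*], the right-hand side
   takes the values [z ^ m] and [z^* ^ m]. *)
Lemma rotation_power m : u ^+ m = 1%:M
  + ((z ^+ m - (z^*%C) ^+ m) / (2 * (z - z^*%C))) *: V
  + ((z ^+ m + (z^*%C) ^+ m - 2) / (2 * (z + z^*%C - 2))) *: W.
Proof.
have uu := ugU GG Gu; have uu' := ug_VM GG Gu.
have WM : W *m u = u *m u + 1%:M - u - u.
  by rewrite !mulmxBl mulmxDl uu' mul1mx.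
have MW : u *m W = u *m u + 1%:M - u - u.
  by rewrite !mulmxBr mulmxDr uu mulmx1.
have eW : u *m W = W + (z + z^*%C - 2) *: (u - 1%:M).
  by rewrite MW -WM tC -uW [W *m (u - _)]mulmxBr mulmx1 [RHS]addrC subrK.
have e2 : u *m u = u + u - 1%:M + (W + (z + z^*%C - 2) *: (u - 1%:M)).
  rewrite -eW MW; move: (u *m u) (1%:M : 'M[C]_N) => a I.
  by apply/matrixP => i j; rewrite !mxE; ring.
have eV : u *m V = u *m u - 1%:M by rewrite mulmxBr uu.
elim: m => [|m IH].
  rewrite !expr0 subrr mul0r scale0r addr0 -[1 + 1]/(2%:R) subrr mul0r scale0r addr0.
  by [].
rewrite exprS -[_ * _]/(u *m u ^+ m) IH !mulmxDr mulmx1 -!scalemxAr eV eW e2.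
rewrite !exprS; move: (z ^+ m) ((z^*%C) ^+ m) => Z Z'.
move: zz_neq0 t2_neq0 zu; move: (z^*%C) => w h1 h2 zw.
set a := (Z - Z') / _; set c := (Z + Z' - 2) / _.
have ha : a * (2 * (z - w)) = Z - Z' by rewrite /a divfK // mulf_neq0 // pnatr_eq0.
have hc : c * (2 * (z + w - 2)) = Z + Z' - 2 by rewrite /c divfK // mulf_neq0 // pnatr_eq0.
set a' := (z * Z - w * Z') / _; set c' := (z * Z + w * Z' - 2) / _.
have key : (z - w) ^+ 2 = (z + w - 2) * (z + w + 2).
  by transitivity ((z + w) ^+ 2 - 4 * (z * w)); [ring | rewrite zw; ring].
have ea : a' = 2^-1 + a * ((z + w) / 2) + c * ((z + w) / 2 - 1).
  apply: (mulIf (x := 2 * (z - w))); first by rewrite mulf_neq0 // pnatr_eq0.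
  rewrite divfK; last by rewrite mulf_neq0 // pnatr_eq0.
  transitivity ((z - w) + (a * (2 * (z - w))) * ((z + w) / 2) + (c * (2 * (z + w - 2))) * ((z - w) / 2)).
    by rewrite ha hc; field.
  by field.
have ec : c' = 2^-1 + a * ((z + w) / 2 + 1) + c * ((z + w) / 2).
  apply: (mulIf (x := 2 * (z + w - 2))); first by rewrite mulf_neq0 // pnatr_eq0.
  rewrite divfK; last by rewrite mulf_neq0 // pnatr_eq0.
  transitivity ((z + w - 2) + a * ((z + w - 2) * (z + w + 2)) + (c * (2 * (z + w - 2))) * ((z + w) / 2)); last by field.
  rewrite -key hc; transitivity ((z + w - 2) + (a * (2 * (z - w))) * ((z - w) / 2) + (Z + Z' - 2) * ((z + w) / 2)); last by field.
  by rewrite ha; field.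
rewrite ea ec; move: (u^H) (1%:M) => h I.
by apply/matrixP => i j; rewrite !mxE; field.
Qed.

(** Two powers near a common cluster point have a quotient near 1. *)
Lemma power_near1 e : 0 < e -> exists2 m, (0 < m)%N & cabs (z ^+ m - 1) < e.
Proof.
move=> e0; have zn j : cabs (z ^+ j) = 1.
  have h : cabs z = 1.
    have : cabs z ^+ 2 = 1 by apply: complexI; rewrite cabs_sqr zu rmorph1.
    by move=> /eqP; rewrite sqrf_eq1 => /orP[/eqP ->//|/eqP h]; have := cabs_ge0 z; rewrite h; lra.
  by elim: j => [|j IH]; rewrite ?expr0 ?cabs1 // exprS cabsM IH h mulr1.
have zl j : cabs (z ^+ j) <= 1 by rewrite zn.
have [w hw] := bounded_cluster zl.
have e20 : 0 < e / 2 by rewrite divr_gt0.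
have [i _ hi] := hw _ 0%N e20; have [j ij hj] := hw _ i.+1 e20.
exists (j - i)%N; first by rewrite subn_gt0.
have -> : cabs (z ^+ (j - i) - 1) = cabs (z ^+ j - z ^+ i).
  have -> : z ^+ j - z ^+ i = (z ^+ (j - i) - 1) * z ^+ i.
    by rewrite mulrBl mul1r -exprD subnK // ltnW.
  by rewrite cabsM zn mulr1.
have -> : z ^+ j - z ^+ i = (z ^+ j - w) - (z ^+ i - w) by ring.
apply: (le_lt_trans (cabsD _ _)); rewrite cabsN [e]splitr ltrD //.
Qed.

(** Let z^m be close to 1 with imaginary part S, which is nonzero by [z_inf]. In [rotation_power]
    the coefficient of V is S / (2 s) and that of W is of order S^2, so (2 s / S) (u^m - 1) tends to
    V. *)
Lemma tang_rotation : tang G V.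
Proof.
have s0 : s != 0.
  by apply: contra zz_neq0 => /eqP h; rewrite subJ -/s h mulr0 mul0r.
have ns : 0 < `|s| by rewrite normr_gt0.
have t20 : 0 < 2 - t by have := t2; lra.
pose B := 4 * s ^+ 2 / (2 - t) * nm W.
have B0 : 0 <= B.
  apply: mulr_ge0; last exact: nm_ge0.
  by apply: divr_ge0; [apply: mulr_ge0 => //; apply: sqr_ge0 | exact: ltW].
apply: (@tang_bound _ _ _ _ B) => // e e0 e1.
(* The bound 1 gives z^m positive real part, which excludes -1 and yields |z^m - 1|^2 <= 2 S^2; the
   other bound makes the scale 2 s / S large. *)
pose e' := Num.min 1 (2 * `|s| * e).
have e'0 : 0 < e' by rewrite lt_min ltr01 !mulr_gt0.
have [m m0] := power_near1 e'0; rewrite lt_min => /andP[v1 v2].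
set v := z ^+ m in v1 v2.
have vu : v * v^*%C = 1 by rewrite /v rmorphXn -exprMn zu expr1n.
set x := complex.Re v; set S := complex.Im v.
have xS : x ^+ 2 + S ^+ 2 = 1.
  by apply: complexI; rewrite add_Re2_Im2 sqr_normc vu rmorph1.
have x0 : 0 < x.
  have : `|complex.Re (v - 1)| < 1 := le_lt_trans (Re_cabs _) v1.
  by rewrite /x; case: (v) => p p' /=; rewrite ltr_norml; lra.
have v1E : cabs (v - 1) ^+ 2 = 2 - 2 * x.
  apply: complexI; rewrite cabs_sqr rmorphB rmorph1.
  transitivity (v * v^*%C + 1 - (v + v^*%C)); first ring.
  by rewrite vu addcJ rmorphB rmorphM !rmorph_nat.
have S0 : S != 0.
  apply/eqP => h; have : v = 1; last by apply/eqP; apply: z_inf.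
  have x1 : x = 1 by rewrite h in xS; nra.
  by apply/eqP; rewrite -subr_eq0 -cabs_eq0 -sqrf_eq0 v1E x1; apply/eqP; ring.
have SE : `|S| < 2 * `|s| * e.
  apply: le_lt_trans v2; have -> : S = complex.Im (v - 1) by rewrite /S; case: (v) => p p' /=; rewrite subr0.
  exact: Im_cabs.
have nS : 0 < `|S| by rewrite normr_gt0.
exists (u ^+ m), (2 * s / S); split.
- by elim: (m) => [|j Gj]; rewrite ?expr0 ?exprS; [exact: ug1|exact: ugM].
- rewrite !normrM normfV (ger0_norm (ler0n _ 2)) ltr_pdivlMr // mulrC ltr_pdivrMr //.
rewrite rotation_power -/v.
have -> : (z^*%C) ^+ m = v^*%C by rewrite -rmorphXn.
have -> : (v - v^*%C) / (2 * (z - z^*%C)) = (S / (2 * s))%:C%C.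
  rewrite !subJ -/s -/S; apply: (mulIf (x := 2 * ((2 * s)%:C%C * 'i%C))).
    by rewrite mulf_neq0 ?pnatr_eq0 // -subJ.
  rewrite divfK; last by rewrite mulf_neq0 ?pnatr_eq0 // -subJ.
  have -> : (2 : C) = 2%:C%C by rewrite rmorph_nat.
  rewrite !mulrA -!rmorphM; congr (_%:C%C * _); field; exact: s0.
set d := (_ / _ : C).
have -> : (2 * s / S)%:C%C *: (1%:M + (S / (2 * s))%:C%C *: V + d *: W - 1%:M) - V
   = ((2 * s / S)%:C%C * d) *: W.
  have h : (2 * s / S)%:C%C * (S / (2 * s))%:C%C = 1 :> C.
    by rewrite -rmorphM -(rmorph1 (real_complex R)); congr (_%:C%C); field; rewrite s0 S0.
  rewrite addrAC [1%:M + _]addrC addrK scalerDr !scalerA h scale1r.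
  by rewrite addrAC subrr add0r.
rewrite nmZ /B -[_ * nm W * e]mulrAC ler_wpM2r ?nm_ge0 //.
rewrite cabsM cabsR.
have dE : cabs d * (2 * (2 - t)) = cabs (v - 1) ^+ 2.
  have hd : d * (2 * (t - 2))%:C%C = - ((v - 1) * (v - 1)^*%C).
    have -> : (2 * (t - 2))%:C%C = 2 * (z + z^*%C - 2) by rewrite tC rmorphM rmorph_nat.
    rewrite divfK; last by rewrite mulf_neq0 // pnatr_eq0.
    rewrite rmorphB rmorph1.
    transitivity (v + v^*%C - 1 - 1); first ring.
    by rewrite -{2}vu; ring.
  have := congr1 (@cabs R) hd; rewrite cabsM cabsR cabsN cabsM cabsJ -expr2 => <-.
  by rewrite normrM (ger0_norm (ler0n _ 2)) distrC gtr0_norm.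
have dS : cabs (v - 1) ^+ 2 <= 2 * S ^+ 2.
  rewrite v1E; have -> : S ^+ 2 = 1 - x ^+ 2 by rewrite -xS; ring.
  have : x <= 1 by have := sqr_ge0 S; nra.
  nra.
have d2 : cabs d <= S ^+ 2 / (2 - t).
  by rewrite ler_pdivlMr //; lra.
have -> : `|2 * s / S| = 2 * `|s| / `|S| by rewrite !normrM normfV (ger0_norm (ler0n _ 2)).
apply: (@le_trans _ _ (2 * `|s| / `|S| * (S ^+ 2 / (2 - t)))).
  by rewrite ler_wpM2l // divr_ge0 // mulr_ge0.
have -> : 2 * `|s| / `|S| * (S ^+ 2 / (2 - t)) = 2 * `|s| * `|S| / (2 - t).
  by rewrite -(real_normK (num_real S)); field; rewrite !gt_eqF.
have -> : 4 * s ^+ 2 / (2 - t) * e = 2 * `|s| * (2 * `|s| * e) / (2 - t).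
  by rewrite -(real_normK (num_real s)); field; rewrite gt_eqF.
by rewrite ler_pM2r ?invr_gt0 // ler_wpM2l ?mulr_ge0 // ltW.
Qed.

End Rotation.

Lemma golden_lt2 (R : realType) (y : R) : y ^+ 2 = y + 1 -> 1 < y -> y < 2.
Proof. by move=> h y1; rewrite ltNge; apply/negP => h2; nra. Qed.

Lemma golden_trace (R : realType) (y : R) : y ^+ 2 = y + 1 -> 1 < y ->
  - 2 < 3 - 2 * y < 2.
Proof. by move=> h y1; have := golden_lt2 h y1 => h2; apply/andP; split; lra. Qed.

Lemma half_sqr_le1 (R : realType) (t : R) : - 2 < t < 2 -> 0 <= 1 - (t / 2) ^+ 2.
Proof. by move=> /andP[h1 h2]; nra. Qed.

(** * The commutator of a reflection with a conjugate, at the golden ratio *)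

Section TwoReflections.
Variables (R : realType) (N : nat) (G : 'M[R[i]]_N -> Prop).
Local Notation C := R[i].
Hypothesis GG : unitary_group G.
Variables (q : C) (S P P0 : 'M[C]_N).
Hypothesis GS : G S.
Hypothesis SE : S = q *: 1%:M - (1 + q) *: (P + P0).
Hypothesis qu : q * q^*%C = 1.
Hypotheses (PP : P *m P = P) (PH : P^H = P) (P0H : P0^H = P0).
Hypotheses (PP0 : P *m P0 = 0) (P0P : P0 *m P = 0) (P0P0 : P0 *m P0 = P0).
Hypothesis q1 : 1 + q != 0.
Local Notation L := (ctang G).

Let conj_S X : P0 *m X = 0 -> X *m P0 = 0 ->
  S *m X *m S^H = X - (1 + q) *: (X *m P) - (1 + q^*%C) *: (P *m X)
    + ((1 + q) * (1 + q^*%C)) *: (P *m X *m P).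
Proof.
move=> h1 h2.
have SX : S *m X = q *: X - (1 + q) *: (P *m X).
  by rewrite SE mulmxBl -!scalemxAl mul1mx mulmxDl h1 addr0.
have ZS (Z : 'M[C]_N) : Z *m P0 = 0 -> Z *m S^H = q^*%C *: Z - (1 + q^*%C) *: (Z *m P).
  have zE : (1 + q)^*%C = 1 + q^*%C by rewrite rmorphD rmorph1.
  move=> h; rewrite SE adjB !adjZ adjD adj1 PH P0H zE.
  by rewrite mulmxBr -!scalemxAr mulmx1 mulmxDr h addr0.
have h3 : P *m X *m P0 = 0 by rewrite -mulmxA h2 mulmx0.
rewrite SX mulmxBl -!scalemxAl (ZS X h2) (ZS _ h3).
set z := q^*%C; have qz : q * z = 1 := qu.
move: (P *m X) (X *m P) (P *m X *m P) => a d f.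
transitivity ((q * z) *: X - ((q * z) + q) *: d - ((q * z) + z) *: a
   + ((1 + q) * (1 + z)) *: f).
  by apply/matrixP => i j; rewrite !mxE; ring.
by rewrite qz scale1r [1 + z]addrC.
Qed.

Hypothesis qJ : q - q^*%C != 0.

(* [P X (1 - P)] is the eigencomponent of [X] for the eigenvalue [- q^*] of the
   conjugation by [S], whose other eigenvalues are [1] and [- q]. *)
Lemma offdiag_row X : P0 *m X = 0 -> X *m P0 = 0 -> L X -> L (P *m X - P *m X *m P).
Proof.
move=> h1 h2 LX; set X1 := S *m X *m S^H; have LX1 : L X1 by apply: ctang_conj.
have e1 := conj_S h1 h2; rewrite -/X1 in e1.
have k1 : P0 *m X1 = 0.
  by rewrite e1 mulmxDr !mulmxBr -!scalemxAr !mulmxA h1 P0P !mul0mx !scaler0 !subr0 addr0.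
have k2 : X1 *m P0 = 0.
  by rewrite e1 mulmxDl !mulmxBl -!scalemxAl -!mulmxA h2 PP0 !mulmx0 !scaler0 !subr0 addr0.
set X2 := S *m X1 *m S^H; have LX2 : L X2 by apply: ctang_conj.
have e2 := conj_S k1 k2; rewrite -/X2 in e2.
set z := q^*%C in e1 e2; have qz : q * z = 1 := qu; have qJz : q - z != 0 := qJ.
have PX1 : P *m X1 = - z *: (P *m X) + ((1 + q) * z) *: (P *m X *m P).
  rewrite e1 mulmxDr !mulmxBr -!scalemxAr !mulmxA PP.
  by apply/matrixP => i j; rewrite !mxE; ring.
have X1P : X1 *m P = - q *: (X *m P) + ((1 + z) * q) *: (P *m X *m P).
  rewrite e1 mulmxDl !mulmxBl -!scalemxAl -!mulmxA PP.
  by apply/matrixP => i j; rewrite !mxE; ring.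
have PX1P : P *m X1 *m P = (q * z) *: (P *m X *m P).
  rewrite PX1 mulmxDl -!scalemxAl -!mulmxA PP mulmxA.
  by apply/matrixP => i j; rewrite !mxE; ring.
have LL : L (X2 - (1 - q) *: X1 - q *: X).
  by apply: (ctangB GG); [apply: (ctangB GG)|] => //; apply: (ctangZ GG).
have e : X2 - (1 - q) *: X1 - q *: X = ((1 + z) * (z - q)) *: (P *m X - P *m X *m P)
    + ((1 + z) * q * (q * z - 1)) *: (P *m X *m P).
  rewrite e2 PX1P X1P PX1 e1.
  move: (P *m X) (X *m P) (P *m X *m P) => a d f.
  by apply/matrixP => i j; rewrite !mxE; ring.
rewrite e qz subrr mulr0 scale0r addr0 in LL.
have nz : (1 + z) * (z - q) != 0.
  rewrite mulf_neq0 //; last by rewrite -opprB oppr_eq0.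
  have -> : 1 + z = (1 + q)^*%C by rewrite rmorphD rmorph1.
  by rewrite conjc_eq0.
by have := ctangZ GG ((1 + z) * (z - q))^-1 LL; rewrite scalerA mulVf // scale1r.
Qed.

Variables (Y : 'M[C]_N) (al : C) (y : R).
Hypothesis GY : G Y.
Hypothesis YP0 : Y *m P0 *m Y^H = P0.
Hypothesis PYP : P *m Y *m P = al *: P.
Hypothesis aly : al * al^*%C = (2 - y)%:C%C.
Hypothesis qy : (1 + q) * (1 + q)^*%C = (2 + y)%:C%C.
Hypothesis y2 : y ^+ 2 = y + 1.
Hypothesis y1 : 1 < y.

(** In the commutator u of S and Y the contributions of P0 cancel, and u involves only P and Q = Y P
    Y^H, with P Q P = (2 - y) P. Thus u satisfies the hypotheses of [tang_rotation], so u - u^H is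
    tangent; [offdiag_row] extracts from it the part P Q (1 - P). *)
Lemma two_reflections : L (P *m (Y *m P *m Y^H) - (2 - y)%:C%C *: P).
Proof.
have YY := ugU GG GY; have YY' := ug_VM GG GY.
set Q := Y *m P *m Y^H; pose c := (2 - y)%:C%C; rewrite -/Q -/c; have alc : al * al^*%C = c := aly.
have QH : Q^H = Q by rewrite /Q !adjM adjK PH mulmxA.
have QQ : Q *m Q = Q.
  by rewrite /Q !mulmxA -[Y *m P *m Y^H *m Y]mulmxA YY' mulmx1 -[Y *m P *m P]mulmxA PP.
have PYHP : P *m Y^H *m P = al^*%C *: P.
  have -> : P *m Y^H *m P = (P *m Y *m P)^H by rewrite !adjM PH mulmxA.
  by rewrite PYP adjZ PH.
have P0Q : P0 *m Q = 0.
  rewrite -YP0 /Q !mulmxA -[Y *m P0 *m Y^H *m Y]mulmxA YY' mulmx1.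
  by rewrite -[Y *m P0 *m P]mulmxA P0P mulmx0 mul0mx.
have QP0 : Q *m P0 = 0 by rewrite -QH -P0H -adjM P0Q adj0.
have PQP : P *m Q *m P = c *: P.
  by rewrite /Q !mulmxA PYP -!scalemxAl PYHP scalerA alc.
have QPQ : Q *m P *m Q = c *: Q.
  have -> : Q *m P *m Q = Y *m (P *m Y^H *m P *m Y *m P) *m Y^H by rewrite /Q !mulmxA.
  rewrite PYHP -!scalemxAl PYP scalerA [_ * al]mulrC alc.
  by rewrite -scalemxAr -scalemxAl.
pose z := q^*%C; pose u := S *m (Y *m S^H *m Y^H).
have Gu : G u by do 3?apply: (ugM GG) => //; apply: (ugV GG).
have zE : (1 + q)^*%C = 1 + z by rewrite rmorphD rmorph1.
have qz : q * z = 1 := qu.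
pose mu := (2 + y)%:C%C; have qm : (1 + q) * (1 + z) = mu by rewrite -zE qy.
have muz : mu = 2 + q + z by rewrite -qm; transitivity (1 + q * z + q + z); [ring | rewrite qz; ring].
have uE : u = 1%:M - (1 + z) *: P - (1 + q) *: Q + mu *: (P *m Q).
  rewrite /u; have -> : Y *m S^H *m Y^H = z *: 1%:M - (1 + z) *: (Q + P0).
    rewrite SE adjB !adjZ adjD adj1 PH P0H zE mulmxBr mulmxBl.
    rewrite -[Y *m (z *: _)]scalemxAr -[Y *m ((1 + z) *: _)]scalemxAr -!scalemxAl mulmx1 YY.
    by rewrite mulmxDr mulmxDl YP0.
  rewrite SE mulmxBl !mulmxBr -!scalemxAl -!scalemxAr !mul1mx mulmx1.
  rewrite mulmxDl !mulmxDr PP0 P0Q P0P0 addr0 add0r.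
  transitivity ((q * z) *: 1%:M - (q * z + z) *: P - (q * z + q) *: Q + ((1 + q) * (1 + z)) *: (P *m Q)
    + ((1 + q) * (1 + z) - (q * z + z) - (q * z + q)) *: P0).
    move: (P *m Q) (1%:M : 'M[C]_N) => a I.
    by apply/matrixP => i j; rewrite !mxE; ring.
  rewrite qz qm scale1r.
  have -> : mu - (1 + z) - (1 + q) = 0 by rewrite muz; ring.
  by rewrite scale0r addr0.
have muJ : mu^*%C = mu by rewrite conjc_real.
have uHE : u^H = 1%:M - (1 + q) *: P - (1 + z) *: Q + mu *: (Q *m P).
  have zJ : (1 + z)^*%C = 1 + q by rewrite -zE conjcK.
  by rewrite uE adjD !adjB !adjZ adj1 adjM PH QH muJ zE zJ.
have WE : u + u^H - 1%:M - 1%:M = - mu *: (P + Q - P *m Q - Q *m P).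
  rewrite uHE uE; move: (P *m Q) (Q *m P) (1%:M : 'M[C]_N) => a d I; rewrite muz.
  by apply/matrixP => i j; rewrite !mxE; ring.
have DP : (P + Q - P *m Q - Q *m P) *m P = (1 - c) *: P.
  rewrite !mulmxBl mulmxDl PP PQP -[Q *m P *m P]mulmxA PP.
  by move: (Q *m P) => a; apply/matrixP => i j; rewrite !mxE; ring.
have DQ : (P + Q - P *m Q - Q *m P) *m Q = (1 - c) *: Q.
  rewrite !mulmxBl mulmxDl QQ QPQ -[P *m Q *m Q]mulmxA QQ.
  by move: (P *m Q) => a; apply/matrixP => i j; rewrite !mxE; ring.
(* The trace on the plane of P and Q is 2 - (2 + y) (1 - c) with c = 2 - y, which reduces to 3 - 2 y
   by y^2 = y + 1. *)
pose t := 3 - 2 * y.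
have tE : - mu * (1 - c) = (t - 2)%:C%C.
  rewrite -(rmorph1 (real_complex R)) -rmorphN -rmorphB -rmorphM; congr (_%:C%C).
  transitivity (y * 1 + 2 - (y ^+ 2 + y * 2 )); last by rewrite y2 /t; ring.
  ring.
have uW : (u + u^H - 1%:M - 1%:M) *m (u - 1%:M) = (t - 2)%:C%C *: (u - 1%:M).
  rewrite WE -tE -scalemxAl -scalerA; congr (_ *: _).
  have -> : u - 1%:M = mu *: (P *m Q) - (1 + z) *: P - (1 + q) *: Q.
    rewrite uE; move: (P *m Q) (1%:M : 'M[C]_N) => a I.
    by apply/matrixP => i j; rewrite !mxE; ring.
  rewrite !mulmxBr -!scalemxAr mulmxA DP DQ -scalemxAl.
  by move: (P *m Q) => a; apply/matrixP => i j; rewrite !mxE; ring.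
have t2 : - 2 < t < 2 := golden_trace y2 y1.
(* A point of the unit circle with w + w^* = t, hence an eigenvalue candidate for the rotation. *)
pose w : C := Complex (t / 2) (Num.sqrt (1 - (t / 2) ^+ 2)).
have wu : w * w^*%C = 1.
  rewrite -sqr_normc -add_Re2_Im2 /= sqr_sqrtr; last exact: half_sqr_le1.
  by rewrite addrCA subrr addr0.
have wt : w + w^*%C = t%:C%C.
  by rewrite addcJ -(rmorph_nat (real_complex R)) -rmorphM; congr (_%:C%C) => /=; field.
have LV := ctangT GG (tang_rotation GG Gu uW t2 wu wt (fun m => golden_no_root y2 y1 wu wt)).
have P0u : P0 *m u = P0.
  rewrite uE mulmxDr !mulmxBr -!scalemxAr [P0 *m (P *m Q)]mulmxA P0P mul0mx P0Q !scaler0 mulmx1.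
  by rewrite !subr0 addr0.
have uP0 : u *m P0 = P0.
  rewrite uE mulmxDl !mulmxBl -!scalemxAl -[P *m Q *m P0]mulmxA PP0 QP0 mulmx0 !scaler0 mul1mx.
  by rewrite !subr0 addr0.
have P0V : P0 *m (u - u^H) = 0.
  by rewrite mulmxBr P0u -[P0 *m u^H]adjK adjM adjK P0H uP0 P0H subrr.
have VP0 : (u - u^H) *m P0 = 0.
  by rewrite mulmxBl uP0 -[u^H *m P0]adjK adjM adjK P0H P0u P0H subrr.
have := offdiag_row P0V VP0 LV.
have PV : P *m (u - u^H) = (q - z) *: P - (q - z) *: (P *m Q) + mu *: (P *m Q) - (mu * c) *: P.
  rewrite mulmxBr uHE uE !mulmxDr !mulmxN -!scalemxAr mulmx1 [P *m (P *m Q)]mulmxA [P *m (Q *m P)]mulmxA PP PQP.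
  by move: (P *m Q) => a; apply/matrixP => i j; rewrite !mxE; ring.
have -> : P *m (u - u^H) - P *m (u - u^H) *m P = (2 * (1 + z)) *: (P *m Q - c *: P).
  rewrite PV mulmxBl mulmxDl mulmxBl -!scalemxAl PP PQP muz.
  by move: (P *m Q) => a; apply/matrixP => i j; rewrite !mxE; ring.
move=> h; have nz : 2 * (1 + z) != 0.
  by rewrite mulf_neq0 ?pnatr_eq0 // -zE conjc_eq0.
by have := ctangZ GG (2 * (1 + z))^-1 h; rewrite scalerA mulVf // scale1r.
Qed.

End TwoReflections.

(** The two entries of a column of sigma_2 in the block with 1 - a = 1 / [2]^2, where g = [2]^2.
    They show that sigma_2 can start the iteration of [refl_next] with x = a. *)
Lemma refl_column_norm (R : realType) (q : R[i]) (g a c : R) :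
  q * q^*%C = 1 -> (1 + q) * (1 + q)^*%C = g%:C%C -> g * (a * (1 - a)) = a ->
  c ^+ 2 = a * (1 - a) ->
  (q - (1 + q) * (1 - a)%:C%C) * (q - (1 + q) * (1 - a)%:C%C)^*%C = (1 - a)%:C%C /\
  (- (1 + q) * c%:C%C) * (- (1 + q) * c%:C%C)^*%C = a%:C%C.
Proof.
move=> qu qg ga ca.
have gC : g%:C%C * (a%:C%C * (1 - a)%:C%C) = a%:C%C by rewrite -!rmorphM ga.
have cC : c%:C%C * c%:C%C = a%:C%C * (1 - a)%:C%C by rewrite -!rmorphM -expr2 ca.
have aC : a%:C%C = 1 - (1 - a)%:C%C by rewrite rmorphB rmorph1 opprB addrCA subrr addr0.
have yJ : (((1 - a)%:C%C)^*)%C = (1 - a)%:C%C by rewrite conjc_real.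
have cJ : ((c%:C%C)^*)%C = c%:C%C by rewrite conjc_real.
rewrite -qg in gC; move: gC cC aC yJ cJ.
move: (a%:C%C) ((1 - a)%:C%C) (c%:C%C) => x y z gC cC aC yJ cJ.
rewrite rmorphD rmorph1 in qg gC.
rewrite rmorphB !rmorphM rmorphN rmorphD rmorph1 /= yJ cJ.
split.
  transitivity (q * q^*%C - y * ((1 + q) * (1 + q^*%C) + q * q^*%C - 1) + (1 + q) * (1 + q^*%C) * y ^+ 2); first ring.
  rewrite qu; transitivity (1 - (1 + q) * (1 + q^*%C) * ((1 - y) * y)); first ring.
  by rewrite -aC gC aC; ring.
transitivity ((1 + q) * (1 + q^*%C) * (z * z)); first ring.
by rewrite cC gC.
Qed.

#[local] Opaque eu Sk qq np.

(** * The three-step units for r different from 6 and 10 *)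

Section Base3Lie.
Variables (R : realType) (b : bool) (r n : nat).
Local Notation C := R[i].
Local Notation q := (qq R b r).
Hypothesis r5 : (5 <= r)%N.
Hypothesis n3 : (3 <= n)%N.
Local Notation Sk := (@Sk R b r n).
Local Notation eu := (@eu R r n).
Local Notation Gr := (@Gr R b r n).
Local Notation L := (ctang Gr).
Local Notation good := (@good R b r n).
Local Notation node := (node r).
Local Notation GG := (@Gr_group R b r n r5).
Local Notation p1 := [:: true; false; true].
Local Notation p2 := [:: false; true; true].
Local Notation p3 := [:: true; true; true].

Let n1 : node 3 1 p1. Proof. by rewrite /node /= !andbT; lia. Qed.
Let n2 : node 3 1 p2. Proof. by rewrite /node /= !andbT; lia. Qed.

Lemma size3_adm s : size s = 3%N -> adm r s -> [\/ s = p1, s = p2 | s = p3].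
Proof.
case: s => [//|a [//|c [//|d [|//]]]] _.
by case: a; case: c; case: d => //=; rewrite ?andbF // => _; [apply: Or33|apply: Or31|apply: Or32].
Qed.

Lemma one_split3 : 1%:M = eu p1 p1 + eu p2 p2 + eu p3 p3.
Proof.
apply/matrixP => i j; rewrite !mxE /=.
set m := (n - 3)%N; have sd : size (drop m (pth i)) = 3 by rewrite size_drop pth_size /m; lia.
have ad := adm_drop m (pth_adm i).
have ij : (i == j) = (drop m (pth i) == drop m (pth j)) && (take m (pth i) == take m (pth j)).
  apply/eqP/andP => [->//|[/eqP e1 /eqP e2]]; apply: pth_inj.
  by rewrite -(cat_take_drop m (pth i)) e1 e2 cat_take_drop.
rewrite ij; case: (size3_adm sd ad) => ->; rewrite !eqxx /=.
- by rewrite ![_ == p1]eq_sym addr0 addr0.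
- by rewrite ![_ == p2]eq_sym add0r addr0.
- by rewrite ![_ == p3]eq_sym add0r add0r.
Qed.

Local Notation S1 := (Sk (n - 3 + 1)).
Local Notation S2 := (Sk (n - 3 + 0)).

Let GS1 : Gr S1. Proof. by apply: Gr_Sk. Qed.
Let GS2 : Gr S2. Proof. by apply: Gr_Sk. Qed.

Let S1p1 t : S1 *m eu p1 t = - eu p1 t.
Proof.
rewrite (@Sk_eu R b r n r5 1 p1) // /Ac /Bc /= (ac_0 R r5) (bc_0 R r5) rmorph0 mulr0 scale0r addr0.
by rewrite rmorph1 mulr1 opprD addrCA subrr addr0 scaleN1r.
Qed.

Let S1p2 t : S1 *m eu p2 t = q *: eu p2 t.
Proof.
rewrite (@Sk_eu R b r n r5 1 p2) // /Ac /Bc /= rmorph0 !mulr0 scale0r addr0.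
by rewrite subr0.
Qed.

Let S1p3 t : S1 *m eu p3 t = q *: eu p3 t.
Proof.
rewrite (@Sk_eu R b r n r5 1 p3) // /Ac /Bc /= rmorph0 !mulr0 scale0r addr0.
by rewrite subr0.
Qed.

(** Odd powers keep the eigenvalue -1 on the path [p1], which returns to height 0 after two steps;
    the others become q^k. *)
Lemma S1X k : odd k -> S1 ^+ k = (q ^+ k) *: 1%:M - (1 + q ^+ k) *: eu p1 p1.
Proof.
move=> ok.
have hX s z : S1 *m eu s s = z *: eu s s -> S1 ^+ k *m eu s s = z ^+ k *: eu s s.
  move=> h; elim: (k) => [|j IH]; first by rewrite !expr0 scale1r [LHS]mul1mx.
  rewrite exprS -[_ * _]/(S1 *m S1 ^+ j) -mulmxA IH -scalemxAr h scalerA.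
  by rewrite exprSr.
rewrite -[LHS]mulmx1 {1}one_split3 !mulmxDr (hX p1 (-1)) ?S1p1 ?scaleN1r //.
rewrite (hX _ _ (S1p2 p2)) (hX _ _ (S1p3 p3)) one_split3 -signr_odd ok expr1.
move: (eu p1 p1) (eu p2 p2) (eu p3 p3) => x y z.
by apply/matrixP => i j; rewrite !mxE; ring.
Qed.

Lemma L_offdiag3 : ~ r = 6%N -> ~ r = 10%N -> L (eu p1 p2).
Proof.
move=> r6 r10; have [k [ok k1 k2 k3]] := middle_third_odd r5 r6 r10.
have MU : matrix_units (eu p1 p1) (eu p1 p2) (eu p2 p1) (eu p2 p2).
  have e := @eu_mulN R r n 3 1.
  by split; split; by [apply: e | apply: eu_mul0].
have rho1 : q ^+ k * (q ^+ k)^*%C = 1.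
  by rewrite rmorphXn -exprMn qq_unit expr1n.
have mu01 := qX_norm_lt1 R r5 k1 k2 k3; have muE := qX_normD1 R b r k.
set mu := _ ^+ 2 in mu01 muE.
have kapmu : - (1 + q ^+ k) * (- (1 + q ^+ k))^*%C = mu%:C%C by rewrite rmorphN mulrNN.
have rhokap : q ^+ k * (- (1 + q ^+ k))^*%C + (q ^+ k)^*%C * (- (1 + q ^+ k)) = - mu%:C%C.
  rewrite -muE rmorphN !rmorphD rmorph1; set y := (q ^+ k)^*%C in rho1 *.
  set z := q ^+ k in rho1 *.
  transitivity (- ((1 + z) * (1 + y)) + (1 - z * y)); first ring.
  by rewrite rho1 subrr addr0.
have RkE : S1 ^+ k = q ^+ k *: 1%:M + (- (1 + q ^+ k)) *: eu p1 p1.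
  by rewrite S1X // scaleNr.
have GX : Gr (S1 ^+ k).
  by elim: (k) => [|j Gj]; rewrite ?expr0 ?exprS; [exact: (ug1 GG)|exact: (ugM GG)].
have d1 : 1 - ac R r 1 = (qn R r 2 ^+ 2)^-1.
  by rewrite (ac1 R r5) ?(qn1 R r5) ?div1r ?expr2 //; lia.
have qn2 := qn2_gt0 R r5.
have q2 := qq_normD1 R b r5.
have a01 : 0 < ac R r 1 < 1.
  apply/andP; split; last first.
    by rewrite -subr_gt0 d1 invr_gt0 exprn_gt0.
  have q3 : (0 < 3 < r)%N by clear -r5; lia.
  by apply: divr_gt0; [exact: qn_gt0 | apply: mulr_gt0].
have bc2 : bc R r 1 ^+ 2 = ac R r 1 * (1 - ac R r 1) by apply: (bc_sqr R r5); clear -r5; lia.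
have xE : qn R r 2 ^+ 2 * (ac R r 1 * (1 - ac R r 1)) = ac R r 1.
  by rewrite d1 mulrCA mulfV ?mulr1 // expf_neq0 // gt_eqF.
have init : exists x al be Y, refl_state Gr (eu p1 p1) (eu p1 p2) (eu p2 p1) (eu p2 p2) x al be Y.
  have [n1' n2'] := refl_column_norm (qq_unit R b r) q2 xE bc2.
  exists (ac R r 1), (Ac R b r p1), (Bc R b r p1), S2.
  split; [exact: GS2 | | exact: n1' | exact: n2' | exact: a01].
  have -> := @Sk_eu R b r n r5 0 p1 p1 n3.
  have -> : flipk 0 p1 = p2 by [].
  by rewrite drop0 /mk2 !scale0r !addr0.
have a11 : (eu p1 p1)^H = eu p1 p1 by rewrite eu_adj.
have a12 : (eu p1 p2)^H = eu p2 p1 by rewrite eu_adj.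
have a21 : (eu p2 p1)^H = eu p1 p2 by rewrite eu_adj.
have a22 : (eu p2 p2)^H = eu p2 p2 by rewrite eu_adj.
have [w w0 tX] := tang_offdiag GG MU a11 a12 a21 a22 GX RkE rho1 kapmu rhokap mu01 init.
move: tX; rewrite /mk2 !scale0r addr0 add0r.
set c1 := - _; set c2 := _ * w => /(ctangT GG) LX.
have c10 : c1 != 0.
  rewrite /c1 oppr_eq0 !mulf_neq0 ?conjc_eq0 //.
    by apply/eqP => h; move: kapmu; rewrite h mul0r => /complexI e; move: mu01; rewrite -e ltxx.
  by apply/eqP => h; move: rho1; rewrite h mul0r => /eqP; rewrite eq_sym oner_eq0.
(* Conjugation by S1 multiplies e_{p1,p2} by - q^* and e_{p2,p1} by - q. Adding q times the original
   vector cancels the second unit, and q - q^* is not 0. *)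
have LY := ctang_conj GG GS1 LX.
have SX : S1 *m (c1 *: eu p1 p2 + c2 *: eu p2 p1) *m S1^H =
    - (q^*%C) *: (c1 *: eu p1 p2) - q *: (c2 *: eu p2 p1).
  have R1 s : s = p1 \/ s = p2 -> eu s p1 *m S1^H = - eu s p1.
    by case=> ->; rewrite -[LHS]adjK adjM adjK eu_adj // S1p1 adjN eu_adj.
  have R2 s : s = p1 \/ s = p2 -> eu s p2 *m S1^H = q^*%C *: eu s p2.
    by case=> ->; rewrite -[LHS]adjK adjM adjK eu_adj // S1p2 adjZ eu_adj.
  rewrite mulmxDr -!scalemxAr S1p1 S1p2 mulmxDl -!scalemxAl mulNmx R1; last by right.
  rewrite R2; last by left.
  move: (eu p1 p2) (eu p2 p1) (q^*%C) => u v z.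
  by apply/matrixP => i j; rewrite !mxE; ring.
have := ctangD GG (ctangZ GG q LX) LY; rewrite SX.
have -> : q *: (c1 *: eu p1 p2 + c2 *: eu p2 p1) +
    (- (q^*%C) *: (c1 *: eu p1 p2) - q *: (c2 *: eu p2 p1)) = ((q - q^*%C) * c1) *: eu p1 p2.
  move: (eu p1 p2) (eu p2 p1) (q^*%C) => u v z.
  by apply/matrixP => i j; rewrite !mxE; ring.
move=> /(L_scale r5); apply.
by apply: mulf_neq0 => //; apply: qq_neqJ.
Qed.

Lemma good3 l : ~ r = 6%N -> ~ r = 10%N -> good 3 l.
Proof.
move=> r6 r10 s t /nodeP[s1 s2 s3] /nodeP[t1 t2 t3] st.
have h := L_offdiag3 r6 r10.
have h' : L (eu p2 p1) by apply: (L_adj r5) => //; rewrite ?eu_adj.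
rewrite -s3 in t3; move: st t3.
by case: (size3_adm s1 s2) => ->; case: (size3_adm t1 t2) => ->.
Qed.

End Base3Lie.

(** With A = sigma_2 and B = sigma_3 this is a column of sigma_2 sigma_3^2 sigma_2 on the three
    paths to height 2; [conj_column2] does the same for the two paths to height 0. *)
Lemma conj_column3 (F : comPzRingType) N (A B u v w : 'M[F]_N) (q t1 t1' s1 t2 t2' s2 : F) :
  A *m u = t1 *: u + s1 *: v -> A *m v = t1' *: v + s1 *: u -> A *m w = q *: w ->
  B *m u = q *: u -> B *m v = t2 *: v + s2 *: w -> B *m w = t2' *: w + s2 *: v ->
  A *m (B *m (B *m (A *m u))) =
    (q ^+ 2 * t1 ^+ 2 + s1 ^+ 2 * (t2 ^+ 2 + s2 ^+ 2)) *: u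
    + (s1 * (q ^+ 2 * t1 + t1' * (t2 ^+ 2 + s2 ^+ 2))) *: v
    + (q * (t2 + t2') * s1 * s2) *: w.
Proof.
move=> Au Av Aw Bu Bv Bw.
rewrite Au !(mulmxDr, =^~ scalemxAr) Bu Bv !(mulmxDr, =^~ scalemxAr) Bu Bv Bw.
rewrite !(mulmxDr, =^~ scalemxAr) Au Av Aw.
by apply/matrixP => i j; rewrite !mxE; ring.
Qed.

Lemma conj_column2 (F : comPzRingType) N (A B u v : 'M[F]_N) (q t1 t1' s1 : F) :
  A *m u = t1 *: u + s1 *: v -> A *m v = t1' *: v + s1 *: u ->
  B *m u = - u -> B *m v = q *: v ->
  A *m (B *m (B *m (A *m u))) =
    (t1 ^+ 2 + q ^+ 2 * s1 ^+ 2) *: u + (t1 * s1 + q ^+ 2 * s1 * t1') *: v.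
Proof.
move=> Au Av Bu Bv.
rewrite Au !(mulmxDr, =^~ scalemxAr) Bu Bv !(mulmxN, mulmxDr, =^~ scalemxAr) Bu Bv.
rewrite !(mulmxDr, mulmxN, =^~ scalemxAr) Au Av.
by apply/matrixP => i j; rewrite !mxE; ring.
Qed.

Lemma unit_power (R : realType) (x : R[i]) k : x * x^*%C = 1 -> x ^+ k * (x ^+ k)^*%C = 1.
Proof.
move=> h; elim: k => [|k IH]; first by rewrite expr0 rmorph1 mulr1.
by rewrite exprS rmorphM mulrACA h IH mulr1.
Qed.

Lemma refl_product (R : realType) N (P Y : 'M[R[i]]_N) (al : R[i]) :
  P^H = P -> P *m P = P -> P *m Y *m P = al *: P ->
  P *m (Y *m P *m Y^H) = al *: (Y *m P)^H.
Proof.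
move=> PH PP PYP; rewrite !mulmxA PYP adjM PH -scalemxAl.
by [].
Qed.

Lemma compress_conj (F : comPzRingType) N (P S g K : 'M[F]_N) (t : F) :
  P *m g = g -> P *m S *m P = t *: P -> P *m (S *m g *m K) = t *: (g *m K).
Proof. by move=> Pg PSP; rewrite -{1}Pg !mulmxA PSP -!scalemxAl Pg. Qed.

Lemma adj_comb3 (R : realType) N (u v w : 'M[R[i]]_N) (c d e : R[i]) :
  (c *: u + d *: v + e *: w)^H = c^*%C *: u^H + d^*%C *: v^H + e^*%C *: w^H.
Proof. by rewrite !adjD !adjZ. Qed.

(** Conjugating by S2 and cutting down to the row of P with [offdiag_row] multiplies u2 by d2 and u3
    by q^*, up to the common factor t1. These factors differ, so the two units can be separated. *)
Lemma row_extract (R : realType) N (G : 'M[R[i]]_N -> Prop) (GG : unitary_group G)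
    (q : R[i]) (S P P0 S2 u2 u3 : 'M[R[i]]_N) (t1 d1 d2 a c : R[i]) :
  G S -> S = q *: 1%:M - (1 + q) *: (P + P0) -> q * q^*%C = 1 ->
  P *m P = P -> P^H = P -> P0^H = P0 -> P *m P0 = 0 -> P0 *m P = 0 ->
  1 + q != 0 -> q - q^*%C != 0 ->
  G S2 -> P *m S2 *m P = t1 *: P -> P0 *m S2 *m P = 0 ->
  P *m u2 = u2 -> P *m u3 = u3 -> u2 *m P = 0 -> u3 *m P = 0 ->
  u2 *m P0 = 0 -> u3 *m P0 = 0 ->
  u2 *m S2^H = d2 *: u2 + d1 *: P -> u3 *m S2^H = q^*%C *: u3 ->
  t1 != 0 -> a != 0 -> c != 0 -> d2 - q^*%C != 0 ->
  ctang G (a *: u2 + c *: u3) -> ctang G u2 /\ ctang G u3.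
Proof.
move=> GS SE qu PP PH P0H PP0 P0P q1 qJ GS2 PSP PSP0 Pu2 Pu3 u2P u3P u2P0 u3P0 u2S u3S
  t0 a0 c0 d0 Lg; set g := _ + _ in Lg.
have scale (x : R[i]) M : x != 0 -> ctang G (x *: M) -> ctang G M.
  by move=> x0 /(ctangZ GG x^-1); rewrite scalerA mulVf // scale1r.
have Pg : P *m g = g by rewrite /g mulmxDr -!scalemxAr Pu2 Pu3.
have gS : g *m S2^H = (a * d2) *: u2 + (a * d1) *: P + (c * q^*%C) *: u3.
  by rewrite /g mulmxDl -!scalemxAl u2S u3S scalerDr !scalerA.
have LX := ctang_conj GG GS2 Lg.
have P0X : P0 *m (S2 *m g *m S2^H) = 0.
  by rewrite -Pg !mulmxA PSP0 !mul0mx.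
have XP0 : (S2 *m g *m S2^H) *m P0 = 0.
  rewrite -!mulmxA (mulmxA g) gS !mulmxDl -!scalemxAl u2P0 u3P0 PP0.
  by rewrite !scaler0 !addr0 mulmx0.
have := offdiag_row GG GS SE qu PP PH P0H PP0 P0P q1 qJ P0X XP0 LX.
rewrite (compress_conj _ Pg PSP) gS -scalemxAl !mulmxDl -!scalemxAl u2P u3P PP.
rewrite !scaler0 addr0 add0r => Lh.
have L2 : ctang G u2.
  apply: (scale (a * (d2 - q^*%C))); first by rewrite mulf_neq0.
  have := ctangB GG (ctangZ GG t1^-1 Lh) (ctangZ GG q^*%C Lg); congr (ctang _ _).
  rewrite /g; move: q^*%C => z.
  by apply/matrixP => i j; rewrite !mxE; field.
split=> //; apply: (scale c) => //; rewrite -[c *: u3](addKr (a *: u2)) addrC.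
by apply: (ctangB GG Lg); apply: (ctangZ GG).
Qed.

Lemma conj_sub_neq0 (R : realType) (x y : R[i]) : x - y != 0 -> x^*%C - y^*%C != 0.
Proof. by rewrite -rmorphB conjc_eq0. Qed.

(** * The height 2 block of four strands for r = 10 *)

Section Level10.
Variables (R : realType) (b : bool).
Local Notation C := R[i].
Local Notation r := 10%N.
Local Notation q := (qq R b r).
Local Notation z := (q^*%C).
Definition ten_y : R := 2 * cos (2 * (pi / r%:R)).
Local Notation y := ten_y.
Let r5 : (5 <= r)%N := isT.

Let qz : q * z = 1 := qq_unit R b r.

Let qy : q + z = y%:C%C.
Proof. by rewrite qqE cisJD. Qed.

Let q5 : q ^+ 5 = -1.
Proof.
rewrite qqE cisX; have -> : 5%:R * (2 * (pi / r%:R)) = pi :> R by field.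
rewrite /cis cospi sinpi mulr0; apply/eqP; rewrite eq_complex /=; apply/andP; split; apply/eqP; ring.
Qed.

(** The cyclotomic equation of the primitive tenth roots of unity. The explicit identities below are
    reduced with it and with q q^* = 1. *)
Lemma ten_cyclo : q ^+ 4 - q ^+ 3 + q ^+ 2 - q + 1 = 0.
Proof.
apply: (mulfI (qq_neqN1 R b r5)); rewrite mulr0.
transitivity (q ^+ 5 + 1); first ring.
by rewrite q5 addNr.
Qed.

Lemma ten_golden : y ^+ 2 = y + 1.
Proof.
apply: complexI; transitivity ((q + z) ^+ 2); first by rewrite qy -rmorphXn.
transitivity (q + z + 1); last by rewrite qy -(rmorph1 (real_complex R)) -rmorphD.
apply/eqP; rewrite -subr_eq0; apply/eqP.
transitivity (z ^+ 2 * (q ^+ 4 - q ^+ 3 + q ^+ 2 - q + 1)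
  + (1 - (q * z) ^+ 2) * (q ^+ 2 - q) - (1 - q * z) ^+ 2 - z * (1 - q * z)); first ring.
by rewrite ten_cyclo qz; ring.
Qed.

Lemma ten_y1 : 1 < y.
Proof.
have h0 : 0 < y.
  rewrite /ten_y mulr_gt0 //; apply: cos_gt0_pihalf; have := pi_gt0 R => h.
  by apply/andP; split; lra.
have := ten_golden; nra.
Qed.

Lemma ten_normD1 : (1 + q) * (1 + q)^*%C = (2 + y)%:C%C.
Proof.
have -> : (2 + y)%:C%C = 2 + (q + z) :> C by rewrite qy rmorphD rmorph_nat.
rewrite rmorphD rmorph1; transitivity (1 + q * z + (q + z)); first ring.
by rewrite qz.
Qed.

Lemma ten_qn2 : qn R r 2 ^+ 2 = 2 + y.
Proof. by apply: complexI; rewrite -(qq_normD1 R b r5) ten_normD1. Qed.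

Lemma ten_qn3 : qn R r 3 = 1 + y.
Proof. by have := qn_rec R r5 1; rewrite (qn1 R r5) -expr2 ten_qn2; lra. Qed.

Lemma ten_ac1 : 1 - ac R r 1 = (2 + y)^-1.
Proof. by rewrite (ac1 R r5) // (qn1 R r5) -expr2 ten_qn2 div1r. Qed.

Lemma ten_ac2 : ac R r 2 = y - 1.
Proof.
have h2 := qn2_gt0 R r5; have y1 := ten_y1.
have h4 : qn R r 4 = qn R r 2 * y.
  have := qn_rec R r5 2; rewrite ten_qn3; move: (qn R r 4) (qn R r 2) => u v; lra.
have y2 := ten_golden; rewrite /ac h4 ten_qn3.
have y0 : 1 + y != 0 by rewrite gt_eqF //; lra.
apply: (mulIf y0); transitivity (y ^+ 2 - 1); last ring.
rewrite y2; transitivity y; last ring.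
by field; rewrite y0 gt_eqF.
Qed.

Variable n : nat.
Hypothesis n5 : (5 <= n)%N.
Let n4 : (4 <= n)%N. Proof. exact: ltnW. Qed.
Local Notation Sk := (@Sk R b r n).
Local Notation eu := (@eu R r n).
Local Notation Gr := (@Gr R b r n).
Local Notation L := (ctang Gr).
Local Notation good := (@good R b r n).
Local Notation node := (node r).
Local Notation GG := (@Gr_group R b r n r5).
Local Notation p1 := [:: true; true; false; true].
Local Notation p2 := [:: true; false; true; true].
Local Notation p3 := [:: false; true; true; true].
Local Notation o1 := [:: false; true; false; true].
Local Notation o2 := [:: false; false; true; true].
Local Notation S1 := (Sk (n - 4 + 2)).
Local Notation S2 := (Sk (n - 4 + 1)).
Local Notation S3 := (Sk (n - 4 + 0)).

(** The entries of sigma_2 on the pair [p1], [p2] are t1, t1' and s1; those of sigma_3 on the pair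
    [p2], [p3] are t2, t2' and s2. *)
Definition t1 : C := Ac R b r [:: true; false; true].
Definition t1' : C := Ac R b r [:: false; true; true].
Definition s1 : C := Bc R b r [:: true; false; true].
Definition t2 : C := Ac R b r p2.
Definition t2' : C := Ac R b r p3.
Definition s2 : C := Bc R b r p2.

Let S2p1 t : S2 *m eu p1 t = t1 *: eu p1 t + s1 *: eu p2 t.
Proof. exact: (@Sk_eu R b r n r5 1 p1 t n4). Qed.

Let S2p2 t : S2 *m eu p2 t = t1' *: eu p2 t + s1 *: eu p1 t.
Proof. exact: (@Sk_eu R b r n r5 1 p2 t n4). Qed.

Let S2p3 t : S2 *m eu p3 t = q *: eu p3 t.
Proof.
have := @Sk_eu R b r n r5 1 p3 t n4.
by rewrite /= AcTT BcTT scale0r addr0.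
Qed.

Let S2o1 t : S2 *m eu o1 t = t1 *: eu o1 t + s1 *: eu o2 t.
Proof. exact: (@Sk_eu R b r n r5 1 o1 t n4). Qed.

Let S2o2 t : S2 *m eu o2 t = t1' *: eu o2 t + s1 *: eu o1 t.
Proof. exact: (@Sk_eu R b r n r5 1 o2 t n4). Qed.

Let S3p1 t : S3 *m eu p1 t = q *: eu p1 t.
Proof.
have := @Sk_eu R b r n r5 0 p1 t n4.
by rewrite drop0 AcTT BcTT scale0r addr0.
Qed.

Let S3p2 t : S3 *m eu p2 t = t2 *: eu p2 t + s2 *: eu p3 t.
Proof. exact: (@Sk_eu R b r n r5 0 p2 t n4). Qed.

Let S3p3 t : S3 *m eu p3 t = t2' *: eu p3 t + s2 *: eu p2 t.
Proof. exact: (@Sk_eu R b r n r5 0 p3 t n4). Qed.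

Let S3o1 t : S3 *m eu o1 t = - eu o1 t.
Proof.
have := @Sk_eu R b r n r5 0 o1 t n4; rewrite drop0 => ->.
have -> : Ac R b r o1 = -1.
  by rewrite /Ac /dco (ac_0 R r5) rmorph1 mulr1 opprD addrCA subrr addr0.
have -> : Bc R b r o1 = 0 by rewrite /Bc /bco (bc_0 R r5) rmorph0 mulr0.
by rewrite scaleN1r scale0r addr0.
Qed.

Let S3o2 t : S3 *m eu o2 t = q *: eu o2 t.
Proof.
have := @Sk_eu R b r n r5 0 o2 t n4.
by rewrite drop0 AcTT BcTT scale0r addr0.
Qed.

Lemma ten_t1 : t1 * (1 + q) = q ^+ 2.
Proof.
have h : (1 - ac R r 1)%:C%C * ((1 + q) * (1 + z)) = 1 :> C.
  have zE : (1 + q)^*%C = 1 + z by rewrite rmorphD rmorph1.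
  rewrite -zE ten_normD1 ten_ac1 -rmorphM mulVf ?rmorph1 // gt_eqF //.
  by have := ten_y1; lra.
have e : t1 = q - (1 + q) * (1 - ac R r 1)%:C%C by [].
transitivity (q * (q * z) + q ^+ 2 - (q * ((1 - ac R r 1)%:C%C * ((1 + q) * (1 + z))))
   + ((1 - ac R r 1)%:C%C * (1 + q)) * (q * z - 1) + q * (1 - q * z)).
  by rewrite e; ring.
by rewrite h qz; ring.
Qed.

Lemma ten_t1' : t1' * (1 + q) = -1.
Proof.
have [h _] := @Ac_pair R b r r5 [:: true] isT; rewrite -/t1 -/t1' in h.
have -> : t1' = q - 1 - t1 by rewrite -h; ring.
by rewrite mulrBl ten_t1; ring.
Qed.

Lemma ten_s1 : s1 ^+ 2 = t1 * t1' + q.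
Proof.
have [_ h] := @Ac_pair R b r r5 [:: true] isT.
by rewrite -/t1 -/t1' -/s1 in h; rewrite -[q]opprK -h; ring.
Qed.

(** Here t2^2 + s2^2 is the diagonal entry of sigma_3^2 at [p2]. *)
Lemma ten_m : q * (t2 ^+ 2 + s2 ^+ 2) = - (q - 1) * (q - 2).
Proof.
have [h h'] := @Ac_pair R b r r5 [:: true; true] isT; rewrite -/t2 -/t2' -/s2 in h h'.
have hs : s2 ^+ 2 = t2 * t2' + q by rewrite -[q in RHS]opprK -h'; ring.
have ht : t2 = q - (1 + q) * (2 - q - z).
  rewrite /t2 /Ac /dco ten_ac2; congr (_ - _ * _).
  have -> : 1 - (y - 1) = 2 - y :> R by ring.
  transitivity (2 - (q + z)); first by rewrite qy rmorphB rmorph_nat.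
  by rewrite opprD addrA.
have ht' : t2' = q - 1 - t2 by rewrite -h; ring.
rewrite hs ht'; transitivity (q * (t2 * (q - 1) + q)); first ring.
have -> : t2 * (q - 1) + q = q ^+ 3 - q ^+ 2 + 2 - z + (q * z - 1) * q.
  by rewrite ht; ring.
rewrite qz subrr mul0r addr0.
transitivity (q ^+ 4 - q ^+ 3 + q ^+ 2 - q + 1 - q ^+ 2 + 3 * q - 1 - q * z); first ring.
by rewrite ten_cyclo qz; ring.
Qed.

Let q1 : 1 + q != 0 := qq_neqN1 R b r5.

Let y2lt : y < 2 := golden_lt2 ten_golden ten_y1.

Let two_y_neq0 : (2 - y)%:C%C != 0 :> C.
Proof. by apply/eqP => /complexI h; have := y2lt; rewrite -subr_gt0 h ltxx. Qed.

Let qB1 : (q - 1) * (q - 1)^*%C = (2 - y)%:C%C.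
Proof.
have -> : (2 - y)%:C%C = 2 - (q + z) :> C by rewrite qy rmorphB rmorph_nat.
rewrite rmorphB rmorph1; transitivity (q * z + 1 - (q + z)); first ring.
by rewrite qz.
Qed.

Let qN1 : q - 1 != 0.
Proof. by apply: contra two_y_neq0 => /eqP h; rewrite -qB1 h mul0r. Qed.

Let q0 : q != 0.
Proof. by apply/eqP => h; have /eqP := qz; rewrite h mul0r eq_sym oner_eq0. Qed.

Let s1_neq0 : s1 != 0.
Proof. by have [] := @Bc_neq0 R b r r5 1 [:: true] isT isT erefl. Qed.

Let s2_neq0 : s2 != 0.
Proof. by have [] := @Bc_neq0 R b r r5 2 [:: true; true] isT isT erefl. Qed.

Let mm : C := t2 ^+ 2 + s2 ^+ 2.

Let mE : mm = q ^+ 3 - q ^+ 2 + 2 - z.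
Proof.
apply: (mulfI q0); rewrite ten_m.
transitivity (q ^+ 4 - q ^+ 3 + q ^+ 2 - q + 1 - (q - 1) * (q - 2) - (q ^+ 4 - q ^+ 3 + q ^+ 2 - q + 1)); first ring.
rewrite ten_cyclo; transitivity (q ^+ 4 - q ^+ 3 + q ^+ 2 - q + 1 + (- q ^+ 2 + 3 * q - 2)); last first.
  by transitivity (q ^+ 4 - q ^+ 3 + 2 * q - 1); [ring | rewrite -qz; ring].
by rewrite ten_cyclo; ring.
Qed.

Let s1E : s1 ^+ 2 * (1 + q) ^+ 2 = q + q ^+ 2 + q ^+ 3.
Proof.
rewrite ten_s1; transitivity ((t1 * (1 + q)) * (t1' * (1 + q)) + q * (1 + q) ^+ 2); first ring.
by rewrite ten_t1 ten_t1'; ring.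
Qed.

(** The coordinates w1, w2, w3 of the image of [p1] under sigma_2 sigma_3^2 sigma_2, as given by
    [conj_column3]. *)
Definition w1 : C := q ^+ 2 * t1 ^+ 2 + s1 ^+ 2 * mm.
Definition w2 : C := s1 * (q ^+ 2 * t1 + t1' * mm).
Definition w3 : C := q * (q - 1) * s1 * s2.

Lemma ten_w1 : w1 = q - 1.
Proof.
apply: (mulIf (x := (1 + q) ^+ 2)); first by rewrite expf_neq0.
transitivity (q ^+ 2 * (t1 * (1 + q)) ^+ 2 + (s1 ^+ 2 * (1 + q) ^+ 2) * mm).
  by rewrite /w1; ring.
rewrite ten_t1 s1E; transitivity (q ^+ 6 + (1 + q + q ^+ 2) * (q * mm)); first ring.
rewrite ten_m.
transitivity ((q - 1) * (1 + q) ^+ 2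
   + (q ^+ 2 + q - 1) * (q ^+ 4 - q ^+ 3 + q ^+ 2 - q + 1)); last by rewrite ten_cyclo; ring.
ring.
Qed.

Lemma ten_w2 : w2 != 0.
Proof.
rewrite mulf_neq0 //; apply/eqP => h.
have : (q ^+ 2 * t1 + t1' * mm) * (1 + q) = (y - 3)%:C%C.
  transitivity (q ^+ 2 * (t1 * (1 + q)) + (t1' * (1 + q)) * mm); first ring.
  rewrite ten_t1 ten_t1' mE.
  have -> : (y - 3)%:C%C = (q + z) - 3 :> C by rewrite qy rmorphB rmorph_nat.
  transitivity (q + z - 3 + (q ^+ 4 - q ^+ 3 + q ^+ 2 - q + 1)); first ring.
  by rewrite ten_cyclo addr0.
rewrite h mul0r => /esym/complexI h3; have := y2lt; lra.
Qed.

Lemma ten_w3 : w3 != 0.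
Proof. exact: mulf_neq0 (mulf_neq0 (mulf_neq0 q0 qN1) s1_neq0) s2_neq0. Qed.

Lemma ten_t1'_neq : t1' - q != 0.
Proof.
apply/eqP => h; have : (t1' - q) * (1 + q) * z = - (1 + y)%:C%C.
  have -> : (1 + y)%:C%C = 1 + (q + z) :> C by rewrite qy rmorphD rmorph1.
  rewrite mulrBl ten_t1'; transitivity (- z - q * z - q * (q * z)); first ring.
  by rewrite qz; ring.
rewrite h !mul0r => /eqP; rewrite eq_sym oppr_eq0 => /eqP/complexI h3.
by have := ten_y1; lra.
Qed.

Local Notation Y := (S2 *m (S3 *m (S3 *m S2))).

Let Yp1 t : Y *m eu p1 t = w1 *: eu p1 t + w2 *: eu p2 t + w3 *: eu p3 t.
Proof.
have [h _] := @Ac_pair R b r r5 [:: true; true] isT; rewrite -/t2 -/t2' in h.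
have := conj_column3 (S2p1 t) (S2p2 t) (S2p3 t) (S3p1 t) (S3p2 t) (S3p3 t).
by rewrite h; rewrite -!mulmxA.
Qed.

Let Yo1 t : Y *m eu o1 t = (q ^+ 3) *: eu o1 t.
Proof.
have h1 : t1 ^+ 2 + q ^+ 2 * s1 ^+ 2 = q ^+ 3.
  apply: (mulIf (x := (1 + q) ^+ 2)); first by rewrite expf_neq0.
  transitivity ((t1 * (1 + q)) ^+ 2 + q ^+ 2 * (s1 ^+ 2 * (1 + q) ^+ 2)); first ring.
  by rewrite ten_t1 s1E; ring.
have h2 : t1 * s1 + q ^+ 2 * s1 * t1' = 0.
  apply: (mulIf (x := 1 + q)) => //.
  transitivity (s1 * (t1 * (1 + q)) + q ^+ 2 * s1 * (t1' * (1 + q))); first ring.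
  by rewrite ten_t1 ten_t1'; ring.
have := conj_column2 (S2o1 t) (S2o2 t) (S3o1 t) (S3o2 t).
by rewrite h1 h2 scale0r addr0 -!mulmxA.
Qed.

Let nd1 : node 4 2 p1. Proof. by []. Qed.
Let nd2 : node 4 2 p2. Proof. by []. Qed.
Let nd3 : node 4 2 p3. Proof. by []. Qed.
Let ndo : node 4 0 o1. Proof. by []. Qed.

Let e_mul := fun l s t u hs ht hu => @eu_mulN R r n 4 l s t u n4 hs ht hu.

Let GS1 : Gr S1. Proof. exact: Gr_Sk. Qed.
Let GS2 : Gr S2. Proof. exact: Gr_Sk. Qed.
Let GS3 : Gr S3. Proof. exact: Gr_Sk. Qed.

Let GY : Gr Y.
Proof. by do 3?apply: (ugM GG). Qed.

(** The path up, down, up extends to [p1] and to [o1], so the three-step projection of sigma_1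
    splits in two. *)
Let S1E : S1 = q *: 1%:M - (1 + q) *: (eu p1 p1 + eu o1 o1).
Proof.
have n3 : (3 <= n)%N by apply: ltnW.
have -> : S1 = Sk (n - 3 + 1) by congr Sk; clear -n4; lia.
transitivity (Sk (n - 3 + 1) ^+ 1); first by rewrite expr1.
apply: etrans (S1X R b r5 n3 (isT : odd 1)) _; congr (_ - _); congr (_ *: _).
exact: eu_split.
Qed.

#[local] Opaque t1 t1' s1 t2 t2' s2 w1 w2 w3.

Let PP11 : eu p1 p1 *m eu p1 p1 = eu p1 p1. Proof. exact: (e_mul nd1 nd1). Qed.
Let PP00 : eu o1 o1 *m eu o1 o1 = eu o1 o1. Proof. exact: (e_mul ndo ndo). Qed.
Let PP10 : eu p1 p1 *m eu o1 o1 = 0. Proof. exact: eu_mul0. Qed.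
Let PP01 : eu o1 o1 *m eu p1 p1 = 0. Proof. exact: eu_mul0. Qed.
Let PH11 : (eu p1 p1)^H = eu p1 p1. Proof. exact: eu_adj. Qed.
Let PH0 : (eu o1 o1)^H = eu o1 o1. Proof. exact: eu_adj. Qed.
Let PH21 : (eu p2 p1)^H = eu p1 p2. Proof. exact: eu_adj. Qed.
Let PH31 : (eu p3 p1)^H = eu p1 p3. Proof. exact: eu_adj. Qed.

Let PYP : eu p1 p1 *m Y *m eu p1 p1 = w1 *: eu p1 p1.
Proof.
apply: etrans (_ : eu p1 p1 *m (Y *m eu p1 p1) = _); first exact: esym (mulmxA _ _ _).
by rewrite Yp1 !mulmxDr -!scalemxAr PP11 !(eu_mul0 R r n (s := p1)) // !scaler0 !addr0.
Qed.

Let YP0 : Y *m eu o1 o1 *m Y^H = eu o1 o1.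
Proof.
have h : eu o1 o1 *m Y^H = (q ^+ 3)^*%C *: eu o1 o1.
  by rewrite -[LHS]adjK adjM adjK eu_adj // Yo1 adjZ eu_adj.
by rewrite Yo1 -scalemxAl h scalerA unit_power ?scale1r.
Qed.

Let g := w2^*%C *: eu p1 p2 + w3^*%C *: eu p1 p3.

Let w1_neq0 : w1 != 0. Proof. by rewrite ten_w1. Qed.

Let w1w1 : w1 * w1^*%C = (2 - y)%:C%C.
Proof. by rewrite ten_w1. Qed.

(** Up to the scalar w1, this is the first row of Y P Y^H without its diagonal entry, as supplied by
    [two_reflections]. *)
Let Lg : L g.
Proof.
have h := @two_reflections R (np r n) Gr GG q S1 (eu p1 p1) (eu o1 o1) GS1 S1E qz
  PP11 PH11 PH0 PP10 PP01 PP00 q1 (qq_neqJ R b r5) Y w1 y GY YP0 PYP w1w1 ten_normD1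
  ten_golden ten_y1.
apply: (L_scale r5 w1_neq0); move: h; congr (L _).
rewrite (refl_product PH11 PP11 PYP).
rewrite Yp1 adj_comb3 PH11 PH21 PH31 -w1w1 /g.
move: (eu p1 p1) (eu p1 p2) (eu p1 p3) => u v w.
by apply/matrixP => i j; rewrite !mxE; ring.
Qed.

Let t1_neq0 : t1 != 0.
Proof.
apply/eqP => h; have := ten_t1; rewrite h mul0r => /eqP.
by rewrite eq_sym expf_eq0 (negPf q0).
Qed.

Let P1e12 : eu p1 p1 *m eu p1 p2 = eu p1 p2. Proof. exact: (e_mul nd1 nd1). Qed.
Let P1e13 : eu p1 p1 *m eu p1 p3 = eu p1 p3. Proof. exact: (e_mul nd1 nd1). Qed.
Let e12P : eu p1 p2 *m eu p1 p1 = 0. Proof. exact: eu_mul0. Qed.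
Let e13P : eu p1 p3 *m eu p1 p1 = 0. Proof. exact: eu_mul0. Qed.
Let e12P0 : eu p1 p2 *m eu o1 o1 = 0. Proof. exact: eu_mul0. Qed.
Let e13P0 : eu p1 p3 *m eu o1 o1 = 0. Proof. exact: eu_mul0. Qed.
Let P0e21 : eu o1 o1 *m eu p2 p1 = 0. Proof. exact: eu_mul0. Qed.
Let P1e21 : eu p1 p1 *m eu p2 p1 = 0. Proof. exact: eu_mul0. Qed.

Let e12S2 : eu p1 p2 *m S2^H = t1'^*%C *: eu p1 p2 + s1^*%C *: eu p1 p1.
Proof. by rewrite -[LHS]adjK adjM adjK eu_adj // S2p2 adjD !adjZ !eu_adj. Qed.

Let e13S2 : eu p1 p3 *m S2^H = z *: eu p1 p3.
Proof. by rewrite -[LHS]adjK adjM adjK eu_adj // S2p3 adjZ eu_adj. Qed.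

Let PS2P : eu p1 p1 *m S2 *m eu p1 p1 = t1 *: eu p1 p1.
Proof.
apply: etrans (esym (mulmxA _ _ _)) _.
by rewrite S2p1 mulmxDr -!scalemxAr PP11 P1e21 scaler0 addr0.
Qed.

Let P0S2P : eu o1 o1 *m S2 *m eu p1 p1 = 0.
Proof.
apply: etrans (esym (mulmxA _ _ _)) _.
by rewrite S2p1 mulmxDr -!scalemxAr PP01 P0e21 !scaler0 addr0.
Qed.

Let Le12_13 : L (eu p1 p2) /\ L (eu p1 p3).
Proof.
have h1 : w2^*%C != 0 by rewrite conjc_eq0 ten_w2.
have h2 : w3^*%C != 0 by rewrite conjc_eq0 ten_w3.
have h3 := conj_sub_neq0 ten_t1'_neq.
exact: (row_extract GG GS1 S1E qz PP11 PH11 PH0 PP10 PP01 q1 (qq_neqJ R b r5) GS2 PS2P P0S2P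
  P1e12 P1e13 e12P e13P e12P0 e13P0 e12S2 e13S2 t1_neq0 h1 h2 h3 Lg).
Qed.

Let node42 s : node 4 2 s -> s \in [:: p1; p2; p3].
Proof. by case/nodeP; case: s => [|[] [|[] [|[] [|[] []]]]]. Qed.

Lemma good42 : good 4 2.
Proof.
have [e12 e13] := Le12_13.
have e21 : L (eu p2 p1) by apply: (L_adj r5).
have e31 : L (eu p3 p1) by apply: (L_adj r5).
have e23 : L (eu p2 p3) by apply: (@L_mul R b r n r5 4 2 p2 p1 p3).
have e32 : L (eu p3 p2) by apply: (@L_mul R b r n r5 4 2 p3 p1 p2).
move=> s t /node42 hs /node42 ht_; move: hs ht_; rewrite !inE.
by move=> /or3P[] /eqP -> /or3P[] /eqP ->.
Qed.
End Level10.

(** * From the height 2 units of four steps to five steps *)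

Section Five.
Variables (R : realType) (b : bool) (r n : nat).
Local Notation C := R[i].
Local Notation q := (qq R b r).
Hypothesis r5 : (5 <= r)%N.
Local Notation eu := (@eu R r n).
Local Notation Gr := (@Gr R b r n).
Local Notation L := (ctang Gr).
Local Notation good := (@good R b r n).
Local Notation node := (node r).
Local Notation GG := (@Gr_group R b r n r5).

(** D moves v, w and w' to other rows and kills v'; D' moves them back. Subtracting the double
    bracket therefore leaves only v'. *)
Lemma double_bracket N (v v' w w' D D' d1 d2 d3 : 'M[C]_N) (c A B c' A' B' : C) :
  D *m v = d1 -> D *m v' = 0 -> D *m w = d2 -> D *m w' = d3 ->
  v *m D = 0 -> v' *m D = 0 -> w *m D = 0 -> w' *m D = 0 ->
  D' *m d1 = v -> D' *m d2 = w -> D' *m d3 = w' ->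
  d1 *m D' = 0 -> d2 *m D' = 0 -> d3 *m D' = 0 ->
  let f := c *: (A *: v + B *: v') + c' *: (A' *: w + B' *: w') in
  let f1 := D *m f - f *m D in
  f - (D' *m f1 - f1 *m D') = (c * B) *: v'.
Proof.
move=> h1 h2 h3 h4 k1 k2 k3 k4 e1 e2 e3 i1 i2 i3 f f1.
have -> : f1 = (c * A) *: d1 + (c' * A') *: d2 + (c' * B') *: d3.
  rewrite /f1 /f !(mulmxDr, mulmxDl, =^~ scalemxAl, =^~ scalemxAr).
  rewrite h1 h2 h3 h4 k1 k2 k3 k4 !(scaler0, addr0, subr0).
  by rewrite !scalerDr !scalerA addrA.
rewrite !(mulmxDr, mulmxDl, =^~ scalemxAl, =^~ scalemxAr) e1 e2 e3 i1 i2 i3.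
rewrite !(scaler0, addr0, subr0) /f.
by apply/matrixP => i j; rewrite !mxE; ring.
Qed.

Hypotheses (r7 : (7 <= r)%N) (n5 : (5 <= n)%N) (g42 : good 4 2).
Local Notation x := [:: true; true; true].
Local Notation z1 := [:: true; false; true].
Local Notation z2 := [:: false; true; true].

Let r0 : (0 < r - 2)%N. Proof. by rewrite subn_gt0 (leq_trans _ r7). Qed.
Let r1 : (1 < r - 2)%N. Proof. by rewrite ltn_subRL (leq_trans _ r7). Qed.
Let r2 : (2 < r - 2)%N. Proof. by rewrite ltn_subRL (leq_trans _ r7). Qed.
Let r3 : (3 < r - 2)%N. Proof. by rewrite ltn_subRL (leq_trans _ r7). Qed.
Let r33 : (3 <= r - 3)%N. Proof. by rewrite leq_subRL // (leq_trans _ r7). Qed.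

Let nx : node 3 3 x.
Proof. by do 3?[apply: node_T]. Qed.

Let nz1 : node 3 1 z1.
Proof. by apply: node_T => //; apply: node_F; apply: node_T. Qed.

Let nz2 : node 3 1 z2.
Proof. by apply: node_F; do 2?[apply: node_T]. Qed.

Let node31 z : node 3 1 z -> z = z1 \/ z = z2.
Proof.
case/nodeP; case: z => [|[] [|[] [|[] [|? ?]]]] //; try by left. by right.
Qed.

(** [bridge_key] would need height 1 at five steps, which is not yet known. Instead, the lifts of
    the units between F x and T z' serve as D and D'; z' differs from z so that their products with
    the right ends of the units vanish. *)
Let Lbridge z z' : node 3 1 z -> node 3 1 z' -> z != z' ->
  L (eu [:: false, true & x] [:: true, true & z]).
Proof.
move=> nz nz' zz; have [h1 h2] := bridge r5 n5 nx nz g42.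
have ns : node 4 2 (false :: x) by exact: node_F.
have nu : node 4 2 (true :: z') := node_T nz' r1.
have sz := node_size nz; have sz' := node_size nz'.
have D1 := L_lift r5 (node_size nu) (node_size ns) n5 (g42 nu ns isT).
have D2 := L_lift r5 (node_size ns) (node_size nu) n5 (g42 ns nu isT).
have B0 : Bc R b r [:: true, false & x] != 0.
  by have [] := @Bc_neq0 R b r r5 3 x isT r33 erefl.
have nTF : node 5 3 [:: true, false & x] := node_T ns r2.
have nFF : node 5 1 [:: false, false & x] by apply: node_F.
have nTT t : node 3 1 t -> node 5 3 [:: true, true & t].
  by move=> nt; apply: (node_T _ r2); apply: (node_T nt r1).
have nFT t : node 3 1 t -> node 5 1 [:: false, true & t].
  by move=> nt; apply: node_F; apply: (node_T nt r1).
have ne c d e g : [:: c, d & z] != [:: e, g & z'].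
  by apply/eqP => -[_ _ h]; rewrite h eqxx in zz.
have ne1 c d e g t : node 3 1 t -> [:: c, d & t] != [:: e, g & x].
  by move=> nt; apply/eqP => -[_ _ h]; move: nt; rewrite h => /nodeP[].
have ne2 c d e g t : node 3 1 t -> [:: c, d & x] != [:: e, g & t].
  by move=> nt; rewrite eq_sym; apply: ne1.
have h3 := ctang_bracket GG D2 (ctang_bracket GG D1 h2).
have := ctangB GG h2 h3.
rewrite (@double_bracket _ _ _ _ _ _ _ (eu [:: true, true & z'] [:: true, true & z])
  (eu [:: false, true & z'] [:: false, true & z]) (eu [:: false, true & z'] [:: true, false & z])).
- apply: (L_scale r5); rewrite mulf_neq0 // conjc_eq0.
  by apply/eqP => h0; have := qq_unit R b r; rewrite h0 mul0r => /eqP; rewrite eq_sym oner_eq0.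
all: rewrite ?mulmxDl ?mulmxDr.
all: try (rewrite !eu_mul0 ?addr0 //= ?sz ?sz' //; by [apply: ne | apply: ne1 | apply: ne2]).
all: rewrite [in LHS]/=.
- by rewrite (eu_mulN R n5 (nTT _ nz') nTF) /= ?sz // eu_mul0 ?addr0 //= ?sz ?sz'.
- by rewrite eu_mul0 ?add0r //= ?sz ?sz' // (eu_mulN R n5 (nFT _ nz') nFF) /= ?sz.
- by rewrite eu_mul0 ?add0r //= ?sz ?sz' // (eu_mulN R n5 (nFT _ nz') nFF) /= ?sz.
- by rewrite (eu_mulN R n5 nTF (nTT _ nz')) /= ?sz // eu_mul0 ?addr0 //= ?sz ?sz'.
- by rewrite eu_mul0 ?add0r //= ?sz ?sz' // (eu_mulN R n5 nFF (nFT _ nz')) /= ?sz.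
- by rewrite eu_mul0 ?add0r //= ?sz ?sz' // (eu_mulN R n5 nFF (nFT _ nz')) /= ?sz.
Qed.

Let vac m l : (m < l.+2)%N -> good m l.
Proof. by move=> ml s t hs ht_ st; move: (node_gap r5 hs ht_ st); rewrite leqNgt ml. Qed.

Let g53 : good 5 3.
Proof.
have g4 : node 4 4 (true :: x) := node_T nx r3.
have k4 : node 4 2 (true :: z1) := node_T nz1 r1.
exact: (spread1 r5 n5 r2 g42 (vac _) g4 k4 (Lbridge nz1 nz2 isT)).
Qed.

Let g51 : good 5 1.
Proof.
have g4 : node 4 2 (false :: x) := node_F nx.
have k4 : node 4 0 (false :: z1) := node_F nz1.
apply: (spread r5 n5 r0 g42 g4 k4) => -[|[] z] nk; [by case/nodeP: nk | by case: (node_Tinv nk) | ].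
have nz := node_Finv nk.
have [h1 h2] := bridge r5 n5 nx nz g42.
have [z' nz' zz] : exists2 z', node 3 1 z' & z != z'.
  by have [->|->] := node31 nz; [exists z2 | exists z1].
have Lv' := Lbridge nz nz' zz.
have nTF : node 5 3 [:: true, false & x] := node_T g4 r2.
have nTT : node 5 3 [:: true, true & z] := node_T (node_T nz r1) r2.
have Lv : L (eu [:: true, false & x] [:: true, true & z]).
  exact: (g53 nTF nTT isT).
move: h1 h2 Lv Lv'; set v := eu _ _; set w := eu _ _; set v' := eu _ _; set w' := eu _ _.
move=> h1 h2 Lv Lv'.
have Lw : L w by rewrite -(addKr v w) addrC; apply: (ctangB GG).
have [_ _ hz] := nodeP _ _ _ _ nz.
have [_ B0] := @Bc_neq0 R b r r5 1 z isT (leq_trans (isT : 1 <= 3)%N r33) hz.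
have q0 : q != 0.
  by apply/eqP => h0; have := qq_unit R b r; rewrite h0 mul0r => /eqP; rewrite eq_sym oner_eq0.
have Lf : L (q *: ((Ac R b r [:: false, true & z])^*%C *: w + (Bc R b r [:: false, true & z])^*%C *: w')).
  rewrite -[X in L X](addKr (q^*%C *: (Ac R b r [:: true, false & x] *: v + Bc R b r [:: true, false & x] *: v'))) addrC.
  by apply: (ctangB GG) => //; apply: (ctangZ GG); apply: (ctangD GG); apply: (ctangZ GG).
have {}Lf := L_scale r5 q0 Lf.
apply: (L_scale r5 (c := (Bc R b r [:: false, true & z])^*%C)); first by rewrite conjc_eq0.
rewrite -[X in L X](addKr ((Ac R b r [:: false, true & z])^*%C *: w)) addrC.
by apply: (ctangB GG) => //; apply: (ctangZ GG).
Qed.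

Lemma good5_of_good42 l : good 5 l.
Proof.
move=> s t hs ht_ st; have := node_gap r5 hs ht_ st; have [_] := node_parity hs.
case: l hs ht_ => [|[|[|[|l]]]] // hs ht_ _ _; [exact: g51|exact: g53].
Qed.

End Five.

Lemma good_last (R : realType) (b : bool) (r n : nat) :
  ((5 <= r)%N /\ r <> 6%N /\ r <> 10%N /\ (3 <= n)%N) \/ (r = 10%N /\ (5 <= n)%N) ->
  forall l, @good R b r n n l.
Proof.
have climb m : (5 <= r)%N -> (3 <= m)%N -> (forall l, @good R b r n m l) ->
    forall k, (m + k <= n)%N -> forall l, @good R b r n (m + k)%N l.
  move=> r5 m3 gm; elim=> [|k IH] h l; first by rewrite addn0.
  move: h; rewrite addnS => h; apply: (step r5) => //; last exact: IH (ltnW h).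
  by rewrite (leq_trans m3) // leq_addr.
case=> [[r5 [r6 [r10 n3]]]|[r10 n5]] l.
  have := @climb 3%N r5 isT (fun k => @good3 R b r n r5 n3 k r6 r10) (n - 3)%N.
  by rewrite subnKC // => h; apply: h.
move: climb; rewrite r10 => climb.
have := @climb 5%N isT isT _ (n - 5)%N; rewrite subnKC // => h; apply: h => // k.
by apply: good5_of_good42 => //; apply: good42.
Qed.

(** * Density *)

Section Density.
Variables (R : realType) (b : bool) (r n : nat).
Local Notation C := R[i].
Hypothesis r5 : (5 <= r)%N.
Local Notation J lam := (@Jm R r n lam).
Local Notation Gr := (@Gr R b r n).
Local Notation L := (ctang Gr).
Local Notation GG := (@Gr_group R b r n r5).
Local Notation good := (@good R b r n).
Hypothesis gd : forall l, good n l.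

(** Brackets of opposite units give the differences e_{x,x} - e_{x0,x0}. Writing Y in these and the
    off-diagonal units costs a multiple tr Y of e_{x0,x0}. *)
Lemma ctang_traceless lam (hl : in_Lambda 2 r n lam) (Y : 'M[C]_(dimV 2 r n lam)) :
  \tr Y = 0 -> L (J lam *m Y *m (J lam)^T).
Proof.
move=> tY; have [d0|d0] := posnP (dimV 2 r n lam).
  suff -> : J lam *m Y *m (J lam)^T = 0 by apply: (ctang0 GG).
  by apply/matrixP => i j; rewrite !mxE big1 // => k; have := ltn_ord k; rewrite {2}d0.
pose x0 := Ordinal d0.
have nd x := @vpath_node r n lam hl x.
have off (x y : 'I_(dimV 2 r n lam)) : x != y -> L (eu R r n (vpath x) (vpath y)).
  move=> xy; by apply: (gd (nd x) (nd y)); rewrite (inj_eq (@vpath_inj r n lam)).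
have diag (x : 'I_(dimV 2 r n lam)) : L (eu R r n (vpath x) (vpath x) - eu R r n (vpath x0) (vpath x0)).
  have [->|xx] := eqVneq x x0; first by rewrite subrr; apply: (ctang0 GG).
  have := ctang_bracket GG (off _ _ xx) (off _ _ (_ : x0 != x)); rewrite eq_sym xx => /(_ isT).
  by rewrite !(eu_mulN R (leqnn n) (nd _) (nd _)) ?vpath_size.
have -> : J lam *m Y *m (J lam)^T = \sum_x \sum_y Y x y *:
    (eu R r n (vpath x) (vpath y) - (x == y)%:R *: eu R r n (vpath x0) (vpath x0)).
  rewrite {1}[Y]matrix_sum_delta mulmx_sumr mulmx_suml.
  under [RHS]eq_bigr do under eq_bigr do rewrite scalerBr.
  under [RHS]eq_bigr do rewrite sumrB.
  rewrite sumrB; set s := (X in _ = _ - X); have -> : s = 0.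
    rewrite /s; under eq_bigr do under eq_bigr do rewrite scalerA.
    transitivity (\tr Y *: eu R r n (vpath x0) (vpath x0)); last by rewrite tY scale0r.
    rewrite scaler_suml; apply: eq_bigr => x _; rewrite (bigD1 x) //= eqxx mulr1 big1 ?addr0 // => y yx.
    by rewrite eq_sym (negPf yx) mulr0 scale0r.
  rewrite subr0; apply: eq_bigr => x _; rewrite mulmx_sumr mulmx_suml; apply: eq_bigr => y _.
  by rewrite -scalemxAr -scalemxAl Jm_delta.
apply: (ctang_sum GG) => x _; apply: (ctang_sum GG) => y _; apply: (ctangZ GG).
have [<-|xy] := eqVneq x y; first by rewrite scale1r; apply: diag.
by rewrite scale0r subr0; apply: off.
Qed.

Definition adherent (M : 'M[C]_(np r n)) : Prop :=
  forall eps : R, 0 < eps -> exists2 g, Gr g & nm (g - M) < eps.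

Lemma sector_adherent lam (hl : in_Lambda 2 r n lam) (U : 'M[C]_(dimV 2 r n lam)) :
  special_unitary R _ U -> adherent (extend_id (J lam) U).
Proof.
case=> UU dU; have [P [th [PP UE sth]]] := spectral_special_unitary UU dU.
have JJ := @Jm_orthonormal R r n lam.
pose X := J lam *m rotation_gen P th *m (J lam)^T.
have tX : tang Gr X.
  apply: (ctang_tang GG).
    by apply: ctang_traceless => //; rewrite rotation_gen_trace // sth.
  by rewrite Jm_adj rotation_gen_skew // mulmxN mulNmx.
have [D D0 hD] := extend_rotation_taylor (J lam) th PP.
have -> : extend_id (J lam) U = extend_id (J lam) (rotation P th 1).
  by rewrite /rotation UE; congr extend_id; congr (_ *m diag_mx _ *m _); apply/rowP => j; rewrite !mxE mul1r.
set B := nm (J lam) * (nm (P^H) * nm P) * nm ((J lam)^T) * (dimV 2 r n lam)%:R + nm (1%:M - J lam *m (J lam)^T).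
apply: (@tang_exp R _ Gr GG X (fun t => extend_id (J lam) (rotation P th t)) B) => //.
- by rewrite /B addr_ge0 ?mulr_ge0 ?nm_ge0.
- by move=> t; apply: nm_extend_rotation.
- by rewrite rotation0 // extend_id1.
- by move=> s t; rewrite rotationD // extend_idM.
move=> eps e0; exists (Num.min 1 (eps / (D + 1))); first by rewrite lt_min ltr01 divr_gt0 // ltr_wpDl.
move=> t t0; rewrite lt_min => /andP[t1 te]; apply: (le_trans (hD t t0 (ltW t1))).
rewrite expr2 mulrA ler_wpM2r ?(ltW t0) //; have D1 : 0 < D + 1 by rewrite ltr_wpDl.
by move: te; rewrite ltr_pdivlMr // => te; apply: (le_trans _ (ltW te)); rewrite mulrC ler_wpM2l ?lerDl ?(ltW t0).
Qed.

Lemma adherentM M1 M2 : adherent M1 -> adherent M2 -> adherent (M1 *m M2).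
Proof.
move=> h1 h2 eps e0.
pose K := nm M1 + (np r n * np r n)%:R + 1.
have K0 : 0 < K by rewrite ltr_wpDl // addr_ge0 ?nm_ge0.
have ek : 0 < eps / (2 * K) by rewrite divr_gt0 // mulr_gt0.
have [g1 G1 n1] := h1 _ ek; have [g2 G2 n2] := h2 _ ek.
exists (g1 *m g2); first exact: (ugM GG).
have -> : g1 *m g2 - M1 *m M2 = (g1 - M1) *m g2 + M1 *m (g2 - M2).
  by rewrite mulmxBl mulmxBr addrA subrK.
apply: (le_lt_trans (nmD _ _)).
have ng2 := unitary_nm (ugU GG G2).
have l1 : nm ((g1 - M1) *m g2) <= eps / (2 * K) * (K - nm M1 - 1).
  apply: (le_trans (nmM _ _)); apply: ler_pM; rewrite ?nm_ge0 ?(ltW n1) //.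
  by rewrite /K addrAC addrK addrAC subrr add0r.
have l2 : nm (M1 *m (g2 - M2)) <= eps / (2 * K) * nm M1.
  by apply: (le_trans (nmM _ _)); rewrite mulrC; apply: ler_wpM2r; rewrite ?nm_ge0 ?(ltW n2).
apply: (le_lt_trans (lerD l1 l2)); rewrite -mulrDr.
have -> : K - nm M1 - 1 + nm M1 = K - 1 by ring.
apply: (@lt_trans _ _ (eps / (2 * K) * K)); first by rewrite ltr_pM2l // gtrBl.
have -> : eps / (2 * K) * K = eps / 2 by field; rewrite gt_eqF.
by rewrite ltr_pdivrMr // ltr_pMr // ltr1n.
Qed.

Lemma adherent1 : adherent 1%:M.
Proof. by move=> eps e0; exists 1%:M; rewrite ?subrr ?nm0 //; apply: (ug1 GG). Qed.

(** Each factor [extend_id] is the identity on all other sectors, so the sectors can be prescribed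
    one after the other by multiplication. *)
Lemma sectors_adherent (U : forall lam : seq nat, 'M[C]_(dimV 2 r n lam)) (ls : seq (seq nat)) :
  (forall lam, in_Lambda 2 r n lam -> special_unitary R _ (U lam)) ->
  all (in_Lambda 2 r n) ls -> uniq ls ->
  exists2 M, adherent M & forall lam, in_Lambda 2 r n lam ->
    M *m J lam = if lam \in ls then J lam *m U lam else J lam.
Proof.
move=> hU; elim: ls => [_ _|mu ls IH /= /andP[hm hs] /andP[ml us]].
  by exists 1%:M; [apply: adherent1 | move=> lam _; rewrite mul1mx].
have [M aM MJ] := IH hs us; exists (extend_id (J mu) (U mu) *m M).
  by apply: adherentM => //; apply: sector_adherent => //; apply: hU.
move=> lam hl; rewrite -mulmxA MJ // inE; have [->|lm] := eqVneq lam mu.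
  by rewrite (negPf ml) /= extend_id_J //; apply: Jm_orthonormal.
have E0 : extend_id (J mu) (U mu) *m J lam = J lam.
  have o : (J mu)^T *m J lam = 0 by apply: Jm_orthogonal => //; rewrite eq_sym.
  by rewrite /extend_id mulmxDl mulmxBl mul1mx -!mulmxA o !mulmx0 add0r subr0.
by rewrite /=; case: ifP => _; rewrite ?mulmxA E0.
Qed.

Lemma Lambda_finite : exists2 ls, uniq ls & forall lam, in_Lambda 2 r n lam = (lam \in ls).
Proof.
exists [seq lam <- [seq [:: (n - k)%N; k] | k <- iota 0 n.+1] | in_Lambda 2 r n lam].
  by rewrite filter_uniq // map_inj_uniq ?iota_uniq // => k l [].
move=> lam; rewrite mem_filter; case hl : in_Lambda => //; symmetry; apply/mapP.
have [l0 [l1 [-> l10 ln lr]]] := in_LambdaE hl; exists l1; first by rewrite mem_iota; lia.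
by congr [:: _; _]; lia.
Qed.

Lemma density (U : forall lam : seq nat, 'M[C]_(dimV 2 r n lam)) :
  (forall lam, in_Lambda 2 r n lam -> special_unitary R _ (U lam)) ->
  forall eps : R, 0 < eps ->
  exists w : seq (nat * bool), braid_word n w /\
    forall lam, in_Lambda 2 r n lam ->
      forall x y, `|rho_word R b 2 r n lam w x y - U lam x y| < eps%:C%C.
Proof.
move=> hU eps e0; have [ls uls hls] := Lambda_finite.
have als : all (in_Lambda 2 r n) ls by apply/allP => lam; rewrite hls.
have [M aM MJ] := sectors_adherent hU als uls.
have [_ [w hw ->] hn] := aM _ e0; exists w; split=> // lam hl x y.
have JJ := @Jm_orthonormal R r n lam.
have hM := MJ lam hl; rewrite -hls hl in hM.
(* Compression by the isometry J merely selects entries of the large matrix, so its norm bounds all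
   sectors at once. *)
have -> : rho_word R b 2 r n lam w x y - U lam x y =
    ((J lam)^T *m (repw R b r n w - M) *m J lam) x y.
  by rewrite mulmxBr mulmxBl -!mulmxA repw_Jm // hM !mulmxA JJ !mul1mx !mxE.
have [i hi] := pth_ex (vpath_adm x) (vpath_size x).
have [j hj] := pth_ex (vpath_adm y) (vpath_size y).
have -> : ((J lam)^T *m (repw R b r n w - M) *m J lam) x y = (repw R b r n w - M) i j.
  rewrite !mxE (bigD1 j) //= big1 ?addr0 => [|k kj]; last first.
    by rewrite !mxE -hj (inj_eq (@pth_inj r n)) (negPf kj) mulr0.
  rewrite !mxE -hj eqxx mulr1 (bigD1 i) //= big1 ?addr0 => [|k ki]; last first.
    by rewrite !mxE -hi (inj_eq (@pth_inj r n)) (negPf ki) mul0r.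
  by rewrite !mxE -hi eqxx mul1r.
by rewrite -cabsE ltcR; apply: le_lt_trans hn; apply: nm_entry.
Qed.

End Density.

(* The closure of rho_n^{(2,r)}(B_n) in prod_lam U(V_lam) contains
   prod_lam SU(V_lam): every family (U_lam) of special unitaries is a limit
   (entrywise, uniformly over the finitely many lam) of images of braids. *)
Theorem theorem0p1 (R : realType) (b : bool) (r n : nat) :
  ((5 <= r)%N /\ r <> 6%N /\ r <> 10%N /\ (3 <= n)%N) \/
  (r = 10%N /\ (5 <= n)%N) ->
  forall U : forall lam : seq nat, 'M[R[i]]_(dimV 2 r n lam),
  (forall lam, in_Lambda 2 r n lam -> special_unitary R _ (U lam)) ->
  forall eps : R, 0 < eps ->
  exists w : seq (nat * bool), braid_word n w /\
    forall lam, in_Lambda 2 r n lam ->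
      forall x y, `|rho_word R b 2 r n lam w x y - U lam x y| < eps%:C%C.
Proof.
move=> h U hU eps e0; apply: density => //.
  by case: h => [[]//|[-> _]].
exact: good_last h.
Qed.
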